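(* Let $q_1,q_2\in L_{1,1}$ and let $f_j(x,k)$ be the Jost solution corresponding to $q_j$, $j=1,2$. Then the pair $\{\ell_1,\ell_2\}$, $\ell_j=-\frac{d^2}{dx^2}+q_j$, has property $C_+$: if $h\in L^1(\mathbb{R}_+)$ and $$\int_0^\infty h(x)f_1(x,k)f_2(x,k)\,dx=0\qquad\text{for all } k>0,$$ then $h=0$.
   Context: $\mathbb{R}_+=[0,\infty)$. $L_{1,1}$ is the set of real-valued functions $q$ on $\mathbb{R}_+$ with $\int_0^\infty(1+x)|q(x)|\,dx<\infty$ and $q\in L^2(0,a)$ for every $a<\infty$. For $q\in L_{1,1}$ and $k$ with $\operatorname{Im}k\ge0$, the Jost solution $f(x,k)$ is the unique solution of $-f''+q(x)f=k^2f$, $x>0$, with $f(x,k)=e^{ikx}+o(1)$ as $x\to+\infty$; equivalently, for $k\neq0$, the solution of $f(x,k)=e^{ikx}+\int_x^\infty\frac{\sin[k(t-x)]}{k}q(t)f(t,k)\,dt$. *)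

(* Defs.v *)
(* MathComp-Analysis, with the complex numbers R[i] of mathcomp-real-closed. *)
From HB Require Import structures.
From mathcomp Require Import all_boot all_order all_algebra.
From mathcomp Require Import complex.
From mathcomp Require Import all_classical all_reals all_analysis.

Set Implicit Arguments.
Unset Strict Implicit.
Unset Printing Implicit Defensive.

Import Order.TTheory GRing.Theory Num.Theory.
Import numFieldNormedType.Exports.

Local Open Scope classical_set_scope.
Local Open Scope ring_scope.
Local Open Scope complex_scope.

(* A function on [0, +oo[ is represented by a function on R whose values on
   the negative half-line are never used. R[i] has no canonical topology,
   normed R-module or measurable structure, so limits, derivatives and
   integrals of complex-valued functions are taken componentwise. *)

Section Defs.
Context {R : realType}.
Implicit Types (q : R -> R) (h f g : R -> R[i]) (k z : R[i]).

Local Notation mu := (@lebesgue_measure R).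
(* Otherwise shadowed by the R[i]-valued 'Re and 'Im of numClosedFieldType. *)
Local Notation Re := (@complex.Re R).
Local Notation Im := (@complex.Im R).

Definition Rplus : set R := `[0, +oo[.

Definition L11 q : Prop :=
  [/\ measurable_fun Rplus q,
      mu.-integrable Rplus (fun x => ((1 + x) * `|q x|)%:E) &
      forall a : R, mu.-integrable `]0, a[ (fun x => (q x ^+ 2)%:E)].

Definition L1plus h : Prop :=
  mu.-integrable Rplus (fun x => (Re (h x))%:E) /\
  mu.-integrable Rplus (fun x => (Im (h x))%:E).

Definition cintegral (D : set R) f : R[i] :=
  (\int[mu]_(x in D) Re (f x)) +i* (\int[mu]_(x in D) Im (f x)).

Definition cexp z : R[i] :=
  (expR (Re z) * cos (Im z)) +i* (expR (Re z) * sin (Im z)).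

Definition is_cderive (x : R) f (d : R[i]) : Prop :=
  is_derive x (1 : R) (fun t => Re (f t)) (Re d) /\
  is_derive x (1 : R) (fun t => Im (f t)) (Im d).

Definition ccvg_pinfty f (l : R[i]) : Prop :=
  (Re (f x) @[x --> +oo] --> Re l) /\ (Im (f x) @[x --> +oo] --> Im l).

Definition abs_continuous (a b : R) (F : R -> R) : Prop :=
  forall e : R, 0 < e -> exists2 d : R, 0 < d &
    forall (n : nat) (u v : 'I_n -> R),
      (forall i, [/\ a <= u i, u i <= v i & v i <= b]) ->
      trivIset setT (fun i => `]u i, v i[%classic) ->
      \sum_(i < n) (v i - u i) < d ->
      \sum_(i < n) `|F (v i) - F (u i)| < e.

(* - f'' + q f = k ^ 2 f on ]0, +oo[. As q is only locally integrable, a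
   solution is a differentiable f whose derivative g is locally absolutely
   continuous, the equation holding almost everywhere. *)
Definition schrodinger_solution q k f : Prop :=
  exists g : R -> R[i],
    [/\ forall x : R, 0 < x -> is_cderive x f (g x),
        forall a b : R, 0 < a -> a <= b ->
          abs_continuous a b (fun x => Re (g x)) /\
          abs_continuous a b (fun x => Im (g x)) &
        {ae mu, forall x : R, 0 < x -> exists2 g' : R[i],
          is_cderive x g g' & - g' + (q x)%:C * f x = k ^+ 2 * f x}].

(* The asymptotics are f(x) = e^{ikx} (1 + o(1)). For real k this says
   f(x) = e^{ikx} + o(1), since |e^{ikx}| = 1; for Im k > 0 an additive o(1)
   would be compatible with every multiple of f. The
   imaginary unit is written 0 +i* 1 because 'i denotes Num.imaginary, which is
   specified only up to sign. *)
Definition jost_solution q k f : Prop :=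
  schrodinger_solution q k f /\
  ccvg_pinfty (fun x => f x / cexp ((0 +i* 1) * k * x%:C)) 1.

Definition jost_family q (f : R -> R[i] -> R[i]) : Prop :=
  forall k : R[i], 0 <= Im k -> jost_solution q k (f ^~ k).

Definition property_Cplus q1 q2 : Prop :=
  forall f1 f2 : R -> R[i] -> R[i],
    jost_family q1 f1 -> jost_family q2 f2 ->
    forall h : R -> R[i], L1plus h ->
      (forall k : R, 0 < k ->
         cintegral Rplus (fun x => h x * f1 x k%:C * f2 x k%:C) = 0) ->
      {ae mu, forall x : R, Rplus x -> h x = 0}.

End Defs.

(* Main.v *)
(* Put Psi(s) = Re \int_0^oo (a + ib)(k) e^{iks} dk. Replacing e^{ikx} by a Jost
   solution f(x,k), the Volterra equation for f and Gronwall's lemma give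
   Re \int_0^oo (a + ib)(k) f(x,k) e^{ik(s-x)} dk = Psi(s) + O(\int_s^oo |Psi|),
   which is what the transformation operator of f would give, without its
   kernel being constructed. Applying this to f_1 and then to f_2 yields
   Re \int_0^oo (a + ib)(k) f_1 f_2 dk = Psi(2x) + O(\int_{2x}^oo |Psi|).
   Hence the orthogonality relations, multiplied by a + ib and integrated over k,
   imply |\int h(x) Psi(2x) dx| <= K \int |h(x)| \int_{2x}^oo |Psi| dx for the real
   and imaginary parts of h, first when the conjugate transform of (a, b)
   vanishes and then in the limit. Polynomials in beta/(s + beta) without
   constant term arise as such limits, from (a + ib)(k) = polynomial times
   e^{-eps k} with eps -> 0, and they suffice to approximate the indicator
   function of an interval, so that
   |\int_x^y h| <= 2K (y - x) \int_0^y |h|. Therefore |h(x)| <= 2K \int_0^x |h|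
   almost everywhere, which forces h = 0. *)
Require Import Defs.
From HB Require Import structures.
From mathcomp Require Import all_boot all_order all_algebra.
From mathcomp Require Import complex.
From mathcomp Require Import all_classical all_reals all_analysis.
From mathcomp Require Import measurable_realfun.
From mathcomp Require Import ring lra.

Set Implicit Arguments.
Unset Strict Implicit.
Unset Printing Implicit Defensive.

Import Order.TTheory GRing.Theory Num.Theory.
Import numFieldNormedType.Exports.

Local Open Scope classical_set_scope.
Local Open Scope ring_scope.


(** * Integrals of real functions *)

Section integration.
Context {R : realType}.
Local Notation mu := (@lebesgue_measure R).
Implicit Types (D E : set (measurableTypeR R)) (f g : R -> R).

(** The gain comes from two orders of smallness. If Psi is close to the indicator function of ]2x,
    2y[, its tail integral is at most about 2(y - x) and nearly vanishes beyond 2y, so the transport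
    error only sees |h| before y and carries the factor y - x.

    For complex h the relations mix its parts: their real part is the integral of h1 Re F - h2 Im F,
    with F the k-integral of (a + ib) f_1 f_2. Isolating h1 requires Im F to be small too. Since -
    Im F belongs to i(a + ib), that is to the pair (-b, a), the same transport estimate controls it,
    provided that the transform of (-b, a) is small.

    On s >= 0 the real function beta/(s + beta) is formally the transform of - i beta e^{i beta k}.
    This density is not integrable, its pole -beta being real. The factor e^{-eps k} pushes the pole
    into the lower half-plane and costs errors of order eps (1 + s)^(-2) in both parts. These errors
    are integrable in s, as they must be, because the transport estimate involves tail integrals. *)

Definition integrableR D f := mu.-integrable D (EFin \o f).

Lemma integrableR_meas D f : integrableR D f -> measurable_fun D f.
Proof. by move=> /integrableP[/measurable_EFinP]. Qed.

Lemma le_integrableR D f g : measurable D -> measurable_fun D f ->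
  (forall x, D x -> `|f x| <= g x) -> integrableR D g -> integrableR D f.
Proof.
move=> mD mf fg ig; apply: (le_integrable _ _ _ ig) => //; first exact/measurable_EFinP.
by move=> x Dx /=; rewrite lee_fin (le_trans (fg x Dx))// ler_norm.
Qed.

Lemma integrableRS D E f : measurable D -> measurable E -> E `<=` D ->
  integrableR D f -> integrableR E f.
Proof. by move=> mD mE ED; exact: integrableS. Qed.

Lemma integrableRD D f g : measurable D -> integrableR D f -> integrableR D g ->
  integrableR D (fun x => f x + g x).
Proof. by move=> mD fi gi; have := integrableD mD fi gi. Qed.

Lemma integrableRB D f g : measurable D -> integrableR D f -> integrableR D g ->
  integrableR D (fun x => f x - g x).
Proof. by move=> mD fi gi; have := integrableB mD fi gi. Qed.

Lemma integrableRZl D (c : R) f : measurable D -> integrableR D f ->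
  integrableR D (fun x => c * f x).
Proof. by move=> mD fi; have := integrableZl mD c fi. Qed.

Lemma integrableR_norm D f : integrableR D f -> integrableR D (fun x => `|f x|).
Proof. exact: integrable_norm. Qed.

Lemma integrableR_eq D f g : measurable D -> (forall x, D x -> f x = g x) ->
  integrableR D f -> integrableR D g.
Proof.
move=> mD fg; apply: eq_integrable => // x /set_mem Dx /=.
by rewrite fg.
Qed.

Lemma integrableR_patch D f : measurable D -> integrableR D f ->
  integrableR setT (f \_ D).
Proof.
move=> mD fi; rewrite /integrableR -restrict_EFin.
exact: (integrable_mkcond _ mD).1.
Qed.

Lemma Rintegral_eq D f g : (forall x, D x -> f x = g x) ->
  \int[mu]_(x in D) f x = \int[mu]_(x in D) g x.
Proof. by move=> fg; apply: eq_Rintegral => x /set_mem; exact: fg. Qed.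

Lemma le_norm_Rintegral D f g : measurable D -> measurable_fun D f ->
  (forall x, D x -> `|f x| <= g x) -> integrableR D g ->
  `|\int[mu]_(x in D) f x| <= \int[mu]_(x in D) g x.
Proof.
move=> mD mf fg ig; have fi := le_integrableR mD mf fg ig.
apply: (le_trans (le_normr_Rintegral _ _)) => //.
by apply: le_Rintegral => //; exact: integrableR_norm.
Qed.

Lemma Rdominated_convergence D (f_ : nat -> R -> R) f g : measurable D ->
  (forall n, measurable_fun D (f_ n)) ->
  (forall x, D x -> f_ ^~ x @ \oo --> f x) ->
  integrableR D g -> (forall n x, D x -> `|f_ n x| <= g x) ->
  integrableR D f /\
  (fun n => \int[mu]_(x in D) f_ n x) @ \oo --> \int[mu]_(x in D) f x.
Proof.
move=> mD mf_ cvf ig dom.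
have mf : measurable_fun D f by exact: (measurable_fun_cvg mf_ cvf).
have [|||||fi _ cv] := @dominated_convergence _ _ _ mu D mD
  (fun n x => (f_ n x)%:E) (EFin \o f) (EFin \o g).
- by move=> n; exact/measurable_EFinP.
- exact/measurable_EFinP.
- apply: aeW => x Dx; apply: cvg_EFin; first exact: nearW.
  exact: cvf.
- exact: ig.
- by apply: aeW => n x Dx; rewrite lee_fin dom.
split=> //.
have /fine_cvgP[_] : (fun n => (\int[mu]_(x in D) (f_ n x)%:E)%E) @ \oo -->
    (fine (\int[mu]_(x in D) (f x)%:E)%E)%:E.
  by rewrite fineK//; exact: integrable_fin_num.
exact.
Qed.

(** The separated majorant makes the extension of [f] by zero integrable for the product measure, so
    that Fubini's theorem applies on the whole plane. *)
Lemma Rfubini (D1 D2 : set (measurableTypeR R)) (f : R -> R -> R) (a b : R -> R) :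
  measurable D1 -> measurable D2 ->
  measurable_fun (D1 `*` D2) (fun z => f z.1 z.2) ->
  integrableR D1 a -> integrableR D2 b ->
  (forall x y, D1 x -> D2 y -> `|f x y| <= a x * b y) ->
  [/\ integrableR D1 (fun x => \int[mu]_(y in D2) f x y),
      integrableR D2 (fun y => \int[mu]_(x in D1) f x y) &
      \int[mu]_(x in D1) \int[mu]_(y in D2) f x y =
      \int[mu]_(y in D2) \int[mu]_(x in D1) f x y].
Proof.
move=> mD1 mD2 mf ia ib fab.
pose F := (fun z : R * R => (f z.1 z.2)%:E) \_ (D1 `*` D2).
have mD12 : measurable (D1 `*` D2) by exact: measurableX.
have mF : measurable_fun setT F.
  by apply/(measurable_restrictT _ mD12); exact/measurable_EFinP.
have FE x y : D1 x -> F (x, y) = ((fun y => (f x y)%:E) \_ D2) y.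
  move=> Dx; rewrite /F !patchE; congr (if _ then _ else _).
  by apply/idP/idP; rewrite !inE/= => // -[].
have FE' x y : D2 y -> F (x, y) = ((fun x => (f x y)%:E) \_ D1) x.
  move=> Dx; rewrite /F !patchE; congr (if _ then _ else _).
  by apply/idP/idP; rewrite !inE/= => // -[].
have F0 x y : ~ D1 x -> F (x, y) = 0%E.
  by move=> nD; rewrite /F patchE memNset//= => -[].
have F0' x y : ~ D2 y -> F (x, y) = 0%E.
  by move=> nD; rewrite /F patchE memNset//= => -[].
have mfx x : D1 x -> measurable_fun D2 (f x).
  move=> Dx; apply/measurable_EFinP/(measurable_restrictT _ mD2).
  have -> : (EFin \o f x) \_ D2 = F \o pair x.
    by apply/funext => y /=; rewrite FE.
  exact: measurableT_comp.
have mfy y : D2 y -> measurable_fun D1 (f ^~ y).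
  move=> Dx; apply/measurable_EFinP/(measurable_restrictT _ mD1).
  have -> : (EFin \o (f ^~ y)) \_ D1 = F \o (pair^~ y).
    by apply/funext => x /=; rewrite FE'.
  exact: measurableT_comp.
have ifx x : D1 x -> integrableR D2 (f x).
  move=> Dx; apply: (@le_integrableR _ _ (fun y => a x * b y)) => //.
  - exact: mfx.
  - by move=> y; exact: fab.
  - exact: integrableRZl.
have ify y : D2 y -> integrableR D1 (f ^~ y).
  move=> Dy; apply: (@le_integrableR _ _ (fun x => b y * a x)) => //.
  - exact: mfy.
  - by move=> x Dx; rewrite mulrC; exact: fab.
  - exact: integrableRZl.
have iF : (mu \x mu)%E.-integrable setT F.
  apply/integrable12ltyP => //.
  apply: (@le_lt_trans _ _ (\int[mu]_x ((fun x => (`|a x| * \int[mu]_(y in D2) `|b y|)%:E) \_ D1) x)%E); last first.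
    rewrite -integral_mkcond.
    have : integrableR D1 (fun x => (\int[mu]_(y in D2) `|b y|) * `|a x|).
      by apply: integrableRZl => //; exact: integrableR_norm.
    move=> /integrableP[_]; apply: le_lt_trans; apply: ge0_le_integral => //.
    - by move=> x _; rewrite lee_fin mulr_ge0// Rintegral_ge0.
    - apply/measurable_EFinP; apply: measurable_funM => //.
      by apply: measurableT_comp => //; exact: integrableR_meas.
    - apply: measurableT_comp => //; apply/measurable_EFinP; apply: measurable_funM => //.
      by apply: measurableT_comp => //; exact: integrableR_meas.
    - by move=> x _ /=; rewrite lee_fin mulrC ler_norm.
  apply: ge0_le_integral => //.
  - by move=> x _; exact: integral_ge0.
  - apply: (measurable_fun_fubini_tonelli_F (fun z => `|F z|%E)) => //.
    exact: measurableT_comp.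
  - apply/(measurable_restrictT _ mD1); apply/measurable_EFinP; apply: measurable_funM => //.
      by apply: measurableT_comp => //; exact: integrableR_meas.
  - move=> x _; rewrite patchE; case: ifPn => [|]; last first.
      move/negP; rewrite inE => nD.
      by under eq_integral do rewrite F0// abse0; rewrite integral0.
    rewrite inE => Dx.
    under eq_integral do rewrite FE//.
    have -> : (\int[mu]_y `|((fun y => (f x y)%:E) \_ D2) y| =
        \int[mu]_(y in D2) `|(f x y)%:E|)%E.
      rewrite [RHS]integral_mkcond; apply: eq_integral => y _.
      by rewrite !patchE; case: ifP => // _; rewrite abse0.
    rewrite EFinM -(@fineK _ (\int[mu]_(y in D2) `|f x y|%:E)%E); last first.
      by apply: integrable_fin_num => //; exact: integrableR_norm (ifx x Dx).
    rewrite -EFinM lee_fin -[X in X <= _]/(\int[mu]_(y in D2) `|f x y|) -RintegralZl//; last exact: integrableR_norm.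
    apply: le_Rintegral => //.
    - exact: integrableR_norm (ifx x Dx).
    - by apply: integrableRZl => //; exact: integrableR_norm.
    - by move=> y Dy; apply: (le_trans (fab _ _ Dx Dy)); rewrite -normrM ler_norm.
have intxE x : (\int[mu]_y F (x, y) = ((fun x => (\int[mu]_(y in D2) f x y)%:E) \_ D1) x)%E.
  rewrite patchE; case: ifPn => [|/negP]; rewrite inE => Dx; last first.
    by under eq_integral do rewrite F0//; rewrite integral0.
  under eq_integral do rewrite FE//.
  rewrite -integral_mkcond /Rintegral fineK//.
  exact: (integrable_fin_num _ (ifx x Dx)).
have intyE y : (\int[mu]_x F (x, y) = ((fun y => (\int[mu]_(x in D1) f x y)%:E) \_ D2) y)%E.
  rewrite patchE; case: ifPn => [|/negP]; rewrite inE => Dx; last first.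
    by under eq_integral do rewrite F0'//; rewrite integral0.
  under eq_integral do rewrite FE'//.
  rewrite -integral_mkcond /Rintegral fineK//.
  exact: (integrable_fin_num _ (ify y Dx)).
split.
- have := integrable_fubini_F iF; rewrite /fubini_F.
  under eq_fun do rewrite intxE.
  by move/(integrable_mkcond _ mD1).
- have mG : measurable_fun D2 (fun y => \int[mu]_(x in D1) f x y).
    have := measurable_fubini_G iF; rewrite /fubini_G.
    under eq_fun do rewrite intyE.
    by move/(measurable_restrictT _ mD2)/measurable_EFinP.
  apply: (@le_integrableR _ _ (fun y => (\int[mu]_(x in D1) a x) * b y)) => //.
    move=> y Dy; rewrite mulrC -RintegralZl//; apply: le_norm_Rintegral => //.
    - exact: mfy.
    - by move=> x Dx; rewrite mulrC; exact: fab.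
    - exact: integrableRZl.
  exact: integrableRZl.
- have := Fubini iF.
  under eq_integral do rewrite intxE.
  under [RHS]eq_integral do rewrite intyE.
  rewrite -!integral_mkcond => E.
  by rewrite /Rintegral -/(Rintegral _ _) E.
Qed.

End integration.

(** * Derivatives of absolutely continuous functions *)

Section absolute_continuity.
Context {R : realType}.
Local Notation mu := (@lebesgue_measure R).
Implicit Types (F : R -> R) (a b : R).

Lemma is_derive0_small F (x e : R) : is_derive x 1 F 0 -> 0 < e ->
  exists2 d : R, 0 < d & forall y, `|y - x| < d -> `|F y - F x| <= e * `|y - x|.
Proof.
move=> [dF vF] e0.
have /cvgrPdist_lt/(_ e e0) : h^-1 *: ((F \o shift x) (h *: 1) - F x) @[h --> 0^'] --> (0 : R).
  by rewrite -[X in _ --> X]vF; exact: dF.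
rewrite near_withinE => /nbhs_ballP[d /= d0 H]; exists d => // y yd.
have [->|yx] := eqVneq y x; first by rewrite !subrr normr0 mulr0.
have := H (y - x); rewrite /ball/= sub0r normrN => /(_ yd).
rewrite subr_eq0 => /(_ yx) /ltW.
rewrite sub0r normrN /GRing.scale/= mulr1 normrM normfV subrK.
by rewrite ler_pdivrMl ?normr_gt0 ?subr_eq0// mulrC.
Qed.

Definition chain a b (s : seq (R * R)) :=
  all (fun p => (a <= p.1) && (p.1 <= p.2) && (p.2 <= b)) s &&
  pairwise (fun p q => q.2 <= p.1) s.

Lemma chain_trivIset a b s : chain a b s ->
  trivIset setT (fun i : 'I_(size s) => `](tnth (in_tuple s) i).1, (tnth (in_tuple s) i).2[%classic).
Proof.
move=> /andP[_ /(pairwiseP (0, 0)) ps].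
have key (i j : 'I_(size s)) x : (i < j)%N ->
    (tnth (in_tuple s) i).1 < x < (tnth (in_tuple s) i).2 ->
    (tnth (in_tuple s) j).1 < x < (tnth (in_tuple s) j).2 -> False.
  move=> ij; rewrite !(tnth_nth (0, 0))/= => /andP[ix _] /andP[_ xj].
  have := ps _ _ (ltn_ord i) (ltn_ord j) ij; rewrite leNgt => /negP; apply.
  exact: lt_trans xj.
apply/trivIsetP => i j _ _ /eqP ij; apply/seteqP; split => // x /=.
rewrite !in_itv/= => -[xi xj].
have [lij|lij|eij] := ltngtP i j.
- exact: (key _ _ _ lij xi xj).
- exact: (key _ _ _ lij xj xi).
- by apply: ij; exact: val_inj.
Qed.

Lemma lebesgue_measure_oo a b : a <= b -> mu `]a, b[ = (b - a)%:E.
Proof.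
move=> ab; rewrite lebesgue_measure_itv/= lte_fin; case: ltP => // ba.
by congr EFin; apply/esym/eqP; rewrite subr_eq0 eq_le ab ba.
Qed.

Lemma lebesgue_measure_oc a b : a <= b -> mu `]a, b] = (b - a)%:E.
Proof.
move=> ab; rewrite lebesgue_measure_itv/= lte_fin; case: ltP => // ba.
by congr EFin; apply/esym/eqP; rewrite subr_eq0 eq_le ab ba.
Qed.

Lemma chain_length a b s (U : set (measurableTypeR R)) : chain a b s -> measurable U ->
  (forall p, p \in s -> `]p.1, p.2[%classic `<=` U) ->
  ((\sum_(p <- s) (p.2 - p.1))%:E <= mu U)%E.
Proof.
move=> cs mU sU.
set I := fun i : 'I_(size s) => `](tnth (in_tuple s) i).1, (tnth (in_tuple s) i).2[%classic.
have mI : measurable (\big[setU/set0]_(i < size s) I i).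
  by apply: bigsetU_measurable => i _; exact: measurable_itv.
have E : (\sum_(p <- s) (p.2 - p.1))%:E = mu (\big[setU/set0]_(i < size s) I i).
  rewrite measure_semi_additive_ord//; last 2 first.
    by move=> k; exact: measurable_itv.
    exact: (chain_trivIset cs).
  rewrite big_tnth -sumEFin; apply: eq_bigr => i _.
  move: cs => /andP[/allP/(_ _ (mem_tnth i (in_tuple s)))/andP[/andP[_ le12] _] _].
  exact/esym/lebesgue_measure_oo.
rewrite E; apply: le_measure; rewrite ?inE//.
move=> x; rewrite -bigcup_seq/= => -[i _ xi]; apply: sU xi.
exact: (mem_tnth i (in_tuple s)).
Qed.

(** Absolute continuity tested on ordered lists of intervals, which can be lengthened one interval
    at a time. *)
Definition chain_continuous a b F := forall e : R, 0 < e -> exists2 d : R, 0 < d &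
  forall s, chain a b s -> \sum_(p <- s) (p.2 - p.1) < d ->
    \sum_(p <- s) `|F p.2 - F p.1| < e.

Lemma abs_continuous_chain a b F : abs_continuous a b F -> chain_continuous a b F.
Proof.
move=> acF e e0; have [d d0 H] := acF e e0; exists d => // s cs.
have tE (g : R * R -> R) :
  \sum_(p <- s) g p = \sum_(i < size s) g (tnth (in_tuple s) i) by exact: big_tnth.
rewrite !tE => sd.
apply: (H _ (fun i => (tnth (in_tuple s) i).1) (fun i => (tnth (in_tuple s) i).2)) => //.
  move=> i.
  move: cs => /andP[/allP/(_ _ (mem_tnth i (in_tuple s)))/andP[/andP[]]]; split => //.
exact: (chain_trivIset cs).
Qed.

(* Cover the exceptional null set by an open set of small measure and walk from
   [a] to [b]: each step is controlled either by the zero derivative or by the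
   absolute continuity of [F] on the open set. *)
Lemma chain_continuous_cst a b F : a <= b -> chain_continuous a b F ->
  {ae mu, forall x, a < x < b -> is_derive x 1 F 0} -> F a = F b.
Proof.
move=> ab acF [N0 [mN0 N00 subN0]].
suff small e : 0 < e -> `|F b - F a| <= e * (b - a) + e.
  apply/eqP; rewrite eq_sym -subr_eq0 -normr_le0; apply/ler_addgt0Pr => e e0.
  have ba0 : 0 < b - a + 1 by rewrite ltr_wpDl// subr_ge0.
  have e'0 : 0 < e / (b - a + 1) by exact: divr_gt0.
  rewrite add0r; apply: (le_trans (small _ e'0)).
  by rewrite -[X in _ + X]mulr1 -mulrDr divfK// gt_eqF.
move=> e0; have [d d0 acFd] := acF e e0.
(* The derivative is only known inside the open interval, so both endpoints join the exceptional
   set. *)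
pose N : set (measurableTypeR R) := N0 `|` [set a] `|` [set b].
have mN : measurable N by apply: measurableU => //; exact: measurableU.
have N00' : mu N = 0%E.
  apply/eqP; rewrite -measure_le0.
  have Na0 : (mu (N0 `|` [set a]) <= 0)%E.
    have A0 : (mu N0 + mu [set a] <= 0)%E by rewrite N00 lebesgue_measure_set1 add0e.
    by apply: le_trans A0; exact: measureU2.
  have A0 : (mu (N0 `|` [set a]) + mu [set b] <= 0)%E by rewrite lebesgue_measure_set1 adde0.
  by apply: le_trans A0; apply: measureU2 => //; exact: measurableU.
have [U [oU NU UN]] : exists U : set R, [/\ open U, N `<=` U & (mu (U `\` N) < d%:E)%E].
  have muN : (mu N < +oo)%E by rewrite N00'.
  have [U [oU NU UN]] := lebesgue_regularity_outer mN muN d0.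
  by exists U.
have mU : measurable (U : set (measurableTypeR R)) by exact: open_measurable.
have muU : (mu U < d%:E)%E.
  rewrite -(setDUK NU) setUC measureU0//; exact: measurableD.
(* The walk has reached [x]: slope at most [e] where the derivative vanishes, and a chain inside [U]
   for the rest. Since [U] has measure less than [d], the chain contributes less than [e] in the
   end. *)
pose E x := exists2 s, chain a x s & (forall p, p \in s -> `]p.1, p.2[%classic `<=` U) /\
  `|F x - F a| <= e * (x - a) + \sum_(p <- s) `|F p.2 - F p.1|.
have Ea : E a.
  by exists [::] => //; split => //; rewrite !subrr normr0 mulr0 big_nil addr0.
(* Every point [c] can be crossed. In [U] the crossing is added to the chain; outside [U] the
   derivative at [c] is 0, and the increments on both sides of [c] are compared with [F c]. *)
have local c : a <= c <= b -> exists2 r, 0 < r & forall x y,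
    a <= x <= c -> c <= y <= b -> c - r < x -> y < c + r -> E x -> E y.
  move=> /andP[ac cb].
  have [Uc|nUc] := pselect (U c).
    have /nbhs_ballP[r /= r0 rU] : nbhs c U by exact: open_nbhs_nbhs.
    exists r => // x y /andP[ax xc] /andP[cy yb] rx yr [s cs [sU sF]].
    have xy : x <= y by exact: le_trans cy.
    exists ((x, y) :: s); last split.
    - move: cs => /andP[sa sp]; rewrite /chain/= sp ax xy lexx/= andbT.
      apply/andP; split; apply/allP => p /(allP sa)/andP[/andP[p1 p2] p3].
        by rewrite p1 p2 (le_trans p3).
      by [].
    - move=> p; rewrite inE => /predU1P[->/=|]; last exact: sU.
      move=> z /=; rewrite in_itv/= => /andP[xz zy]; apply: rU => /=.
      by rewrite /ball/= ltr_norml; apply/andP; split; lra.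
    - rewrite big_cons/= (_ : F y - F a = (F y - F x) + (F x - F a)); last by ring.
      rewrite (le_trans (ler_normD _ _))//.
      have : e * (x - a) <= e * (y - a) by rewrite ler_pM2l// lerB.
      by move: sF; lra.
  have ac' : a < c by rewrite lt_neqAle ac andbT; apply/eqP => Eac; apply: nUc; apply: NU; left; right.
  have cb' : c < b by rewrite lt_neqAle cb andbT; apply/eqP => Eac; apply: nUc; apply: NU; right.
  have dFc : is_derive c 1 F 0.
    apply: contrapT => nd; apply: nUc; apply: NU; left; left; apply: subN0 => /= H.
    by apply: nd; apply: H; rewrite ac' cb'.
  have [r r0 rF] := is_derive0_small dFc e0.
  exists r => // x y /andP[ax xc] /andP[cy yb] rx yr [s cs [sU sF]].
  exists s; last split => //.
    move: cs => /andP[sa sp]; rewrite /chain sp andbT.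
    apply/allP => p /(allP sa)/andP[/andP[p1 p2] p3].
    by rewrite p1 p2 (le_trans p3)// (le_trans xc).
  have Fx : `|F x - F c| <= e * (c - x).
    by rewrite -(ger0_norm (_ : 0 <= c - x)) ?subr_ge0// [`|c - x|]distrC rF// ler0_norm ?subr_le0//; lra.
  have Fy : `|F y - F c| <= e * (y - c).
    by rewrite -(ger0_norm (_ : 0 <= y - c)) ?subr_ge0// rF// ger0_norm ?subr_ge0//; lra.
  rewrite (_ : F y - F a = (F y - F c) - (F x - F c) + (F x - F a)); last by ring.
  rewrite (le_trans (ler_normD _ _))//.
  have := ler_normB (F y - F c) (F x - F c).
  by move: sF; lra.
pose S := [set x | a <= x <= b /\ E x].
have Sa : S a by split => //; rewrite lexx.
have supS : has_sup S by split; [exists a|exists b => x [/andP[]]].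
have aS : a <= sup S by apply: sup_upper_bound.
have Sb : sup S <= b by apply: sup_le_ub; [exists a|move=> x [/andP[]]].
have [r r0 loc] : exists2 r, 0 < r & forall x y,
    a <= x <= sup S -> sup S <= y <= b -> sup S - r < x -> y < sup S + r -> E x -> E y.
  by apply: local; rewrite aS.
have [x [/andP[ax xb] Ex] xr] := sup_adherent r0 supS.
have xS : x <= sup S by apply: sup_upper_bound => //; split => //; rewrite ax.
have Eb : E b.
  pose y := Num.min b (sup S + r / 2).
  have yb : y <= b by rewrite ge_min lexx.
  have Sy : sup S <= y by rewrite le_min Sb/= lerDl divr_ge0// ltW.
  have Ey : E y.
    apply: (loc x) => //; [by rewrite ax|by rewrite Sy|].
    by rewrite gt_min; apply/orP; right; rewrite ltrD2l ltr_pdivrMr// mulr_natr mulr2n ltrDl.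
  have yS : y <= sup S.
    by apply: sup_upper_bound => //; split => //; rewrite yb (le_trans aS).
  move: yS; rewrite ge_min => /orP[bS|]; last by rewrite gerDl leNgt divr_gt0.
  by rewrite (_ : b = y)//; apply/eqP; rewrite eq_le yb (le_trans bS).
have [s cs [sU sF]] := Eb.
apply: (le_trans sF); rewrite lerD2l ltW// acFd//.
by rewrite -lte_fin (le_lt_trans _ muU)// (chain_length cs).
Qed.

Lemma chain_continuousB a b F G :
  chain_continuous a b F -> chain_continuous a b G ->
  chain_continuous a b (fun x => F x - G x).
Proof.
move=> cF cG e e0.
have e20 : 0 < e / 2 by exact: divr_gt0.
have [d1 d10 H1] := cF _ e20; have [d2 d20 H2] := cG _ e20.
exists (Num.min d1 d2); first by rewrite lt_min d10.
move=> s cs; rewrite lt_min => /andP[sd1 sd2].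
rewrite [e](splitr e); apply: le_lt_trans (ltrD (H1 _ cs sd1) (H2 _ cs sd2)).
rewrite -big_split/=; apply: ler_sum => p _.
by rewrite (_ : _ - _ = (F p.2 - F p.1) - (G p.2 - G p.1)) ?ler_normB//; ring.
Qed.

Lemma chain_continuous_integral a b (phi : R -> R) : mu.-integrable setT (EFin \o phi) ->
  chain_continuous a b (fun x => \int[mu]_(t in `]-oo, x]) phi t).
Proof.
move=> iphi e e0; have [d [d0 H]] := integral_normr_continuous iphi e0.
exists d => // s cs sd.
pose I := fun p : R * R => `]p.1, p.2]%classic : set (measurableTypeR R).
have step p : p \in s ->
    `|\int[mu]_(t in `]-oo, p.2]) phi t - \int[mu]_(t in `]-oo, p.1]) phi t| <=
    \int[mu]_(t in I p) `|phi t|.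
  move=> ps; have p12 : p.1 <= p.2.
    by move: cs => /andP[/allP/(_ _ ps)/andP[/andP[]]].
  rewrite (@Rintegral_itvB _ phi -oo%O (BRight p.2) p.1)//.
    by apply: le_normr_Rintegral => //; exact: integrableS iphi.
  exact: integrableS iphi.
(* Degenerate intervals contribute nothing. Without them the list has no repetition, and its members
   can index a disjoint family. *)
have [u [su us]] : exists u, (forall p, p \in u -> p.1 < p.2) /\ 
   [/\ chain a b u, \sum_(p <- s) (p.2 - p.1) = \sum_(p <- u) (p.2 - p.1) & 
   \sum_(p <- s) \int[mu]_(t in I p) `|phi t| = \sum_(p <- u) \int[mu]_(t in I p) `|phi t|].
  exists (seq.filter (fun p => p.1 < p.2) s); split.
    by move=> p; rewrite mem_filter => /andP[].
  have s0 p : p \in s -> ~~ (p.1 < p.2) -> p.1 = p.2.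
    move=> ps; rewrite -leNgt => le21; apply/eqP; rewrite eq_le le21 andbT.
    by move: cs => /andP[/allP/(_ _ ps)/andP[/andP[]]].
  split.
  - move: cs => /andP[sa sp]; apply/andP; split; last exact: pairwise_filter.
    by apply/allP => p; rewrite mem_filter => /andP[_ /(allP sa)].
  - rewrite big_filter [LHS](bigID (fun p => p.1 < p.2))/= [X in _ + X]big_seq_cond [X in _ + X]big1 ?addr0//.
    by move=> p /andP[ps /(s0 _ ps) ->]; rewrite subrr.
  - rewrite big_filter [LHS](bigID (fun p => p.1 < p.2))/= [X in _ + X]big_seq_cond [X in _ + X]big1 ?addr0//.
    move=> p /andP[ps /(s0 _ ps) E]; rewrite /I E set_itvoc0//; exact: Rintegral_set0.
have [cu su1 su2] := us.
have us_uniq : uniq u.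
  move: cu => /andP[_ ]; elim: u su {us su1 su2} => //= p u ih su /andP[pu pw].
  rewrite ih ?andbT//; last by move=> q qu; apply: su; rewrite inE qu orbT.
  apply/negP => /(allP pu); rewrite leNgt => /negP; apply.
  by apply: su; rewrite inE eqxx.
have tI : trivIset [set` u] I.
  have tu := cu; move: tu => /andP[_ /(pairwiseP (0, 0)) ps].
  apply/trivIsetP => p q /= pu qu pq; apply/seteqP; split => // x /=.
  rewrite /I/= !in_itv/= => -[/andP[px xp] /andP[qx xq]].
  have := ps (index p u) (index q u); have := ps (index q u) (index p u).
  rewrite !inE !index_mem pu qu !nth_index// => /(_ isT isT) A /(_ isT isT) B.
  have [lt|lt|] := ltngtP (index p u) (index q u).
  - by have := B lt; lra.
  - by have := A lt; lra.
  - by move=> E; case/eqP: pq; rewrite -(nth_index (0, 0) pu) E nth_index.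
have mI p : measurable (I p) by exact: measurable_itv.
have mD : measurable (\big[setU/set0]_(p <- u) I p) by exact: bigsetU_measurable.
apply: (@le_lt_trans _ _ (\sum_(p <- s) \int[mu]_(t in I p) `|phi t|)).
  by rewrite !big_seq; apply: ler_sum => p ps; exact: step.
rewrite su2.
have -> : \sum_(p <- u) \int[mu]_(t in I p) `|phi t| =
    \int[mu]_(t in \big[setU/set0]_(p <- u) I p) `|phi t|.
  rewrite [RHS]/Rintegral ge0_integral_bigsetU//; last first.
    by apply/measurable_EFinP/measurable_funTS; apply: measurableT_comp => //; exact: (integrableR_meas iphi).
  rewrite -sum_fine//= => p _.
  apply: integrable_fin_num => //.
  apply: integrableS (integrable_abse iphi) => //.
apply: H => //.
rewrite -lte_fin su1 in sd; apply: le_lt_trans sd.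
move: su; rewrite {su1 su2 us us_uniq tI mD cu}.
elim: u => [|p u ih] su; first by rewrite !big_nil measure0.
rewrite !big_cons (le_trans (measureU2 _ _ _))//; first exact: bigsetU_measurable.
rewrite EFinD leeD//; last by apply: ih => q qu; apply: su; rewrite inE qu orbT.
have le12 : p.1 <= p.2 by apply/ltW/su; rewrite inE eqxx.
by rewrite -(lebesgue_measure_oc le12).
Qed.

(** By Lebesgue's differentiation theorem, [F] minus the indefinite integral of [phi] has derivative
    0 almost everywhere. It is also absolutely continuous, hence constant. *)
Lemma ac_FTC a b F (phi : R -> R) : a <= b -> abs_continuous a b F ->
  integrableR `[a, b] phi ->
  {ae mu, forall x, a < x < b -> is_derive x 1 F (phi x)} ->
  F b - F a = \int[mu]_(t in `]a, b]) phi t.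
Proof.
move=> ab acF iphi dF.
pose psi := phi \_ `[a, b].
have ipsi : mu.-integrable setT (EFin \o psi).
  by apply: integrableR_patch => //; exact: measurable_itv.
pose I x := \int[mu]_(t in `]-oo, x]) psi t.
have IE : I b - I a = \int[mu]_(t in `]a, b]) phi t.
  rewrite /I (@Rintegral_itvB _ psi -oo%O (BRight b) a)//; last exact: integrableS ipsi.
  apply: Rintegral_eq => t; rewrite /= in_itv/= => /andP[xt tb].
  by rewrite /psi patchE mem_set//= in_itv/= tb ltW.
suff : F a - I a = F b - I b by rewrite -IE; lra.
apply: (@chain_continuous_cst a b (fun x => F x - I x)) => //.
  apply: chain_continuousB; first exact: abs_continuous_chain.
  exact: chain_continuous_integral.
have dI : {ae mu, forall x, derivable I x 1 /\ derive1 I x = psi x}.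
  apply: FTC1Ny; first by move=> y; exact: integrableS ipsi.
  by apply: integrable_locally.
have aeF := ae_filter_ringOfSetsType mu.
apply: filterS2 dF dI => x dFx [dIx vIx] axb.
have dFx' := dFx axb.
have dIx' : is_derive x 1 I (phi x).
  apply: DeriveDef => //; rewrite -derive1E vIx /psi patchE mem_set//=.
  by case/andP: axb => ax xb; rewrite in_itv/= !ltW.
rewrite -(subrr (phi x)); exact: is_deriveB.
Qed.

End absolute_continuity.

(** * Half-lines and Gronwall's lemma *)

Section half_lines.
Context {R : realType}.
Local Notation mu := (@lebesgue_measure R).
Implicit Types (f r : R -> R) (x y : R).

Lemma measurable_itvR (i : interval R) : measurable ([set` i] : set (measurableTypeR R)).
Proof. exact: measurable_itv. Qed.

Hint Extern 0 (measurable _) => solve [exact: measurable_itvR] : core.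

Lemma integrableR_itvS (i j : interval R) f : (i <= j)%O ->
  integrableR [set` j] f -> integrableR [set` i] f.
Proof. by move=> ij; apply: integrableRS => // t; exact: (subitvP ij). Qed.

Lemma Rintegral_split x y f : x <= y -> integrableR `]x, +oo[ f ->
  \int[mu]_(t in `]x, +oo[) f t =
  \int[mu]_(t in `]x, y]) f t + \int[mu]_(t in `]y, +oo[) f t.
Proof.
move=> xy fi.
have E : `]x, +oo[%classic = `]x, y]%classic `|` `]y, +oo[%classic :> set (measurableTypeR R).
  by rewrite -itv_bndbnd_setU// bnd_simp.
rewrite E in fi *; rewrite Rintegral_setU//.
by apply/disj_setPS => t [] /=; rewrite !in_itv/= andbT => /andP[_ ty] yt; lra.
Qed.

Lemma Rintegral_pinfty_cvg x f : integrableR `]x, +oo[ f ->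
  \int[mu]_(t in `]x, x + n%:R]) f t @[n --> \oo] --> \int[mu]_(t in `]x, +oo[) f t.
Proof.
move=> fi; have mf := integrableR_meas fi.
have [|||||_] := @Rdominated_convergence R `]x, +oo[
    (fun n => f \_ `]x, x + n%:R]) f (fun t => `|f t|) => //.
- move=> n; apply/(measurable_restrict _ _ _) => //.
  by apply: measurable_funS mf => //; exact: subIsetl.
- move=> t /=; rewrite in_itv/= andbT => xt.
  apply: cvg_near_cst; near=> n.
  rewrite patchE mem_set//= in_itv/= xt/= -lerBlDl.
  by near: n; exact: nbhs_infty_ger.
- exact: integrableR_norm.
- move=> n t _; rewrite patchE; case: ifP => // _.
  by rewrite normr0.
apply: cvg_trans; apply: near_eq_cvg; apply: nearW => n.
rewrite -Rintegral_mkcondr; congr (Rintegral _ _ _).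
rewrite setIC; apply/setIidl => t /=; rewrite !in_itv/= => /andP[->]//.
Unshelve. all: by end_near. Qed.

Lemma Rintegral_tail_cvg0 x f : integrableR `]x, +oo[ f ->
  \int[mu]_(t in `]x + n%:R, +oo[) f t @[n --> \oo] --> (0 : R).
Proof.
move=> fi.
have := Rintegral_pinfty_cvg fi; set I := (X in _ --> X) => cv.
have -> : (fun n => \int[mu]_(t in `]x + n%:R, +oo[) f t) =
    (fun n => I - \int[mu]_(t in `]x, x + n%:R]) f t).
  apply/funext => n; rewrite /I (@Rintegral_split x (x + n%:R))//; first by ring.
  by rewrite lerDl.
by rewrite -(subrr I); apply: cvgB => //; exact: cvg_cst.
Qed.

Lemma Rintegral_itv_le (i j : interval R) f : (i <= j)%O ->
  (forall t, t \in j -> 0 <= f t) -> integrableR [set` j] f ->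
  \int[mu]_(t in [set` i]) f t <= \int[mu]_(t in [set` j]) f t.
Proof.
move=> ij f0 fi; have fi' := integrableR_itvS ij fi.
rewrite /Rintegral fine_le//; [exact: integrable_fin_num fi'|exact: integrable_fin_num fi|].
apply: ge0_subset_integral => //.
- by have /measurable_EFinP := integrableR_meas fi.
- by move=> t; exact: (subitvP ij).
Qed.

Lemma exists_exp2_ge (M : R) : exists n, M / 2 ^+ n <= 1.
Proof.
exists (Num.bound M); rewrite ler_pdivrMr ?exprn_gt0// mul1r.
rewrite (le_trans (ler_norm _))// (le_trans (ltW (archi_boundP _)))//.
rewrite -natrX ler_nat.
have -> : Num.bound `|M| = Num.bound M by rewrite /Num.bound; congr (_.+1); rewrite normr_id.
by rewrite ltnW// ltn_expl.
Qed.

(* [P x c] stands for "the bound [c] holds at [x]"; stating Gronwall's lemma for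
   predicates avoids taking suprema over auxiliary parameters. *)
Lemma gronwall r : integrableR `]0, +oo[ r -> (forall t, 0 < t -> 0 <= r t) ->
  exists2 K, 0 < K & forall (x0 : R) (P : R -> R -> Prop), 0 <= x0 ->
    (forall x c c', c <= c' -> P x c -> P x c') ->
    (exists2 M, 0 <= M & forall x, x0 < x -> P x M) ->
    (forall x y c1 c2, x0 < x -> x <= y -> 0 <= c1 -> 0 <= c2 ->
      (forall t, x < t -> t <= y -> P t c1) -> (forall t, y < t -> P t c2) ->
      P x (1 + c1 * \int[mu]_(t in `]x, y]) r t + c2 * \int[mu]_(t in `]y, +oo[) r t)) ->
    forall x, x0 < x -> P x K.
Proof.
move=> ri r0.
pose W := \int[mu]_(t in `]0, +oo[) r t.
have W0 : 0 <= W.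
  by apply: Rintegral_ge0 => t /=; rewrite in_itv/= andbT => /r0.
pose r' := r \_ `]0, +oo[.
(* Strips shorter than [d], and the half-line beyond [X] below, carry mass at most 1/2 of [r]. On
   such sets one use of the step hypothesis halves the excess of a bound over a fixed point. *)
have [d [d0 Hd]] : exists d : R, 0 < d /\ forall A : set (measurableTypeR R),
    measurable A -> (mu A < d%:E)%E -> \int[mu]_(x in A) `|r' x| < 2^-1.
  by apply: integral_normr_continuous => //; exact: integrableR_patch.
have smalld z z' : 0 <= z -> z <= z' -> z' - z < d -> \int[mu]_(t in `]z, z']) r t <= 2^-1.
  move=> z0 zz' zd.
  have -> : \int[mu]_(t in `]z, z']) r t = \int[mu]_(t in `]z, z']) `|r' t|.
    apply: Rintegral_eq => t /=; rewrite in_itv/= => /andP[zt _].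
    have t0 : 0 < t by exact: le_lt_trans zt.
    by rewrite /r' patchE mem_set ?ger0_norm ?r0//= in_itv/= t0.
  apply/ltW/Hd; first exact: measurable_itvR.
  by rewrite lebesgue_measure_oc// lte_fin.
have [n0 Hn0] : exists n0 : nat, \int[mu]_(t in `]n0%:R, +oo[) r t <= 2^-1.
  have /cvgrPdist_lt/(_ 2^-1) := Rintegral_tail_cvg0 ri.
  rewrite invr_gt0 ltr0n => /(_ isT)[N _ /(_ N (leqnn _))]/=.
  rewrite sub0r normrN add0r => /ltW; exists N; apply: le_trans (ler_norm _) _.
  by [].
pose X := n0%:R : R.
(* [K n] is the bound on the part of the half-line beyond [X - n * h]. Entering one more strip, the
   fixed point is 2(1 + W K n), and 1 is added for the remaining excess; the summand [K n] makes the
   sequence increasing. Nothing here depends on [P], [x0] or [M]. *)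
pose K := fix K n := if n is n'.+1 then K n' + (2 * (1 + W * K n') + 1) else (3 : R).
have K0 n : 0 < K n.
  elim: n => [|n ih]//=; apply: addr_gt0 => //; apply: ltr_wpDl => //.
  by rewrite mulr_ge0// addr_ge0// mulr_ge0// ltW.
pose h := d / 2.
have h0 : 0 < h by exact: divr_gt0.
have [N HN] : exists N : nat, X < N%:R * h.
  exists (Num.bound (X / h)).
  by rewrite -ltr_pdivrMr// archi_boundP// divr_ge0// ltW.
exists (K N) => // x0 P x00 Pmono [M M0 PM] step.
have base x : x0 < x -> X < x -> P x (K 0%N).
  move=> xx0 Xx.
  have [j Hj] := exists_exp2_ge M.
  (* Beyond [X] the step turns a bound c into 1 + c/2, with fixed point 2. The a priori bound [M] is
     used up by iteration. *)
  suff H i t : X < t -> x0 < t -> P t (2 + M / 2 ^+ i).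
    by apply: Pmono (H j x Xx xx0); rewrite /K; lra.
  elim: i t => [|i ih] t Xt xt.
    by rewrite expr0 divr1; apply: Pmono (PM t xt); lra.
  have c2 : 0 <= 2 + M / 2 ^+ i by rewrite addr_ge0// divr_ge0// exprn_ge0.
  apply: Pmono (step t t 0 (2 + M / 2 ^+ i) xt (lexx _) (lexx _) c2 _ _).
  - rewrite mul0r addr0 exprS invfM mulrA.
    have : \int[mu]_(t0 in `]t, +oo[) r t0 <= 2^-1.
      apply: le_trans Hn0; apply: Rintegral_itv_le.
      + by rewrite subitvE/= bnd_simp ltW.
      + by move=> s; rewrite in_itv/= andbT => Xs; apply: r0; exact: le_lt_trans Xs.
      + by apply: integrableR_itvS ri; rewrite subitvE/= bnd_simp ler0n.
    move=> I2.
    have : (2 + M / 2 ^+ i) * \int[mu]_(t0 in `]t, +oo[) r t0 <= (2 + M / 2 ^+ i) * 2^-1.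
      exact: ler_wpM2l.
    rewrite (_ : M / 2 / 2 ^+ i = (M / 2 ^+ i) / 2); last by rewrite mulrAC.
    lra.
  - by move=> s ts st; have := lt_le_trans ts st; rewrite ltxx.
  - by move=> s ts; apply: ih; exact: lt_trans ts.
suff H n x : x0 < x -> X - n%:R * h < x -> P x (K n).
  by move=> x xx0; apply: H => //; apply: le_lt_trans xx0; lra.
elim: n x => [|n ih] x xx0 xn; first by apply: base => //; move: xn; rewrite mul0r subr0.
pose z' := X - n%:R * h.
have [z'x|xz'] := ltP z' x.
  apply: Pmono (ih x xx0 z'x) => /=.
  have : 0 <= W * K n by rewrite mulr_ge0// ltW.
  by lra.
(* On the strip, with [K n] known to its right, a bound b improves to c + b/2, with fixed point
   2c. *)
pose c := 1 + W * K n.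
have c0 : 0 <= c by rewrite addr_ge0// mulr_ge0// ltW.
have [j Hj] := exists_exp2_ge M.
suff H i t : x <= t -> t <= z' -> P t (2 * c + M / 2 ^+ i).
  apply: Pmono (H j x (lexx _) xz') => /=; have := K0 n; rewrite -/c; lra.
elim: i t => [|i iH] t xt tz'.
  rewrite expr0 divr1; apply: Pmono (PM t _); last exact: lt_le_trans xt.
  by rewrite lerDr mulr_ge0.
have xt0 : x0 < t by exact: lt_le_trans xt.
have t0 : 0 < t by exact: le_lt_trans xt0.
have c1 : 0 <= 2 * c + M / 2 ^+ i by rewrite addr_ge0// ?mulr_ge0// divr_ge0// exprn_ge0.
apply: Pmono (step t z' _ (K n) xt0 tz' c1 (ltW (K0 n)) _ _).
- have I1 : \int[mu]_(s in `]t, z']) r s <= 2^-1.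
    apply: smalld => //; first exact: ltW.
    move: xn xt; rewrite /z' /h -natr1 mulrDl mul1r; lra.
  have I2 : \int[mu]_(s in `]z', +oo[) r s <= W.
    apply: Rintegral_itv_le => //.
    + by rewrite subitvE/= bnd_simp (le_trans (ltW t0)).
    + by move=> s; rewrite in_itv/= andbT => /r0.
  have A1 := ler_wpM2l c1 I1.
  have A2 := ler_wpM2l (ltW (K0 n)) I2.
  rewrite exprS invfM mulrA (_ : M / 2 / 2 ^+ i = (M / 2 ^+ i) / 2); last by rewrite mulrAC.
  move: A1 A2; rewrite /c (mulrC (K n) W); lra.
- by move=> s ts sz; apply: iH => //; exact: le_trans (ltW ts).
- by move=> s zs; apply: ih => //; apply: lt_trans xt0 _; exact: le_lt_trans zs.
Qed.

End half_lines.
#[export] Hint Extern 0 (measurable _) => solve [exact: measurable_itvR] : core.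

(** * The Volterra equation of a Jost solution *)

Section jost_integral_equation.
Context {R : realType}.
Local Notation mu := (@lebesgue_measure R).
Implicit Types (F G y g q : R -> R) (a b k x : R).

(** Transfers absolute continuity from the derivative of a solution to the bilinear expression in
    Lagrange's identity, whose other ingredients are Lipschitz. *)
Lemma abs_continuous_dom a b F G (M L : R) : 0 <= M -> 0 <= L ->
  abs_continuous a b F ->
  (forall u v, a <= u -> u <= v -> v <= b ->
    `|G v - G u| <= M * `|F v - F u| + L * (v - u)) ->
  abs_continuous a b G.
Proof.
move=> M0 L0 acF dom e e0.
have M1 : 0 < M + 1 by rewrite ltr_wpDl.
have L1 : 0 < L + 1 by rewrite ltr_wpDl.
have eM : 0 < e / 2 / (M + 1) by rewrite !divr_gt0.
have eL : 0 < e / 2 / (L + 1) by rewrite !divr_gt0.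
have [d d0 H] := acF _ eM.
exists (Num.min d (e / 2 / (L + 1))); first by rewrite lt_min d0.
move=> n u v uv tuv; rewrite lt_min => /andP[sd sL].
have := H n u v uv tuv sd; rewrite ltr_pdivlMr// => HF.
move: sL; rewrite ltr_pdivlMr// => HL.
rewrite [e]splitr; apply: le_lt_trans (ltrD HF HL).
rewrite !mulr_suml -big_split/=; apply: ler_sum => i _.
have [aui uvi vib] := uv i.
rewrite (le_trans (dom _ _ aui uvi vib))// lerD//.
  by rewrite mulrC ler_wpM2l// lerDl.
by rewrite mulrC ler_wpM2l ?subr_ge0// lerDl.
Qed.

(** A step of length [d / 2] changes [F] by less than 1, and a fixed number of steps reaches every
    point of the interval. *)
Lemma chain_continuous_bounded a b F : a <= b -> chain_continuous a b F ->
  exists2 M, 0 <= M & forall t, a <= t -> t <= b -> `|F t| <= M.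
Proof.
move=> ab cF; have [d d0 H] := cF 1 ltr01.
pose h := d / 2; have h0 : 0 < h by rewrite divr_gt0.
have step (n : nat) t : a <= t -> t <= b -> t - a <= n%:R * h -> `|F t - F a| <= n%:R.
  elim: n t => [|n ih] t at_ tb.
    by rewrite mul0r subr_le0 => ta; rewrite (_ : t = a) ?subrr ?normr0//; apply/eqP; rewrite eq_le ta.
  rewrite -natr1 mulrDl mul1r => tn.
  pose s := Num.max a (t - h).
  have as_ : a <= s by rewrite le_max lexx.
  have st : s <= t by rewrite ge_max at_ gerBl ltW.
  have := ih s as_ (le_trans st tb).
  have sn : s - a <= n%:R * h.
    rewrite lerBlDl ge_max lerDl mulr_ge0 ?(ltW h0)//=; lra.
  move=> /(_ sn) Fs.
  have := H [:: (s, t)]; rewrite /chain/= !big_seq1/= as_ st tb => /(_ isT).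
  have ts : t - s < d.
    rewrite ltrBlDl -ltrBlDr lt_max; apply/orP; right; rewrite ltrD2l ltrN2 /h; lra.
  move=> /(_ ts) Ft.
  rewrite (_ : F t - F a = (F t - F s) + (F s - F a)); last by ring.
  by rewrite (le_trans (ler_normD _ _))// addrC lerD// ltW.
pose N := Num.bound ((b - a) / h).
exists (N%:R + `|F a|); first by rewrite addr_ge0.
move=> t at_ tb.
have : `|F t - F a| <= N%:R.
  apply: step => //; rewrite -ler_pdivrMr//.
  rewrite (@le_trans _ _ ((b - a) / h))//; first by rewrite ler_pM2r ?invr_gt0// lerB.
  by rewrite ltW// archi_boundP// divr_ge0 ?subr_ge0// ltW.
rewrite -{2}(subrK (F a) (F t)) => tN.
by rewrite (le_trans (ler_normD _ _))// lerD.
Qed.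

Lemma is_derive_continuous F x (D : R) : is_derive x 1 F D -> {for x, continuous F}.
Proof. by move=> [dF _]; apply: differentiable_continuous; exact/derivable1_diffP. Qed.

Lemma is_derive_lipschitz F G a b (B : R) :
  (forall x, a <= x <= b -> is_derive x 1 F (G x)) ->
  (forall x, a <= x <= b -> `|G x| <= B) ->
  forall u v, a <= u -> u <= v -> v <= b -> `|F v - F u| <= B * (v - u).
Proof.
move=> dF GB u v au uv vb.
have sub c : c \in `[u, v] -> a <= c <= b.
  by rewrite in_itv/= => /andP[uc cv]; rewrite (le_trans au)// (le_trans cv).
have [||c cuv ->] := @MVT_segment R F G u v uv.
- by move=> x xuv; apply: dF; apply: sub; exact: subset_itv_oo_cc.
- apply: derivable_within_continuous => x /sub /dF [dFx _]; exact: dFx.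
by rewrite normrM ler_pM// ?GB ?sub// ger0_norm// subr_ge0.
Qed.

Definition sink k (x : R) := sin (k * x) / k.

Lemma is_derive_cosk k c x : is_derive x 1 (fun t => cos (k * (t - c))) (- k * sin (k * (x - c))).
Proof.
apply: is_derive_eq.
by rewrite /GRing.scale/=; ring.
Qed.

Lemma is_derive_sinkk k c x :
  is_derive x 1 (fun t => sin (k * (t - c))) (k * cos (k * (x - c))).
Proof.
apply: is_derive_eq.
by rewrite /GRing.scale/=; ring.
Qed.

Lemma is_derive_sink k c x : k != 0 ->
  is_derive x 1 (fun t => sink k (t - c)) (cos (k * (x - c))).
Proof.
move=> k0; have dk := is_derive_sinkk k c x.
apply: is_derive_eq.
by rewrite /GRing.scale/=; field.
Qed.

Lemma norm_cos_le1 x : `|cos x| <= 1.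
Proof. by rewrite ler_norml cos_geN1 cos_le1. Qed.

Lemma norm_sin_le1 x : `|sin x| <= 1.
Proof. by rewrite ler_norml sin_geN1 sin_le1. Qed.

Lemma norm_sink_le k x : 0 < k -> `|sink k x| <= k^-1.
Proof.
move=> k0; rewrite /sink normrM [`|k^-1|]ger0_norm ?invr_ge0 ?(ltW k0)//.
by rewrite ler_piMl ?norm_sin_le1// invr_ge0 ltW.
Qed.

Lemma sink_lipschitz k u v : 0 < k -> u <= v -> `|sink k v - sink k u| <= v - u.
Proof.
move=> k0 uv; rewrite -[v - u]mul1r.
apply: (@is_derive_lipschitz (sink k) (fun x => cos (k * x)) u v 1) => // x _.
  have := is_derive_sink 0 x (lt0r_neq0 k0).
  rewrite subr0; congr (is_derive _ _ _ _); apply/funext => t; by rewrite subr0.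
exact: norm_cos_le1.
Qed.

Lemma norm_sink_le_id k x : 0 < k -> 0 <= x -> `|sink k x| <= x.
Proof.
move=> k0 x0; have := sink_lipschitz k0 x0.
by rewrite {2}/sink mulr0 sin0 mul0r !subr0.
Qed.

(** For real [k] the Volterra equation has real kernel, so each part of the Jost solution satisfies
    it separately, with (a, b) = (1, 0) for the real part and (0, 1) for the imaginary part.
    Boundedness is asked only away from 0; a bound uniform on the half-line will follow from
    Gronwall's lemma. *)
Definition jost_component q k a b y :=
  [/\ forall x, 0 < x -> {for x, continuous y},
      forall x0, 0 < x0 -> exists M, forall x, x0 <= x -> `|y x| <= M &
      forall x, 0 < x -> y x = a * cos (k * x) + b * sin (k * x) +
        \int[mu]_(t in `]x, +oo[) (sink k (t - x) * (q t * y t))].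

Section equation.
Variables (q y g : R -> R) (k a b : R).
Hypothesis k0 : 0 < k.
Hypothesis qi : integrableR `]0, +oo[ q.
Hypothesis dy : forall x, 0 < x -> is_derive x 1 y (g x).
Hypothesis acg : forall u v, 0 < u -> u <= v -> abs_continuous u v g.
Hypothesis dg : {ae mu, forall x, 0 < x -> is_derive x 1 g ((q x - k ^+ 2) * y x)}.
Hypothesis asy : forall e, 0 < e -> exists A, forall x, A < x ->
  `|y x - (a * cos (k * x) + b * sin (k * x))| < e.

Let p x := a * cos (k * x) + b * sin (k * x).

Let ycont x : 0 < x -> {for x, continuous y}.
Proof. by move=> /dy; exact: is_derive_continuous. Qed.

Let my (x : R) : 0 <= x -> measurable_fun (`]x, +oo[%classic : set (measurableTypeR R)) y.
Proof.
move=> x0; apply: open_continuous_measurable_fun; first exact: rray_open.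
move=> t; rewrite inE/= in_itv/= andbT => xt; apply: ycont; exact: le_lt_trans xt.
Qed.

Let glob x X : 0 < x -> x <= X -> exists2 B, 0 <= B & forall t, x <= t <= X -> `|g t| <= B.
Proof.
move=> x0 xX; have [B B0 HB] := chain_continuous_bounded xX (abs_continuous_chain (acg x0 xX)).
by exists B => // t /andP[]; exact: HB.
Qed.

Let ylip x X : 0 < x -> x <= X -> exists2 B, 0 <= B & forall u v, x <= u -> u <= v -> v <= X ->
  `|y v - y u| <= B * (v - u).
Proof.
move=> x0 xX; have [B B0 HB] := glob x0 xX; exists B => //.
apply: (is_derive_lipschitz _ HB) => t /andP[xt _]; apply: dy; exact: lt_le_trans xt.
Qed.

Let yloc x X : 0 < x -> x <= X -> exists2 B, 0 <= B & forall t, x <= t <= X -> `|y t| <= B.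
Proof.
move=> x0 xX; have [B B0 HB] := ylip x0 xX; exists (`|y x| + B * (X - x)).
  by rewrite addr_ge0// mulr_ge0// subr_ge0.
move=> t /andP[xt tX]; rewrite -{1}(subrK (y x) (y t)) (le_trans (ler_normD _ _))//.
rewrite addrC lerD2l (le_trans (HB _ _ (lexx x) xt tX))// ler_wpM2l//; lra.
Qed.

Let ybound x0 : 0 < x0 -> exists2 M, 0 <= M & forall x, x0 <= x -> `|y x| <= M.
Proof.
move=> x00; have [A HA] := asy ltr01.
have pb x : `|p x| <= `|a| + `|b|.
  rewrite (le_trans (ler_normD _ _))// !normrM lerD// ler_piMr//.
    exact: norm_cos_le1.
  exact: norm_sin_le1.
have xm : x0 <= Num.max x0 A by rewrite le_max lexx.
have [B B0 HB] := yloc x00 xm.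
exists (B + (1 + (`|a| + `|b|))); first by rewrite !addr_ge0.
move=> x x0x; have [xA|Ax] := leP x A.
  rewrite (le_trans (HB x _)) ?x0x ?le_max ?xA ?orbT// lerDl !addr_ge0//.
rewrite -(subrK (p x) (y x)) (le_trans (ler_normD _ _))//.
rewrite (@le_trans _ _ (1 + (`|a| + `|b|)))//; first by rewrite lerD// ltW// HA.
by rewrite lerDr.
Qed.

Let qy x : 0 < x -> integrableR `]x, +oo[ (fun t => q t * y t).
Proof.
move=> x0; have [M M0 HM] := ybound x0.
have qx : integrableR `]x, +oo[ q by apply: integrableR_itvS qi; rewrite subitvE/= bnd_simp ltW.
apply: (@le_integrableR _ _ _ (fun t => M * `|q t|)) => //.
- apply: measurable_funM; [exact: integrableR_meas qx|exact: my (ltW x0)].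
- move=> t /=; rewrite in_itv/= andbT => xt; rewrite normrM mulrC ler_wpM2r// HM//; exact: ltW.
- by apply: integrableRZl => //; exact: integrableR_norm.
Qed.

Let msink c (D : set (measurableTypeR R)) : measurable_fun D (fun t => sink k (t - c)).
Proof.
apply: measurable_funTS; apply: continuous_measurable_fun => t.
exact: is_derive_continuous (is_derive_sink c t (lt0r_neq0 k0)).
Qed.

Let sqy x c : 0 < x -> integrableR `]x, +oo[ (fun t => sink k (t - c) * (q t * y t)).
Proof.
move=> x0; apply: (@le_integrableR _ _ _ (fun t => k^-1 * `|q t * y t|)) => //.
- apply: measurable_funM; [exact: msink|exact: integrableR_meas (qy x0)].
- by move=> t _; rewrite normrM ler_wpM2r// norm_sink_le.
- by apply: integrableRZl => //; exact: integrableR_norm (qy x0).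
Qed.

(* Lagrange's identity for [y] and the solutions sin(k(. - x))/k, cos(k(. - x))
   of the free equation. *)
Let lagrange x X : 0 < x -> x <= X ->
  y x = cos (k * (X - x)) * y X - sink k (X - x) * g X +
        \int[mu]_(t in `]x, X]) (sink k (t - x) * (q t * y t)).
Proof.
move=> x0 xX; pose Phi t := sink k (t - x) * g t - cos (k * (t - x)) * y t.
have [Bg Bg0 HBg] := glob x0 xX; have [By By0 HBy] := yloc x0 xX; have [Bl Bl0 HBl] := ylip x0 xX.
have acPhi : abs_continuous x X Phi.
  apply: (@abs_continuous_dom _ _ g Phi k^-1 (Bg + (Bl + k * By)) _ _ (acg x0 xX)).
  - by rewrite invr_ge0 ltW.
  - by rewrite !addr_ge0// mulr_ge0// ltW.
  move=> u v xu uv vX.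
  have -> : Phi v - Phi u = sink k (v - x) * (g v - g u) +
     ((sink k (v - x) - sink k (u - x)) * g u -
      (cos (k * (v - x)) * (y v - y u) + (cos (k * (v - x)) - cos (k * (u - x))) * y u)).
    by rewrite /Phi; ring.
  rewrite (le_trans (ler_normD _ _))// lerD//.
    by rewrite normrM ler_wpM2r// norm_sink_le.
  rewrite [leRHS]mulrDl; apply: (le_trans (ler_normB _ _)); apply: lerD.
    rewrite normrM mulrC ler_pM// ?HBg ?xu ?(le_trans uv)//.
    have -> : v - u = (v - x) - (u - x) by ring.
    by apply: sink_lipschitz => //; rewrite lerB.
  rewrite [leRHS]mulrDl; apply: (le_trans (ler_normD _ _)); apply: lerD.
    rewrite normrM -[X in _ <= X]mul1r ler_pM// ?norm_cos_le1// HBl//.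
  rewrite normrM mulrAC ler_pM// ?HBy ?xu ?(le_trans uv)//.
  apply: (@is_derive_lipschitz (fun t => cos (k * (t - x))) (fun t => - k * sin (k * (t - x))) u v k) => //.
    by move=> t _; exact: is_derive_cosk.
  by move=> t _; rewrite normrM normrN (ger0_norm (ltW k0)) ler_piMr ?norm_sin_le1// ltW.
have iphi : integrableR `[x, X] (fun t => sink k (t - x) * (q t * y t)).
  have x20 : 0 < x / 2 by rewrite divr_gt0.
  by apply: integrableR_itvS (sqy x x20); rewrite subitvE/= !bnd_simp; lra.
have aeF := ae_filter_ringOfSetsType mu.
have dPhi : {ae mu, forall t, x < t < X -> is_derive t 1 Phi (sink k (t - x) * (q t * y t))}.
  apply: filterS dg => t dgt /andP[xt tX].
  have t0 : 0 < t by exact: lt_trans xt.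
  have dgt' := dgt t0; have dyt' := dy t0.
  have ds := is_derive_sink x t (lt0r_neq0 k0); have dc := is_derive_cosk k x t.
  have kn0 := lt0r_neq0 k0.
  apply: is_derive_eq; rewrite /GRing.scale/= /sink; field.
  by [].
have := ac_FTC xX acPhi iphi dPhi.
rewrite /Phi /sink subrr mulr0 sin0 mul0r cos0 mul1r => <-; ring.
Qed.

(** The value of [p] a quarter period before [X] equals - p'(X)/k, so the free solution is recovered
    from two of its values, without a derivative. *)
Let pfree x X : p x = cos (k * (X - x)) * p X + sin (k * (X - x)) * p (X - pi / 2 / k).
Proof.
have kn0 := lt0r_neq0 k0.
have -> : k * (X - x) = k * X - k * x by ring.
have E : k * (X - pi / 2 / k) = k * X - pi / 2 by field.
rewrite /p E !sinB !cosB cos_pihalf sin_pihalf.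
have := cos2Dsin2 (k * X); set C := cos (k * X); set S := sin (k * X) => CS.
set c := cos (k * x); set s := sin (k * x).
transitivity ((C ^+ 2 + S ^+ 2) * (a * c + b * s)); [by rewrite CS mul1r|ring].
Qed.

(** Lagrange's identity on [x, X] is used with [X] large. The asymptotics control [y] but not its
    derivative [g]. A second application, over the quarter period [X', X] with X' = X - pi/(2k),
    where the cosine factor is 0 and the sine is 1, expresses [g X / k] by [y X'] and a small
    integral; [pfree] treats the free solution in the same way. *)
Lemma jost_component_ode : jost_component q k a b y.
Proof.
split => //.
  by move=> x0 /ybound[M _ HM]; exists M.
move=> x x0; rewrite -/(p x).
have kn0 := lt0r_neq0 k0.
set I := (X in _ = _ + X).
pose c := pi / 2 / k.
have c0 : 0 < c by rewrite !divr_gt0// pi_gt0.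
have [M M0 HM] := ybound x0.
apply/eqP; rewrite -subr_eq0 -normr_le0; apply/ler_addgt0Pr => e e0; rewrite add0r.
have e40 : 0 < e / 4 by rewrite divr_gt0.
have [A HA] := asy e40.
have MK : 0 < M / k + 1 by rewrite ltr_wpDl// divr_ge0// ltW.
have qx : integrableR `]x, +oo[ (fun t => `|q t|).
  by apply: integrableR_norm; apply: integrableR_itvS qi; rewrite subitvE/= bnd_simp ltW.
have e4M : 0 < e / 4 / (M / k + 1) by rewrite divr_gt0.
have /cvgrPdist_lt/(_ _ e4M)[m _ Hm] := Rintegral_tail_cvg0 qx.
have /cvgrPdist_lt/(_ _ e40)[l _ Hl] := Rintegral_pinfty_cvg (sqy x x0).
(* [m] makes the tail of [q] beyond [X'] small, [l] serves the convergence of the integral up to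
   [X], and the two integer bounds place [X'] beyond both [x + m] and [A]. Four errors of size e/4
   result. *)
pose n := (m + l + (Num.bound c) + (Num.bound `|A|))%N.
pose X := x + n%:R; pose X' := X - c.
have nE : n%:R = m%:R + l%:R + (Num.bound c)%:R + (Num.bound `|A|)%:R :> R by rewrite /n !natrD.
have cb : c < (Num.bound c)%:R by rewrite archi_boundP// ltW.
have Ab : `|A| < (Num.bound `|A|)%:R by rewrite archi_boundP.
have lA := ler_norm A.
have m0 : 0 <= m%:R :> R by []. have l0 : 0 <= l%:R :> R by [].
have A0 : 0 <= `|A| by [].
have xX' : x + m%:R <= X' by rewrite /X' /X nE; lra.
have AX' : A < X' by rewrite /X' /X nE; lra.
have X'X : X' <= X by rewrite /X' gerBl ltW.
have xX : x <= X by rewrite /X lerDl.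
have X'0 : 0 < X' by apply: lt_le_trans xX'; rewrite ltr_pwDl.
have E1 := lagrange x0 xX.
have E2 := lagrange X'0 X'X.
have XX' : X - X' = c by rewrite /X'; ring.
have kc : k * c = pi / 2 by rewrite /c; field.
move: E2; rewrite /sink XX' kc sin_pihalf cos_pihalf mul0r add0r.
set J := (X in _ = _ + X) => E2.
have gX : g X / k = J - y X' by rewrite E2; field.
have JB : `|J| <= e / 4.
  apply: (@le_trans _ _ (\int[mu]_(t in `]X', X]) (M / k * `|q t|))).
    apply: le_norm_Rintegral => //.
    - apply: measurable_funM; first by apply: msink.
      by apply: integrableR_meas; apply: integrableR_itvS (qy X'0); rewrite subitvE/= bnd_simp lexx.
    - move=> t /=; rewrite in_itv/= => /andP[Xt _].
      rewrite !normrM (_ : M / k * _ = k^-1 * (`|q t| * M)); last by ring.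
      rewrite ler_pM//; first by have := norm_sink_le (t - X') k0; rewrite /sink normrM.
      rewrite ler_wpM2l// HM// (le_trans _ (ltW Xt))// (le_trans _ xX')// lerDl//.
    - apply: integrableRZl => //; apply: integrableR_itvS qx; rewrite subitvE/= !bnd_simp.
      by rewrite (le_trans _ xX')// lerDl.
  rewrite RintegralZl//; last first.
    apply: integrableR_itvS qx; rewrite subitvE/= !bnd_simp.
    by rewrite (le_trans _ xX')// lerDl.
  have := Hm m (leqnn m); rewrite /= sub0r normrN ger0_norm ?Rintegral_ge0//.
  rewrite ltr_pdivlMr// => tail.
  apply: le_trans (ltW tail); rewrite mulrC ler_pM//.
  - exact: Rintegral_ge0.
  - by rewrite divr_ge0// ltW.
  - apply: Rintegral_itv_le => //; first by rewrite subitvE/= bnd_simp andbT.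
    by apply: integrableR_itvS qx; rewrite subitvE/= bnd_simp ?andbT ?lerDl ?ler0n.
  - by rewrite lerDl.
have HX := HA X (lt_le_trans AX' X'X).
have HX' := HA X' AX'.
have /= HIn := Hl n; rewrite -/I in HIn.
have {}HIn : `|I - \int[mu]_(t in `]x, X]) (sink k (t - x) * (q t * y t))| < e / 4.
  by apply: HIn; rewrite /n -addnA -addnA [(m + _)%N]addnC -!addnA leq_addr.
move: HIn E1; set In := Rintegral _ _ _ => HIn E1.
rewrite E1 (pfree x X) -/(X').
rewrite /sink (_ : sin (k * (X - x)) / k * g X = sin (k * (X - x)) * (g X / k)); last by ring.
rewrite gX.
set C := cos _; set S := sin _.
rewrite (_ : _ - _ = C * (y X - p X) + S * (y X' - p X') - S * J - (I - In)); last by ring.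
have := ler_norm; move=> _.
have C1 : `|C * (y X - p X)| <= e / 4.
  by rewrite normrM (le_trans _ (ltW HX))// ler_piMl// norm_cos_le1.
have S1 : `|S * (y X' - p X')| <= e / 4.
  by rewrite normrM (le_trans _ (ltW HX'))// ler_piMl// norm_sin_le1.
have J1 : `|S * J| <= e / 4.
  by rewrite normrM (le_trans _ JB)// ler_piMl// norm_sin_le1.
have N1 := ler_normB (C * (y X - p X) + S * (y X' - p X') - S * J) (I - In).
have N2 := ler_normB (C * (y X - p X) + S * (y X' - p X')) (S * J).
have N3 := ler_normD (C * (y X - p X)) (S * (y X' - p X')).
lra.
Qed.

End equation.

End jost_integral_equation.

(** * Bounds and dependence on k *)

Section jost_estimates.
Context {R : realType}.
Local Notation mu := (@lebesgue_measure R).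
Implicit Types (f g q y : R -> R) (a b k x : R).

(** Majorant of the Volterra kernel sin(k(t - x))/k q(t), by |sin(ks)/k| <= s. It does not involve
    k, which makes all later constants uniform in k > 0. *)
Definition weight q t := (1 + t) * `|q t|.

Lemma weight_ge0 q t : 0 < t -> 0 <= weight q t.
Proof. by move=> t0; rewrite mulr_ge0// addr_ge0// ltW. Qed.

(** Brings a Volterra integral into the form that the step hypothesis of [gronwall] requires. *)
Lemma le_norm_Rintegral_split f (r : R -> R) x z (c1 c2 : R) : x <= z -> 0 <= c1 -> 0 <= c2 ->
  measurable_fun (`]x, +oo[%classic : set (measurableTypeR R)) f ->
  integrableR `]x, +oo[ r -> (forall t, x < t -> 0 <= r t) ->
  (forall t, x < t -> t <= z -> `|f t| <= r t * c1) ->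
  (forall t, z < t -> `|f t| <= r t * c2) ->
  integrableR `]x, +oo[ f /\
  `|\int[mu]_(t in `]x, +oo[) f t| <=
    c1 * \int[mu]_(t in `]x, z]) r t + c2 * \int[mu]_(t in `]z, +oo[) r t.
Proof.
move=> xz c10 c20 mf ir r0 f1 f2.
have ir1 : integrableR `]x, z] r by apply: integrableR_itvS ir; rewrite subitvE/= bnd_simp lexx.
have ir2 : integrableR `]z, +oo[ r by apply: integrableR_itvS ir; rewrite subitvE/= bnd_simp andbT.
have fi : integrableR `]x, +oo[ f.
  apply: (@le_integrableR _ _ _ (fun t => (c1 + c2) * r t)) => //; last exact: integrableRZl.
  move=> t /=; rewrite in_itv/= andbT => xt; rewrite mulrC mulrDr; have [tz|zt] := leP t z.
    by rewrite (le_trans (f1 t xt tz))// lerDl mulr_ge0// r0.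
  by rewrite (le_trans (f2 t zt))// lerDr mulr_ge0// r0.
split => //.
rewrite (Rintegral_split xz fi) (le_trans (ler_normD _ _))// lerD//.
  rewrite -RintegralZl//; apply: le_norm_Rintegral => //.
  - by apply: integrableR_meas; apply: integrableR_itvS fi; rewrite subitvE/= bnd_simp lexx.
  - by move=> t /=; rewrite in_itv/= => /andP[xt ty]; rewrite mulrC f1.
  - exact: integrableRZl.
rewrite -RintegralZl//; apply: le_norm_Rintegral => //.
- by apply: integrableR_meas; apply: integrableR_itvS fi; rewrite subitvE/= bnd_simp andbT.
- by move=> t /=; rewrite in_itv/= andbT => yt; rewrite mulrC f2.
- exact: integrableRZl.
Qed.

Section potential.
Variable q : R -> R.
Hypothesis mq : measurable_fun (`]0, +oo[%classic : set (measurableTypeR R)) q.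
Hypothesis wq : integrableR `]0, +oo[ (weight q).

Lemma weight_norm_le t : 0 < t -> `|q t| <= weight q t.
Proof. by move=> t0; rewrite /weight ler_peMl// lerDl ltW. Qed.

Lemma potential_integrable : integrableR `]0, +oo[ q.
Proof.
apply: le_integrableR wq => // t /=; rewrite in_itv/= andbT; exact: weight_norm_le.
Qed.

Let wqx x : 0 <= x -> integrableR `]x, +oo[ (weight q).
Proof. by move=> x0; apply: integrableR_itvS wq; rewrite subitvE/= bnd_simp andbT. Qed.

Let mqx x : 0 <= x -> measurable_fun (`]x, +oo[%classic : set (measurableTypeR R)) q.
Proof.
by move=> x0; apply: integrableR_meas; apply: integrableR_itvS potential_integrable; rewrite subitvE/= bnd_simp andbT.
Qed.

Lemma jost_component_meas k a b y : jost_component q k a b y -> forall x, 0 <= x ->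
  measurable_fun (`]x, +oo[%classic : set (measurableTypeR R)) y.
Proof.
move=> [yc _ _] x x0; apply: open_continuous_measurable_fun; first exact: rray_open.
move=> t; rewrite inE/= in_itv/= andbT => xt; apply: yc; exact: le_lt_trans xt.
Qed.

Lemma measurable_sink k c (D : set (measurableTypeR R)) : 0 < k ->
  measurable_fun D (fun t => sink k (t - c)).
Proof.
move=> k0; apply: measurable_funTS; apply: continuous_measurable_fun => t.
exact: is_derive_continuous (is_derive_sink c t (lt0r_neq0 k0)).
Qed.

Lemma norm_sink_q_le k x t : 0 < k -> 0 <= x -> x < t ->
  `|sink k (t - x) * q t| <= weight q t.
Proof.
move=> k0 x0 xt; rewrite normrM /weight ler_wpM2r//.
rewrite (le_trans (norm_sink_le_id k0 _)) ?subr_ge0 ?ltW//; lra.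
Qed.

(** Gronwall's lemma for |y| measured in units of |a| + |b| + 1, where the 1 keeps the unit
    positive. The constant only depends on [weight q]. *)
Lemma jost_component_bounded : exists2 K, 0 < K & forall k a b y, 0 < k ->
  jost_component q k a b y -> forall x, 0 < x -> `|y x| <= K * (`|a| + `|b| + 1).
Proof.
have [K K0 HK] := gronwall wq (@weight_ge0 q).
exists K => // k a b y k0 yJ x x0.
have [yc yb yE] := yJ.
pose A := `|a| + `|b| + 1; have A0 : 0 < A by rewrite ltr_wpDl// addr_ge0.
have x20 : 0 < x / 2 by rewrite divr_gt0.
(* The a priori bound is only available away from 0, hence the start at x/2; the constant of
   Gronwall's lemma does not see it. *)
apply: (HK (x / 2) (fun x c => `|y x| <= c * A) (ltW x20)); last by lra.
- by move=> z c c' cc' /le_trans; apply; rewrite ler_wpM2r// ltW.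
- have [M HM] := yb _ x20; exists (`|M| / A); first by rewrite divr_ge0// ltW.
  by move=> z xz; rewrite divfK ?gt_eqF// (le_trans (HM z (ltW xz)))// ler_norm.
move=> z w c1 c2 xz zw c10 c20 H1 H2.
have z0 : 0 < z by exact: lt_trans xz.
have Ac (c : R) : 0 <= c -> 0 <= c * A by move=> c0; rewrite mulr_ge0// ltW.
have [|||||_ H] := @le_norm_Rintegral_split (fun t => sink k (t - z) * (q t * y t)) (weight q)
    z w (c1 * A) (c2 * A) zw (Ac _ c10) (Ac _ c20).
- apply: measurable_funM; first exact: measurable_sink.
  by apply: measurable_funM; [exact: mqx (ltW z0)|exact: jost_component_meas yJ _ (ltW z0)].
- exact: wqx (ltW z0).
- by move=> t zt; apply: weight_ge0; exact: lt_trans zt.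
- move=> t zt tw; rewrite mulrA normrM ler_pM//; last exact: H1.
  by rewrite norm_sink_q_le// ltW.
- move=> t wt; rewrite mulrA normrM ler_pM//; last exact: H2.
  by rewrite norm_sink_q_le//; [exact: ltW|exact: le_lt_trans wt].
rewrite (yE z z0) (le_trans (ler_normD _ _))//.
rewrite (_ : _ * A = A + (c1 * A * \int[mu]_(t in `]z, w]) weight q t +
    c2 * A * \int[mu]_(t in `]w, +oo[) weight q t)); last by ring.
apply: lerD H; rewrite (le_trans (ler_normD _ _))// /A ler_wpDr// !normrM lerD// ler_piMr//.
  exact: norm_cos_le1.
exact: norm_sin_le1.
Qed.

Lemma cos_lipschitz (u v : R) : `|cos u - cos v| <= `|u - v|.
Proof.
wlog uv : u v / v <= u.
  by move=> H; have [/H//|/ltW/H] := leP v u; rewrite distrC [`|v - u|]distrC.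
rewrite [leRHS]ger0_norm ?subr_ge0// -[leRHS]mul1r.
apply: (@is_derive_lipschitz _ (@cos R) (fun x => - sin x) v u 1) => // x _.
by rewrite normrN; exact: norm_sin_le1.
Qed.

Lemma sin_lipschitz (u v : R) : `|sin u - sin v| <= `|u - v|.
Proof.
wlog uv : u v / v <= u.
  by move=> H; have [/H//|/ltW/H] := leP v u; rewrite distrC [`|v - u|]distrC.
rewrite [leRHS]ger0_norm ?subr_ge0// -[leRHS]mul1r.
apply: (@is_derive_lipschitz _ (@sin R) (fun x => cos x) v u 1) => // x _.
exact: norm_cos_le1.
Qed.

Lemma sink_dist (k l s : R) : 0 < k -> 0 < l -> 0 <= s ->
  `|sink k s - sink l s| <= 2 * `|k - l| / k * s.
Proof.
move=> k0 l0 s0; have kn0 := lt0r_neq0 k0; have ln0 := lt0r_neq0 l0.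
have -> : sink k s - sink l s = (sin (k * s) - sin (l * s)) / k + sink l s * ((l - k) / k).
  by rewrite /sink; field; rewrite kn0.
rewrite (le_trans (ler_normD _ _))//.
have -> : 2 * `|k - l| / k * s = `|k - l| * s / k + s * (`|k - l| / k) by field.
have kV : `|k^-1| = k^-1 by rewrite ger0_norm// invr_ge0 ltW.
apply: lerD.
  rewrite normrM kV ler_wpM2r ?invr_ge0 ?(ltW k0)// (le_trans (sin_lipschitz _ _))//.
  by rewrite -mulrBl normrM (ger0_norm s0).
rewrite normrM; apply: ler_pM => //; first exact: norm_sink_le_id.
by rewrite normrM kV distrC.
Qed.

(** The Volterra equations for [k] and [k0] are subtracted and the difference is estimated by
    Gronwall's lemma. Continuity in k will give measurability in (x, k) jointly. *)
Lemma jost_component_continuous_k (a b : R) (Y : R -> R -> R) :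
  (forall k, 0 < k -> jost_component q k a b (Y ^~ k)) ->
  forall x k0 e, 0 < x -> 0 < k0 -> 0 < e ->
  exists2 d, 0 < d & forall k, 0 < k -> `|k - k0| < d -> `|Y x k - Y x k0| < e.
Proof.
move=> HY x k0 e x0 k00 e0.
have [K K0 HK] := gronwall wq (@weight_ge0 q).
have [K1 K10 HK1] := jost_component_bounded.
pose A := `|a| + `|b| + 1; have A0 : 0 < A by rewrite ltr_wpDl// addr_ge0.
pose W := \int[mu]_(t in `]0, +oo[) weight q t.
have W0 : 0 <= W by apply: Rintegral_ge0 => t /=; rewrite in_itv/= andbT => /weight_ge0.
have K11 : 0 < K + 1 by exact: addr_gt0.
pose w := e / 2 / (A * (K + 1)).
have w0 : 0 < w by rewrite !divr_gt0// mulr_gt0.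
have w60 : 0 < w / 6 by rewrite divr_gt0.
have /cvgrPdist_lt/(_ _ w60)[m _ /(_ m (leqnn m))] := Rintegral_tail_cvg0 wq.
rewrite /= sub0r normrN add0r => tail.
pose T : R := m%:R; have T0 : 0 <= T by [].
(* [d1] makes the free terms at [x] differ by less than e/2. The rest is measured by [w]: [d2]
   bounds the effect of the two kernels by a third of it, [d3] the effect of the free terms up to
   [T], and the tail beyond [T] gives the last third. *)
pose d1 := e / 2 / (A * (x + 1)).
pose d2 := w / 3 / (4 / k0 * (K1 * W + 1)).
pose d3 := w / 3 / (T * W + 1).
have d10 : 0 < d1 by rewrite !divr_gt0// mulr_gt0// addr_gt0.
have KW0 : 0 < K1 * W + 1 by rewrite ltr_wpDl// mulr_ge0// ltW.
have d20 : 0 < d2 by rewrite !divr_gt0// mulr_gt0// divr_gt0.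
have TW0 : 0 < T * W + 1 by rewrite ltr_wpDl// mulr_ge0.
have d30 : 0 < d3 by apply: divr_gt0 => //; apply: divr_gt0.
exists (Num.min (k0 / 2) (Num.min d1 (Num.min d2 d3))).
  by rewrite !lt_min d10 d20 d30 divr_gt0.
move=> k kpos; rewrite !lt_min => /and4P[kk0 kd1 kd2 kd3].
set D := `|k - k0|; have D0 : 0 <= D by exact: normr_ge0.
have k0k : k0 / 2 < k.
  by move: kk0; rewrite ltr_norml => /andP[+ _]; lra.
(* The difference of the trigonometric terms grows like [D * t] but never exceeds 2. It is not
   uniformly small in t; only its integral against [weight q] is. *)
pose c t := Num.min 2 (D * t).
have c0 t : 0 < t -> 0 <= c t by move=> t0; rewrite le_min ler0n/= mulr_ge0// ltW.
have wc0 t : 0 < t -> `|weight q t * c t| = weight q t * c t.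
  by move=> t0; rewrite ger0_norm//; apply: mulr_ge0; [exact: weight_ge0|exact: c0].
have pdist t : 0 < t -> `|(a * cos (k * t) + b * sin (k * t)) -
    (a * cos (k0 * t) + b * sin (k0 * t))| <= A * c t.
  move=> t0.
  have -> : (a * cos (k * t) + b * sin (k * t)) - (a * cos (k0 * t) + b * sin (k0 * t)) =
    a * (cos (k * t) - cos (k0 * t)) + b * (sin (k * t) - sin (k0 * t)) by ring.
  have kt : `|k * t - k0 * t| = D * t by rewrite -mulrBl normrM (gtr0_norm t0).
  have two : 2 = 1 + 1 :> R by ring.
  have cc : `|cos (k * t) - cos (k0 * t)| <= c t.
    rewrite le_min -kt cos_lipschitz andbT (le_trans (ler_normB _ _))// two lerD//; exact: norm_cos_le1.
  have cs : `|sin (k * t) - sin (k0 * t)| <= c t.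
    rewrite le_min -kt sin_lipschitz andbT (le_trans (ler_normB _ _))// two lerD//; exact: norm_sin_le1.
  rewrite (le_trans (ler_normD _ _))// !normrM /A mulrDl mul1r ler_wpDr ?c0// mulrDl.
  by rewrite lerD// ler_wpM2l.
have mc (z : R) : measurable_fun (`]z, +oo[%classic : set (measurableTypeR R)) c.
  apply: measurable_minr => //; exact: measurable_funM.
have iwc z : 0 <= z -> integrableR `]z, +oo[ (fun t => weight q t * c t).
  move=> z0; apply: (@le_integrableR _ _ _ (fun t => 2 * weight q t)) => //.
  - by apply: measurable_funM => //; exact: integrableR_meas (wqx z0).
  - move=> t /=; rewrite in_itv/= andbT => zt.
    have t0 : 0 < t by exact: le_lt_trans zt.
    by rewrite wc0// mulrC ler_wpM2r ?weight_ge0// ge_min lexx.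
  - by apply: integrableRZl => //; exact: wqx.
have wc_small z : 0 <= z -> \int[mu]_(t in `]z, +oo[) (weight q t * c t) <= D * T * W + 2 * (w / 6).
  move=> z0; apply: (@le_trans _ _ (\int[mu]_(t in `]0, +oo[) (weight q t * c t))).
    apply: Rintegral_itv_le; first by rewrite subitvE/= bnd_simp andbT.
      by move=> t; rewrite in_itv/= andbT => t0; rewrite mulr_ge0 ?weight_ge0 ?c0.
    exact: iwc.
  have DT0 : 0 <= D * T by exact: mulr_ge0.
  have [|||||_] := @le_norm_Rintegral_split (fun t => weight q t * c t) (weight q)
    0 T (D * T) 2 T0 DT0 (ltW (ltr0Sn _ 1)).
  - by apply: measurable_funM => //; exact: integrableR_meas wq.
  - exact: wq.
  - exact: weight_ge0.
  - move=> t t0 tT; rewrite wc0// ler_wpM2l ?weight_ge0//.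
    by rewrite ge_min ler_wpM2l ?orbT.
  - move=> t Tt; have t0 := le_lt_trans T0 Tt.
    rewrite wc0// ler_wpM2l ?weight_ge0//.
    by rewrite ge_min lexx.
  move=> H; rewrite (le_trans (ler_norm _))// (le_trans H)// lerD//.
    rewrite ler_wpM2l//; apply: Rintegral_itv_le => //; first by rewrite subitvE/= bnd_simp lexx.
    by move=> t; rewrite in_itv/= andbT => /weight_ge0.
  by rewrite ler_wpM2l// (le_trans (ler_norm _))// ltW.
have small : 2 * D / k * (K1 * A) * W + A * (D * T * W + 2 * (w / 6)) <= A * w.
  have h2 : 2 * D / k * (K1 * W) <= w / 3.
    move: kd2; rewrite -/D /d2 ltr_pdivlMr; last by rewrite mulr_gt0// divr_gt0.
    move=> h; apply: le_trans (ltW h).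
    rewrite (_ : 2 * D / k * (K1 * W) = D * (2 / k * (K1 * W))); last by ring.
    rewrite ler_wpM2l// ler_pM//.
    - by rewrite divr_ge0// ltW.
    - by rewrite mulr_ge0// ltW.
    - rewrite ler_pdivrMr// mulrAC ler_pdivlMr//; lra.
    - by rewrite lerDl.
  have h3 : D * T * W <= w / 3.
    move: kd3; rewrite -/D /d3 ltr_pdivlMr// => h; apply: le_trans (ltW h).
    by rewrite -mulrA ler_wpM2l// lerDl.
  have -> : 2 * D / k * (K1 * A) * W = A * (2 * D / k * (K1 * W)) by ring.
  rewrite -mulrDr ler_wpM2l ?(ltW A0)//; lra.
have x20 : 0 < x / 2 by rewrite divr_gt0.
have Ybound t l : 0 < t -> 0 < l -> `|Y t l| <= K1 * A.
  by move=> t0 l0; exact: (HK1 _ _ _ _ l0 (HY l l0)).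
(* The pointwise part [c x] is kept apart, and Gronwall's lemma is applied to the excess over it, in
   units of [w]. *)
have key : `|Y x k - Y x k0| <= A * (c x + K * w).
  apply: (HK (x / 2) (fun x cc => `|Y x k - Y x k0| <= A * (c x + cc * w)) (ltW x20)); last by lra.
  - move=> z e1 e2 e12 /le_trans; apply.
    by rewrite ler_wpM2l ?(ltW A0)// lerD2l ler_wpM2r// ltW.
  - exists (2 * K1 / w); first by apply: divr_ge0; [apply: mulr_ge0 => //; exact: ltW|exact: ltW].
    move=> z xz; have z0 : 0 < z by exact: lt_trans xz.
    rewrite divfK ?gt_eqF// (le_trans (ler_normB _ _))//.
    rewrite (le_trans (lerD (Ybound z k z0 kpos) (Ybound z k0 z0 k00)))//.
    rewrite (_ : A * (c z + 2 * K1) = A * c z + (K1 * A + K1 * A)); last by ring.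
    by rewrite lerDr mulr_ge0 ?(ltW A0)// c0.
  move=> z v c1 c2 xz zv c10 c20 H1 H2.
  have z0 : 0 < z by exact: lt_trans xz.
  have [_ _ E] := HY k kpos; have [_ _ E0] := HY k0 k00.
  have mYk l : 0 < l -> measurable_fun (`]z, +oo[%classic : set (measurableTypeR R)) (Y ^~ l).
    move=> l0; exact: (jost_component_meas (HY l l0) (ltW z0)).
  have iq l s : 0 < l -> 0 < s -> integrableR `]z, +oo[ (fun t => sink l (t - z) * (q t * Y t s)).
    move=> l0 s0; apply: (@le_integrableR _ _ _ (fun t => K1 * A * weight q t)) => //.
    - apply: measurable_funM; first exact: measurable_sink.
      by apply: measurable_funM; [exact: mqx (ltW z0)|exact: mYk].
    - move=> t /=; rewrite in_itv/= andbT => zt; have t0 : 0 < t by exact: lt_trans zt.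
      by rewrite mulrA normrM mulrC ler_pM// ?Ybound// norm_sink_q_le// ltW.
    - by apply: integrableRZl => //; exact: wqx (ltW z0).
  have split1 : Y z k - Y z k0 = ((a * cos (k * z) + b * sin (k * z)) -
      (a * cos (k0 * z) + b * sin (k0 * z))) +
      \int[mu]_(t in `]z, +oo[) ((sink k (t - z) - sink k0 (t - z)) * (q t * Y t k0)) +
      \int[mu]_(t in `]z, +oo[) (sink k (t - z) * (q t * (Y t k - Y t k0))).
    have -> : \int[mu]_(t in `]z, +oo[) ((sink k (t - z) - sink k0 (t - z)) * (q t * Y t k0)) =
      \int[mu]_(t in `]z, +oo[) (sink k (t - z) * (q t * Y t k0)) -
      \int[mu]_(t in `]z, +oo[) (sink k0 (t - z) * (q t * Y t k0)).
      rewrite -RintegralB//; [|exact: iq|exact: iq].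
      by apply: Rintegral_eq => t _; ring.
    have -> : \int[mu]_(t in `]z, +oo[) (sink k (t - z) * (q t * (Y t k - Y t k0))) =
      \int[mu]_(t in `]z, +oo[) (sink k (t - z) * (q t * Y t k)) -
      \int[mu]_(t in `]z, +oo[) (sink k (t - z) * (q t * Y t k0)).
      rewrite -RintegralB//; [|exact: iq|exact: iq].
      by apply: Rintegral_eq => t _; ring.
    rewrite (E z z0) (E0 z z0); ring.
  have B1 : `|\int[mu]_(t in `]z, +oo[) ((sink k (t - z) - sink k0 (t - z)) * (q t * Y t k0))| <=
      2 * D / k * (K1 * A) * W.
    apply: (@le_trans _ _ (\int[mu]_(t in `]z, +oo[) (2 * D / k * (K1 * A) * weight q t))).
      apply: le_norm_Rintegral => //.
      - apply: measurable_funM; first by apply: measurable_funB; exact: measurable_sink.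
        by apply: measurable_funM; [exact: mqx (ltW z0)|exact: mYk].
      - move=> t /=; rewrite in_itv/= andbT => zt; have t0 : 0 < t by exact: lt_trans zt.
        rewrite !normrM.
        have s1 : `|sink k (t - z) - sink k0 (t - z)| <= 2 * D / k * (1 + t).
          rewrite (le_trans (sink_dist _ _ _))// ?subr_ge0 ?(ltW zt)//.
          by rewrite ler_wpM2l ?divr_ge0 ?mulr_ge0 ?(ltW kpos)//; lra.
        rewrite (_ : _ * weight q t = 2 * D / k * (1 + t) * (`|q t| * (K1 * A))); last by rewrite /weight; ring.
        by rewrite ler_pM// ler_wpM2l// Ybound.
      - by apply: integrableRZl => //; exact: wqx (ltW z0).
    rewrite RintegralZl//; last exact: wqx (ltW z0).
    rewrite ler_wpM2l//.
      by rewrite mulr_ge0 ?divr_ge0 ?mulr_ge0 ?(ltW kpos) ?(ltW K10) ?(ltW A0).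
    apply: Rintegral_itv_le => //; first by rewrite subitvE/= bnd_simp ltW.
    by move=> t; rewrite in_itv/= andbT => /weight_ge0.
  have mD : measurable_fun (`]z, +oo[%classic : set (measurableTypeR R))
      (fun t => sink k (t - z) * (q t * (Y t k - Y t k0))).
    apply: measurable_funM; first exact: measurable_sink.
    by apply: measurable_funM; [exact: mqx (ltW z0)|apply: measurable_funB; exact: mYk].
  have Z0 : integrableR `]z, +oo[ (fun t => A * (weight q t * c t)).
    by apply: integrableRZl => //; exact: iwc (ltW z0).
  have iz := wqx (ltW z0).
  have iz1 : integrableR `]z, v] (weight q) by apply: integrableR_itvS iz; rewrite subitvE/= bnd_simp lexx.
  have iz2 : integrableR `]v, +oo[ (weight q) by apply: integrableR_itvS iz; rewrite subitvE/= bnd_simp andbT.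
  have Aw0 : 0 <= A * w by rewrite mulr_ge0// ltW.
  have pt t cc : z < t -> `|Y t k - Y t k0| <= A * (c t + cc * w) ->
      `|sink k (t - z) * (q t * (Y t k - Y t k0))| <= A * (weight q t * c t) + A * w * cc * weight q t.
    move=> zt H; rewrite mulrA normrM.
    have -> : A * (weight q t * c t) + A * w * cc * weight q t = weight q t * (A * (c t + cc * w)) by ring.
    by rewrite ler_pM// norm_sink_q_le// ltW.
  have B2 : `|\int[mu]_(t in `]z, +oo[) (sink k (t - z) * (q t * (Y t k - Y t k0)))| <=
      A * (D * T * W + 2 * (w / 6)) + A * w * (c1 * \int[mu]_(t in `]z, v]) weight q t +
        c2 * \int[mu]_(t in `]v, +oo[) weight q t).
    have iD : integrableR `]z, +oo[ (fun t => sink k (t - z) * (q t * (Y t k - Y t k0))).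
      apply: (integrableR_eq _ _ (integrableRB _ (iq k k kpos kpos) (iq k k0 kpos k00))) => // t _; ring.
    rewrite (Rintegral_split zv iD) (le_trans (ler_normD _ _))//.
    have P1 : `|\int[mu]_(t in `]z, v]) (sink k (t - z) * (q t * (Y t k - Y t k0)))| <=
       \int[mu]_(t in `]z, v]) (A * (weight q t * c t)) + A * w * c1 * \int[mu]_(t in `]z, v]) weight q t.
      have Zi : integrableR `]z, v] (fun t => A * (weight q t * c t)).
        by apply: integrableR_itvS Z0; rewrite subitvE/= bnd_simp lexx.
      have Zj : integrableR `]z, v] (fun t => A * w * c1 * weight q t) by exact: integrableRZl.
      rewrite -RintegralZl// -RintegralD//; apply: le_norm_Rintegral => //.
      - by apply: integrableR_meas; apply: integrableR_itvS iD; rewrite subitvE/= bnd_simp lexx.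
      - by move=> t /=; rewrite in_itv/= => /andP[zt tv]; apply: pt => //; exact: H1.
      - exact: integrableRD.
    have P2 : `|\int[mu]_(t in `]v, +oo[) (sink k (t - z) * (q t * (Y t k - Y t k0)))| <=
       \int[mu]_(t in `]v, +oo[) (A * (weight q t * c t)) + A * w * c2 * \int[mu]_(t in `]v, +oo[) weight q t.
      have Zi : integrableR `]v, +oo[ (fun t => A * (weight q t * c t)).
        by apply: integrableR_itvS Z0; rewrite subitvE/= bnd_simp andbT.
      have Zj : integrableR `]v, +oo[ (fun t => A * w * c2 * weight q t) by exact: integrableRZl.
      rewrite -RintegralZl// -RintegralD//; apply: le_norm_Rintegral => //.
      - by apply: integrableR_meas; apply: integrableR_itvS iD; rewrite subitvE/= bnd_simp andbT.
      - move=> t /=; rewrite in_itv/= andbT => vt; apply: pt => //; last exact: H2.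
        exact: le_lt_trans vt.
      - exact: integrableRD.
    have S0 := Rintegral_split zv Z0.
    have S1 : \int[mu]_(t in `]z, +oo[) (A * (weight q t * c t)) <= A * (D * T * W + 2 * (w / 6)).
      rewrite RintegralZl//; last exact: iwc (ltW z0).
      by rewrite ler_wpM2l ?(ltW A0)// wc_small// ltW.
    rewrite S0 in S1; apply: (le_trans (lerD P1 P2)); rewrite addrACA.
    by apply: lerD => //; rewrite mulrDr !mulrA.
  have B0 := pdist z z0.
  rewrite split1 (le_trans (ler_normD _ _))//.
  have N := ler_normD ((a * cos (k * z) + b * sin (k * z)) - (a * cos (k0 * z) + b * sin (k0 * z)))
     (\int[mu]_(t in `]z, +oo[) ((sink k (t - z) - sink k0 (t - z)) * (q t * Y t k0))).
  move: N B0 B1 B2 small; set i1 := Rintegral _ _ _; set i2 := Rintegral _ _ _.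
  set i3 := Rintegral _ _ _; set i4 := Rintegral _ _ _.
  lra.
apply: (le_lt_trans key).
have cx : A * c x < e / 2.
  move: kd1; rewrite -/D /d1 ltr_pdivlMr; last by rewrite mulr_gt0// addr_gt0.
  apply: le_lt_trans; rewrite mulrCA ler_wpM2l ?(ltW A0)// ge_min; apply/orP; right.
  by rewrite ler_wpM2l// lerDl.
have wK : A * (K * w) <= e / 2.
  have -> : A * (K * w) = e / 2 * (K / (K + 1)).
    by rewrite /w; field; rewrite !gt_eqF.
  by rewrite ler_piMr ?divr_ge0 ?(ltW e0)// ler_pdivrMr// mul1r lerDl.
rewrite mulrDr; lra.
Qed.

End potential.
End jost_estimates.

(** * Transport along one Jost solution *)

Section measurability.
Context {R : realType}.
Local Notation mu := (@lebesgue_measure R).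
Local Notation Rm := (measurableTypeR R).

Lemma measurable_fun_fst (D1 D2 : set Rm) (f : R -> R) : measurable D1 -> measurable D2 ->
  measurable_fun D1 f -> measurable_fun (D1 `*` D2) (fun z => f z.1).
Proof.
move=> mD1 mD2 mf; apply: (measurable_comp mD1 _ mf).
  by move=> _ [z [z1 _] <-].
exact: measurable_funTS.
Qed.

Lemma measurable_fun_snd (D1 D2 : set Rm) (f : R -> R) : measurable D1 -> measurable D2 ->
  measurable_fun D2 f -> measurable_fun (D1 `*` D2) (fun z => f z.2).
Proof.
move=> mD1 mD2 mf; apply: (measurable_comp mD2 _ mf).
  by move=> _ [z [_ z2] <-].
exact: measurable_funTS.
Qed.

Lemma measurable_fun_swap (D1 D2 : set Rm) (f : R -> R -> R) : measurable D1 -> measurable D2 ->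
  measurable_fun (D1 `*` D2) (fun z => f z.1 z.2) ->
  measurable_fun (D2 `*` D1) (fun z => f z.2 z.1).
Proof.
move=> mD1 mD2 mf.
apply: (@measurable_comp _ _ _ _ _ _ (D1 `*` D2) (fun z => f z.1 z.2) (D2 `*` D1) (fun z => (z.2, z.1))).
- exact: measurableX.
- by move=> _ [z [z1 z2] <-].
- exact: mf.
- by apply: measurable_funTS; apply: measurable_fun_pair.
Qed.

Lemma measurable_fun_cos d (T : measurableType d) (D : set T) (f : T -> R) :
  measurable_fun D f -> measurable_fun D (fun z => cos (f z)).
Proof.
apply: measurableT_comp; apply: continuous_measurable_fun; exact: continuous_cos.
Qed.

Lemma measurable_fun_sin d (T : measurableType d) (D : set T) (f : T -> R) :
  measurable_fun D f -> measurable_fun D (fun z => sin (f z)).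
Proof.
apply: measurableT_comp; apply: continuous_measurable_fun; exact: continuous_sin.
Qed.

(** Carathéodory's argument: measurable in x and continuous in k, [Y] is the pointwise limit of
    functions that are step functions in k. *)
Lemma measurable_fun_separately (Y : R -> R -> R) :
  (forall k, 0 < k -> measurable_fun (`]0, +oo[%classic : set Rm) (Y ^~ k)) ->
  (forall x k0 e, 0 < x -> 0 < k0 -> 0 < e ->
    exists2 d, 0 < d & forall k, 0 < k -> `|k - k0| < d -> `|Y x k - Y x k0| < e) ->
  measurable_fun ((`]0, +oo[%classic : set Rm) `*` (`]0, +oo[%classic : set Rm)) (fun z => Y z.1 z.2).
Proof.
move=> mY cY; set P : set Rm := `]0, +oo[%classic.
have mP : measurable P by [].
pose idx (n : nat) (k : R) := Num.truncn (n.+1%:R * k).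
(* The right end of the grid cell of [k] is chosen, since it is always positive. *)
pose g (n : nat) (k : R) : R := (idx n k).+1%:R / n.+1%:R.
have g0 n k : 0 < g n k by rewrite divr_gt0.
have gk n k : 0 < k -> `|g n k - k| <= n.+1%:R^-1.
  move=> k0; have nk0 : 0 <= n.+1%:R * k by rewrite mulr_ge0// ltW.
  have /andP[l u] := truncn_itv nk0.
  have -> : g n k - k = ((idx n k).+1%:R - n.+1%:R * k) / n.+1%:R by rewrite /g; field.
  rewrite normrM [`|n.+1%:R^-1|]ger0_norm// ler_piMl//.
  move: l u; rewrite -/(idx n k) -natr1 => l u.
  by rewrite ger0_norm; lra.
apply: (measurable_fun_cvg (h := fun n z => Y z.1 (g n z.2))) => [n|[x k] /= [xP kP]]; last first.
  move: xP kP; rewrite /P/= !in_itv/= !andbT => x0 k0.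
  apply/cvgrPdist_lt => e e0; have [d d0 H] := cY x k e x0 k0 e0.
  near=> n; rewrite distrC; apply: H => //; rewrite (le_lt_trans (gk _ _ k0))//.
  by near: n; exact: near_infty_natSinv_lt (PosNum d0).
pose E j := P `*` (P `&` (`[j%:R / n.+1%:R, j.+1%:R / n.+1%:R[%classic : set Rm)).
have mE j : measurable (E j) by apply: measurableX => //; exact: measurableI.
have -> : P `*` P = \bigcup_j E j.
  apply/seteqP; split => [[x k] /= [xP kP]|[x k] [j _] [/= ? []]]//.
  exists (idx n k) => //; split => //; split => //=.
  move: kP; rewrite /P/= !in_itv/= andbT => k0.
  have nk0 : 0 <= n.+1%:R * k by rewrite mulr_ge0// ltW.
  by rewrite ler_pdivrMr// ltr_pdivlMr// mulrC; exact: truncn_itv.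
apply/(measurable_fun_bigcup _ mE) => j.
apply: (@eq_measurable_fun _ _ _ _ _ (fun z => Y z.1 (j.+1%:R / n.+1%:R))).
  move=> [x k]; rewrite inE => -[/= xP [kP kj]]; rewrite /g; congr (Y _ (_.+1%:R / _)).
  apply/esym/truncn_def; move: kj; rewrite in_itv/=.
  by rewrite ler_pdivrMr// ltr_pdivlMr// mulrC.
apply: (measurable_fun_fst (f := Y ^~ (j.+1%:R / n.+1%:R))) => //; first exact: measurableI.
by apply: mY; rewrite divr_gt0.
Unshelve. all: by end_near. Qed.

End measurability.

(** * Multiplication by phases in real coordinates *)

Section rotation.
Context {R : realType}.
Local Notation mu := (@lebesgue_measure R).
Local Notation Rm := (measurableTypeR R).
Implicit Types (a b s t x : R).

(* Real and imaginary parts of (a + ib) e^(is). *)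
Definition rotr a b s := a * cos s - b * sin s.
Definition roti a b s := a * sin s + b * cos s.

Lemma rotr_add a b s t : rotr (rotr a b s) (roti a b s) t = rotr a b (s + t).
Proof. by rewrite /rotr /roti cosD sinD; ring. Qed.

Lemma norm_rotr_le a b s : `|rotr a b s| <= `|a| + `|b|.
Proof.
rewrite (le_trans (ler_normB _ _))// !normrM lerD// ler_piMr//.
  exact: norm_cos_le1.
exact: norm_sin_le1.
Qed.

Lemma norm_roti_le a b s : `|roti a b s| <= `|a| + `|b|.
Proof.
rewrite (le_trans (ler_normD _ _))// !normrM lerD// ler_piMr//.
  exact: norm_sin_le1.
exact: norm_cos_le1.
Qed.

Lemma measurable_fun_rotr d (T : measurableType d) (D : set T) (a b s : T -> R) :
  measurable_fun D a -> measurable_fun D b -> measurable_fun D s ->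
  measurable_fun D (fun z => rotr (a z) (b z) (s z)).
Proof.
move=> ma mb ms; apply: measurable_funB; apply: measurable_funM => //.
  exact: measurable_fun_cos.
exact: measurable_fun_sin.
Qed.

Lemma measurable_fun_roti d (T : measurableType d) (D : set T) (a b s : T -> R) :
  measurable_fun D a -> measurable_fun D b -> measurable_fun D s ->
  measurable_fun D (fun z => roti (a z) (b z) (s z)).
Proof.
move=> ma mb ms; apply: measurable_funD; apply: measurable_funM => //.
  exact: measurable_fun_sin.
exact: measurable_fun_cos.
Qed.

(* The kernel of d'Alembert's formula. *)
Lemma sink_rotr (k a b s x t : R) : 0 < k -> x <= t ->
  sink k (t - x) * rotr a b (k * (s - x)) =
  \int[mu]_(r in `]s, s + 2 * (t - x)]) (2^-1 * rotr a b (k * (r - t))).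
Proof.
move=> k0; have kn0 := lt0r_neq0 k0; rewrite le_eqVlt => /predU1P[->|xt].
  by rewrite subrr mulr0 addr0 set_itvoc0// Rintegral_set0 /sink mulr0 sin0 mul0r mul0r.
pose F r := (2 * k)^-1 * roti a b (k * (r - t)).
pose f r := 2^-1 * rotr a b (k * (r - t)).
have dF (r : R) : is_derive r 1 F (f r).
  have dc := is_derive_cosk k t r; have ds := is_derive_sinkk k t r.
  apply: is_derive_eq; rewrite /f /rotr /GRing.scale/=; field.
  by [].
have cf : continuous f.
  move=> r; apply: cvgM; first exact: cvg_cst.
  apply: cvgB; (apply: cvgM; first exact: cvg_cst).
    exact: is_derive_continuous (is_derive_cosk k t r).
  exact: is_derive_continuous (is_derive_sinkk k t r).
have sT : s < s + 2 * (t - x) by rewrite ltrDl mulr_gt0// subr_gt0.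
have If : integrableR `[s, s + 2 * (t - x)] f.
  apply: continuous_compact_integrable; first exact: segment_compact.
  exact: continuous_subspaceT.
have FTC := @continuous_FTC2 R f F s (s + 2 * (t - x)) sT.
have {FTC} : \int[mu]_(r in `[s, s + 2 * (t - x)]) f r = F (s + 2 * (t - x)) - F s.
  rewrite /Rintegral FTC//.
  - exact: continuous_subspaceT.
  - split => [r _||].
    + by have [] := dF r.
    + exact/cvg_at_right_filter/(is_derive_continuous (dF _)).
    + exact/cvg_at_left_filter/(is_derive_continuous (dF _)).
  - by move=> r _; rewrite derive1E; have [_ ->] := dF r.
rewrite -Rintegral_itv_obnd_cbnd; last by apply: integrableR_itvS If; rewrite subitvE; apply/andP; split; rewrite bnd_simp.
rewrite /f => ->; rewrite /F /rotr /roti /sink.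
have -> : k * (s + 2 * (t - x) - t) = k * (s - x) + k * (t - x) by ring.
have -> : k * (s - t) = k * (s - x) - k * (t - x) by ring.
rewrite !sinD !cosD sinN cosN; field.
by [].
Qed.

End rotation.

Lemma integrableR_cst {R : realType} (x y c : R) : x <= y ->
  integrableR (`]x, y]%classic : set (measurableTypeR R)) (fun=> c).
Proof.
move=> xy; apply/integrableP; split; first exact: measurable_cst.
under eq_integral do rewrite /=.
by rewrite integral_cst//= (lebesgue_measure_oc xy) -EFinM ltry.
Qed.

(** * The integral equation of the transforms and its Gronwall estimate *)

Section transport.
Context {R : realType}.
Local Notation mu := (@lebesgue_measure R).
Local Notation Rm := (measurableTypeR R).
Local Notation P := (`]0, +oo[%classic : set Rm).
Implicit Types (a b : R -> R) (s t x k : R).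

(** The function Psi. Minus the imaginary part of the same complex integral is [ftrans] of the pair
    (-b, a). *)
Definition ftrans a b s := \int[mu]_(k in P) rotr (a k) (b k) (k * s).

(** Together with [mulim], the parts of (a + ib)(Y1 + i Y2). *)
Definition mulre a b (Y1 Y2 : R -> R -> R) x k := a k * Y1 x k - b k * Y2 x k.
Definition mulim a b (Y1 Y2 : R -> R -> R) x k := a k * Y2 x k + b k * Y1 x k.

Lemma measurable_fun_section (f : R -> R -> R) t : 0 < t ->
  measurable_fun (P `*` P) (fun z => f z.1 z.2) -> measurable_fun P (f t).
Proof.
move=> t0 mf; apply: (@measurable_comp _ _ _ _ _ _ (P `*` P) (fun z => f z.1 z.2) P (pair t)) => //.
- exact: measurableX.
- by move=> _ [k kP <-] /=; split => //; rewrite /= in_itv/= t0.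
- by apply: measurable_funTS; apply: measurable_fun_pair.
Qed.

Variable q : R -> R.
Hypothesis mq : measurable_fun P q.
Hypothesis wq : integrableR P (weight q).

Definition jost_pair (Y1 Y2 : R -> R -> R) :=
  (forall k, 0 < k -> jost_component q k 1 0 (Y1 ^~ k)) /\
  (forall k, 0 < k -> jost_component q k 0 1 (Y2 ^~ k)).

Lemma jost_pair_measurable Y1 Y2 : jost_pair Y1 Y2 ->
  measurable_fun (P `*` P) (fun z => Y1 z.1 z.2) /\
  measurable_fun (P `*` P) (fun z => Y2 z.1 z.2).
Proof.
by move=> [J1 J2]; split; apply: measurable_fun_separately;
  try (by move=> k k0; apply: (jost_component_meas (q := q) _ (lexx 0)); eauto);
  apply: (jost_component_continuous_k mq wq); eauto.
Qed.

Lemma jost_pair_bounded : exists2 C, 0 < C & forall Y1 Y2, jost_pair Y1 Y2 ->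
  forall x k, 0 < x -> 0 < k -> `|Y1 x k| <= C /\ `|Y2 x k| <= C.
Proof.
have [K K0 HK] := jost_component_bounded mq wq.
exists (K * 2); first by rewrite mulr_gt0.
move=> Y1 Y2 [J1 J2] x k x0 k0; split.
  apply: le_trans (HK _ _ _ _ k0 (J1 k k0) x x0) _.
  by rewrite normr1 normr0 addr0 (_ : 1 + 1 = 2)//; ring.
apply: le_trans (HK _ _ _ _ k0 (J2 k k0) x x0) _.
by rewrite normr1 normr0 add0r (_ : 1 + 1 = 2)//; ring.
Qed.

Lemma mulre_bounds Y1 Y2 C a b x k : 0 <= C -> `|Y1 x k| <= C /\ `|Y2 x k| <= C ->
  `|mulre a b Y1 Y2 x k| <= C * (`|a k| + `|b k|) /\
  `|mulim a b Y1 Y2 x k| <= C * (`|a k| + `|b k|).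
Proof.
move=> C0 [b1 b2]; split.
  by rewrite (le_trans (ler_normB _ _))// !normrM mulrDr lerD// mulrC ler_wpM2r.
by rewrite (le_trans (ler_normD _ _))// !normrM mulrDr lerD// mulrC ler_wpM2r.
Qed.

Lemma measurable_mulre Y1 Y2 a b : measurable_fun P a -> measurable_fun P b -> jost_pair Y1 Y2 ->
  measurable_fun (P `*` P) (fun z => mulre a b Y1 Y2 z.1 z.2) /\
  measurable_fun (P `*` P) (fun z => mulim a b Y1 Y2 z.1 z.2).
Proof.
move=> ma mb /jost_pair_measurable[m1 m2].
have ma2 : measurable_fun (P `*` P) (fun z => a z.2) by exact: measurable_fun_snd.
have mb2 : measurable_fun (P `*` P) (fun z => b z.2) by exact: measurable_fun_snd.
by split; [apply: measurable_funB|apply: measurable_funD]; apply: measurable_funM.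
Qed.

Section volterra.
Variables (Y1 Y2 : R -> R -> R) (a b : R -> R) (C : R).
Hypothesis J : jost_pair Y1 Y2.
Hypotheses (ia : integrableR P a) (ib : integrableR P b).
Hypothesis C0 : 0 < C.
Hypothesis HC : forall x k, 0 < x -> 0 < k -> `|Y1 x k| <= C /\ `|Y2 x k| <= C.

Let pr := mulre a b Y1 Y2.
Let pi := mulim a b Y1 Y2.
Let G k := 2 * C * (`|a k| + `|b k|).

Let iG : integrableR P G.
Proof.
by apply: integrableRZl => //; apply: integrableRD => //; exact: integrableR_norm.
Qed.

Let rotG x k th : 0 < x -> 0 < k -> `|rotr (pr x k) (pi x k) th| <= G k.
Proof.
move=> x0 k0; have [B1 B2] := mulre_bounds a b (ltW C0) (HC x0 k0).
rewrite (le_trans (norm_rotr_le _ _ _))// (le_trans (lerD B1 B2))// /G.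
by rewrite le_eqVlt; apply/orP; left; apply/eqP; ring.
Qed.

Let mpr : measurable_fun (P `*` P) (fun z => pr z.1 z.2).
Proof. by have [] := measurable_mulre (integrableR_meas ia) (integrableR_meas ib) J. Qed.

Let mpi : measurable_fun (P `*` P) (fun z => pi z.1 z.2).
Proof. by have [] := measurable_mulre (integrableR_meas ia) (integrableR_meas ib) J. Qed.

Let mP : measurable P. Proof. exact: measurable_itvR. Qed.

Let PE x : P x = (0 < x) :> Prop.
Proof. by rewrite /= in_itv/= andbT. Qed.

Let irot t th : 0 < t -> integrableR P (fun k => rotr (pr t k) (pi t k) (k * th)).
Proof.
move=> t0; apply: (le_integrableR mP _ _ iG).
  apply: measurable_fun_rotr; [exact: measurable_fun_section|exact: measurable_fun_section|].
  by apply: measurable_funM; [exact: measurable_id|exact: measurable_cst].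
by move=> k; rewrite PE => k0; exact: rotG.
Qed.

Let irot0 th : integrableR P (fun k => rotr (a k) (b k) (k * th)).
Proof.
apply: (le_integrableR mP _ _ (integrableRD mP (integrableR_norm ia) (integrableR_norm ib))).
  apply: measurable_fun_rotr; [exact: integrableR_meas ia|exact: integrableR_meas ib|].
  by apply: measurable_funM; [exact: measurable_id|exact: measurable_cst].
by move=> k _; exact: norm_rotr_le.
Qed.

Let F s x k t := sink k (t - x) * (q t * rotr (pr t k) (pi t k) (k * (s - x))).

Let u s x := ftrans (pr x) (pi x) (s - x).

(** The Volterra equation multiplied by (a + ib) e^{ik(s - x)}, in its real part. *)
Let Fpoint s x k : 0 < x -> 0 < k ->
  rotr (pr x k) (pi x k) (k * (s - x)) - rotr (a k) (b k) (k * s) =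
  \int[mu]_(t in `]x, +oo[) F s x k t.
Proof.
move=> x0 k0; have [J1 J2] := J.
have [c1 _ E1] := J1 k k0; have [c2 _ E2] := J2 k k0.
have ij (Y : R -> R -> R) : (forall t, 0 < t -> {for t, continuous (Y ^~ k)}) ->
    (forall t, 0 < t -> `|Y t k| <= C) ->
    integrableR `]x, +oo[ (fun t => sink k (t - x) * (q t * Y t k)).
  move=> cY bY; apply: (@le_integrableR _ _ _ (fun t => C * weight q t)) => //.
  - apply: measurable_funM; first exact: measurable_sink.
    apply: measurable_funM.
      apply: integrableR_meas; apply: integrableR_itvS (potential_integrable mq wq).
      by rewrite subitvE/= bnd_simp ltW.
    apply: open_continuous_measurable_fun; first exact: rray_open.
    by move=> t; rewrite inE/= in_itv/= andbT => xt; apply: cY; exact: lt_trans xt.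
  - move=> t /=; rewrite in_itv/= andbT => xt.
    by rewrite mulrA normrM mulrC ler_pM// ?bY ?(lt_trans x0)// norm_sink_q_le// ltW.
  - apply: integrableRZl => //; apply: integrableR_itvS wq.
    by rewrite subitvE/= bnd_simp ltW.
have i1 : integrableR `]x, +oo[ (fun t => sink k (t - x) * (q t * Y1 t k)).
  by apply: ij => // t t0; have [] := HC t0 k0.
have i2 : integrableR `]x, +oo[ (fun t => sink k (t - x) * (q t * Y2 t k)).
  by apply: ij => // t t0; have [] := HC t0 k0.
pose th := k * (s - x).
pose A := a k * cos th - b k * sin th; pose B := - (b k * cos th + a k * sin th).
have -> : \int[mu]_(t in `]x, +oo[) F s x k t =
    A * \int[mu]_(t in `]x, +oo[) (sink k (t - x) * (q t * Y1 t k)) +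
    B * \int[mu]_(t in `]x, +oo[) (sink k (t - x) * (q t * Y2 t k)).
  rewrite -!RintegralZl// -RintegralD//; [|exact: integrableRZl|exact: integrableRZl].
  by apply: Rintegral_eq => t _; rewrite /F /pr /pi /mulre /mulim /rotr /A /B /th; ring.
have -> : k * s = k * x + th by rewrite /th; ring.
rewrite /pr /pi /mulre /mulim (E1 x x0) (E2 x x0) /rotr /A /B -/th cosD sinD; ring.
Qed.

Let FB s x k t : 0 < x -> x < t -> 0 < k -> `|F s x k t| <= G k * weight q t.
Proof.
move=> x0 xt k0; rewrite /F mulrA normrM mulrC ler_pM//; last by rewrite norm_sink_q_le// ltW.
by rewrite rotG// (lt_trans x0).
Qed.

Let mF s x : 0 < x -> measurable_fun (P `*` (`]x, +oo[%classic : set Rm)) (fun z => F s x z.1 z.2).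
Proof.
move=> x0; set Q := (`]x, +oo[%classic : set Rm).
have QP : Q `<=` P.
  by move=> t; rewrite /Q/= !in_itv/= !andbT => xt; exact: lt_trans xt.
have sub : P `*` Q `<=` P `*` P by move=> z [? ?]; split => //; exact: QP.
have mPP : measurable (P `*` P) by exact: measurableX.
have m1 : measurable_fun (P `*` Q) (fun z => z.1 : R) by apply: (measurable_fun_fst (f := id)).
have m2 : measurable_fun (P `*` Q) (fun z => z.2 : R) by apply: (measurable_fun_snd (f := id)).
have minv : measurable_fun P (fun k : R => k^-1).
  apply: open_continuous_measurable_fun; first exact: rray_open.
  by move=> t; rewrite inE/= in_itv/= andbT => t0; apply: inv_continuous; rewrite gt_eqF.
have minv1 : measurable_fun (P `*` Q) (fun z => z.1^-1).
  by apply: (measurable_fun_fst (f := fun k => k^-1)).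
have mPr : measurable_fun (P `*` Q) (fun z => pr z.2 z.1).
  by apply: (measurable_funS mPP sub); exact: (measurable_fun_swap (f := pr)).
have mPi : measurable_fun (P `*` Q) (fun z => pi z.2 z.1).
  by apply: (measurable_funS mPP sub); exact: (measurable_fun_swap (f := pi)).
have mq2 : measurable_fun (P `*` Q) (fun z => q z.2).
  apply: measurable_fun_snd => //; apply: measurable_funS mq => //.
apply: measurable_funM.
  apply: measurable_funM => //; apply: measurable_fun_sin; apply: measurable_funM => //.
  by apply: measurable_funB => //; exact: measurable_cst.
apply: measurable_funM => //; apply: measurable_fun_rotr => //.
by apply: measurable_funM => //; exact: measurable_cst.
Qed.

(** [sink_rotr] turns the factor sin(k(t - x))/k into an integral over phases, and exchanging the
    integrals over r and k makes [u r t] appear. *)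
Let inner s x t : 0 < x -> x < t ->
  \int[mu]_(k in P) F s x k t =
  q t * \int[mu]_(r in `]s, s + 2 * (t - x)]) (2^-1 * u r t) /\
  integrableR `]s, s + 2 * (t - x)] (fun r => 2^-1 * u r t).
Proof.
move=> x0 xt; have t0 : 0 < t by exact: lt_trans xt.
set I := (`]s, s + 2 * (t - x)]%classic : set Rm).
pose H k r := 2^-1 * rotr (pr t k) (pi t k) (k * (r - t)).
have mprt : measurable_fun P (pr t) by exact: measurable_fun_section.
have mpit : measurable_fun P (pi t) by exact: measurable_fun_section.
have mH : measurable_fun (P `*` I) (fun z => H z.1 z.2).
  apply: measurable_funM; first exact: measurable_cst.
  apply: measurable_fun_rotr.
  - by apply: measurable_fun_fst.
  - by apply: measurable_fun_fst.
  - apply: measurable_funM; first exact: measurable_funTS.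
    by apply: measurable_funB; [exact: measurable_funTS|exact: measurable_cst].
have i1 : integrableR I (fun=> 1).
  by apply: integrableR_cst; rewrite lerDl mulr_ge0// subr_ge0 ltW.
have mI : measurable I by exact: measurable_itvR.
have HB k r : P k -> I r -> `|H k r| <= G k * 1.
  rewrite PE => k0 _; rewrite mulr1 /H normrM.
  have := rotG (k * (r - t)) t0 k0; have := normr_ge0 (rotr (pr t k) (pi t k) (k * (r - t))).
  by rewrite [`|2^-1|]ger0_norm//; lra.
have [iA iB E] := Rfubini mP mI mH iG i1 HB.
have HE r : \int[mu]_(k in P) H k r = 2^-1 * u r t.
  by rewrite /H (RintegralZl _ mP (irot (r - t) t0)).
split; last by apply: (integrableR_eq mI _ iB) => r _; exact: HE.
transitivity (q t * \int[mu]_(k in P) \int[mu]_(r in I) H k r).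
  rewrite -(RintegralZl _ mP iA); apply: Rintegral_eq => k; rewrite PE => k0.
  by rewrite /H -sink_rotr ?(ltW xt)// /F; ring.
by rewrite E; congr (_ * _); apply: Rintegral_eq => r _; exact: HE.
Qed.

(** After integration over k the momentum is gone: what remains is a linear equation for [u] alone,
    of the type satisfied by solutions of the wave equation with potential. Its right side only
    involves [u r t] with r > s and t > x, which is why tails beyond s will control the
    difference. *)
Lemma ftrans_volterra s x : 0 < x -> exists f : R -> R,
  [/\ integrableR `]x, +oo[ f,
      u s x - ftrans a b s = \int[mu]_(t in `]x, +oo[) f t &
      forall t, x < t -> f t = q t * \int[mu]_(r in `]s, s + 2 * (t - x)]) (2^-1 * u r t) /\
        integrableR `]s, s + 2 * (t - x)] (fun r => 2^-1 * u r t)].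
Proof.
move=> x0; exists (fun t => \int[mu]_(k in P) F s x k t).
have iw : integrableR `]x, +oo[ (weight q).
  by apply: integrableR_itvS wq; rewrite subitvE/= bnd_simp ltW.
have mQ : measurable (`]x, +oo[%classic : set Rm) by exact: measurable_itvR.
have FB' k t : P k -> (`]x, +oo[%classic : set Rm) t -> `|F s x k t| <= G k * weight q t.
  rewrite PE /= in_itv/= andbT => k0 xt; exact: FB.
have [iA iB E] := Rfubini mP mQ (mF s x0) iG iw FB'.
split; [exact: iB| |by move=> t xt; exact: inner].
rewrite -E /u /ftrans -(RintegralB mP (irot (s - x) x0) (irot0 s)).
by apply: Rintegral_eq => k; rewrite PE => k0; exact: Fpoint.
Qed.

(** A crude bound, uniform in [s] and [x], for the finiteness that [gronwall] presupposes. *)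
Lemma ftrans_u_bounded s x : 0 < x -> `|u s x - ftrans a b s| <=
  \int[mu]_(k in P) G k + \int[mu]_(k in P) (`|a k| + `|b k|).
Proof.
move=> x0; apply: (le_trans (ler_normB _ _)); apply: lerD; apply: (le_norm_Rintegral mP).
- exact: integrableR_meas (irot _ x0).
- by move=> k; rewrite PE => k0; exact: rotG.
- exact: iG.
- exact: integrableR_meas (irot0 _).
- by move=> k _; exact: norm_rotr_le.
- exact: integrableRD mP (integrableR_norm ia) (integrableR_norm ib).
Qed.

End volterra.

(** [rho] majorizes |Psi| and [Rh] its tail integrals. The additional term [c * Rh s] in the
    hypothesis has the same form as the conclusion, so that the lemma can be applied again to a
    transported function; [K] depends on [q] only. *)
Lemma transport : exists2 K, 0 < K & forall Y1 Y2 a b (rho Rh : R -> R) c,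
  jost_pair Y1 Y2 -> integrableR P a -> integrableR P b -> 0 <= c ->
  (forall s, 0 <= s -> 0 <= Rh s) ->
  (forall s s', 0 <= s -> s <= s' -> Rh s' <= Rh s) ->
  (forall s s', 0 <= s -> s <= s' -> integrableR `]s, s'] rho /\
     \int[mu]_(t in `]s, s']) rho t <= Rh s) ->
  (forall s, 0 <= s -> `|ftrans a b s| <= rho s + c * Rh s) ->
  forall s x, 0 <= s -> 0 < x ->
    `|ftrans (mulre a b Y1 Y2 x) (mulim a b Y1 Y2 x) (s - x) - ftrans a b s| <=
    K * (1 + c) * Rh s.
Proof.
have [K K0 HK] := gronwall wq (@weight_ge0 _ q).
have [C C0 HC] := jost_pair_bounded.
pose W := \int[mu]_(t in P) weight q t.
have W0 : 0 <= W by apply: Rintegral_ge0 => t /=; rewrite in_itv/= andbT => /weight_ge0.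
exists (K * (W + 1)); first by rewrite mulr_gt0// ltr_wpDl.
move=> Y1 Y2 a b rho Rh c J ia ib c0 R0 Rmon Rrho psiB s x s0 x0.
pose u s x := ftrans (mulre a b Y1 Y2 x) (mulim a b Y1 Y2 x) (s - x).
have c10 : 0 < 1 + c by rewrite ltr_pwDl.
(* [eta] keeps the comparison function positive where [Rh] vanishes, so that the crude bound is a
   finite multiple of it. *)
suff H eta : 0 < eta -> `|u s x - ftrans a b s| <= K * (W + 1) * (1 + c) * (Rh s + eta).
  apply/ler_addgt0Pr => e e0.
  have KWc0 : 0 < K * (W + 1) * (1 + c) by rewrite !mulr_gt0// ltr_wpDl.
  have := H (e / (K * (W + 1) * (1 + c))) (divr_gt0 e0 KWc0).
  by rewrite mulrDr mulrCA mulfV ?mulr1 ?gt_eqF.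
move=> eta0.
pose B s := (1 + c) * (Rh s + eta).
have B0 s' : 0 <= s' -> 0 < B s' by move=> s'0; rewrite mulr_gt0// ltr_wpDl// R0.
pose B' s := (W + 1) * B s.
have B'0 s' : 0 <= s' -> 0 < B' s' by move=> s'0; rewrite mulr_gt0 ?B0// ltr_wpDl.
have B'mon s1 s2 : 0 <= s1 -> s1 <= s2 -> B' s2 <= B' s1.
  move=> s10 s12; rewrite /B' ler_wpM2l ?addr_ge0// /B ler_wpM2l ?(ltW c10)//.
  by rewrite lerD2r Rmon.
(* The bound is carried for all [s'] at once, because the equation at [s'] involves [u] at larger
   arguments; [B'] is nonincreasing. *)
pose Q x' k' := forall s', 0 <= s' -> `|u s' x' - ftrans a b s'| <= k' * B' s'.
have x20 : 0 < x / 2 by rewrite divr_gt0.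
suff /(_ s s0) : Q x K by move=> /le_trans; apply; rewrite /B' /B -!mulrA.
apply: (HK (x / 2) Q (ltW x20)); last by lra.
- move=> z e1 e2 e12 H s' s'0; apply: (le_trans (H s' s'0)).
  by rewrite ler_wpM2r// ltW// B'0.
- pose M := \int[mu]_(k in P) (2 * C * (`|a k| + `|b k|)) + \int[mu]_(k in P) (`|a k| + `|b k|).
  have M0 : 0 <= M.
    apply: addr_ge0; apply: Rintegral_ge0 => k _; rewrite ?addr_ge0//.
    by apply: mulr_ge0; [rewrite mulr_ge0// ltW|rewrite addr_ge0].
  have E0 : 0 < (W + 1) * ((1 + c) * eta) by rewrite !mulr_gt0// ltr_wpDl.
  exists (M / ((W + 1) * ((1 + c) * eta))); first by rewrite divr_ge0// ltW.
  move=> z xz s' s'0; have z0 : 0 < z by exact: lt_trans xz.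
  apply: (le_trans (ftrans_u_bounded J ia ib C0 (HC _ _ J) s' z0)); rewrite -/M.
  rewrite -mulrA ler_peMr// mulrC ler_pdivlMr// mul1r /B' /B.
  rewrite ler_wpM2l ?addr_ge0// ler_wpM2l ?(ltW c10)// lerDr; exact: R0.
move=> z y c1 c2 xz zy c10' c20 H1 H2 s' s'0.
have z0 : 0 < z by exact: lt_trans xz.
have [f [fi -> fE]] := ftrans_volterra J ia ib C0 (HC _ _ J) s' z0.
(* Half the integral over an interval of length 2(t - z) costs at most [Rh s' / 2] for [rho] and t -
   z times the constant part. Both are absorbed by the factor 1 + t of the weight. *)
have key t k' : z < t -> 0 <= k' -> Q t k' -> `|f t| <= weight q t * (B s' + k' * B' s').
  move=> zt k'0 Qt; have t0 : 0 < t by exact: lt_trans zt.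
  have [-> iu] := fE t zt.
  have tz0 : 0 <= 2 * (t - z) by rewrite mulr_ge0// subr_ge0 ltW.
  have ss' : s' <= s' + 2 * (t - z) by rewrite lerDl.
  have [irho Irho] := Rrho s' _ s'0 ss'.
  set I := (`]s', s' + 2 * (t - z)]%classic : set Rm) in iu irho Irho *.
  have mI : measurable I by exact: measurable_itvR.
  have Bk0 : 0 <= k' * B' s' by rewrite mulr_ge0// ltW// B'0.
  pose D := c * Rh s' + k' * B' s'.
  have icst : integrableR I (fun=> D).
    exact: integrableR_cst.
  have iG := integrableRD mI irho icst.
  have IB : `|\int[mu]_(r in I) (2^-1 * u r t)| <= 2^-1 * (Rh s' + D * (2 * (t - z))).
    apply: (@le_trans _ _ (\int[mu]_(r in I) (2^-1 * (rho r + D)))).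
      apply: (le_norm_Rintegral mI (integrableR_meas iu)); last exact: integrableRZl mI iG.
      move=> r; rewrite /I/= in_itv/= => /andP[sr _].
      rewrite normrM ger0_norm// ler_wpM2l//.
      have r0 : 0 <= r by exact: le_trans (ltW sr).
      rewrite -/(u r t) -(subrK (ftrans a b r) (u r t)) (le_trans (ler_normD _ _))//.
      rewrite addrC /D addrA lerD//.
        by rewrite (le_trans (psiB r r0))// lerD2l ler_wpM2l// Rmon// ltW.
      by rewrite (le_trans (Qt r r0))// ler_wpM2l// B'mon// ltW.
    rewrite (RintegralZl _ mI iG) ler_wpM2l// (RintegralD mI irho icst) lerD//.
    rewrite Rintegral_cst//; have -> : fine (mu I) = 2 * (t - z); last by [].
    by rewrite lebesgue_measure_oc//= addrAC subrr add0r.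
  rewrite normrM /weight (mulrC (1 + t)) -mulrA ler_wpM2l//.
  apply: (le_trans IB).
  have Rs := R0 s' s'0.
  have -> : 2^-1 * (Rh s' + D * (2 * (t - z))) = Rh s' / 2 + D * (t - z) by field.
  have D0 : 0 <= D by rewrite addr_ge0// mulr_ge0.
  have DB : D <= B s' + k' * B' s'.
    by rewrite /D lerD2r /B; have := mulr_ge0 c0 (ltW eta0); have := mulr_ge0 c0 Rs; lra.
  have RB : Rh s' / 2 <= B s' + k' * B' s'.
    have := mulr_ge0 c0 Rs; have := mulr_ge0 c0 (ltW eta0); move: Bk0; rewrite /B; lra.
  have : D * (t - z) <= (B s' + k' * B' s') * t by rewrite ler_pM// ?subr_ge0 ?(ltW zt)//; lra.
  by move=> DH; rewrite [leRHS]mulrDl mul1r [t * _]mulrC; exact: lerD.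
have iw : integrableR `]z, +oo[ (weight q).
  by apply: integrableR_itvS wq; rewrite subitvE/= bnd_simp ltW.
have Bs0 := ltW (B0 s' s'0); have B's0 := ltW (B'0 s' s'0).
have [|||||||_] := @le_norm_Rintegral_split _ f (weight q) z y (B s' + c1 * B' s') (B s' + c2 * B' s') zy.
- by rewrite addr_ge0// mulr_ge0.
- by rewrite addr_ge0// mulr_ge0.
- exact: integrableR_meas fi.
- exact: iw.
- by move=> t zt; apply: weight_ge0; exact: lt_trans zt.
- by move=> t zt ty; apply: key => //; exact: H1.
- by move=> t yt; apply: key => //; [exact: le_lt_trans yt|exact: H2].
move=> H; apply: (le_trans H).
have Iz : \int[mu]_(t in `]z, y]) weight q t + \int[mu]_(t in `]y, +oo[) weight q t <= W.
  rewrite -(Rintegral_split zy iw); apply: Rintegral_itv_le => //.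
    by rewrite subitvE/= bnd_simp ltW.
  by move=> t; rewrite in_itv/= andbT => /weight_ge0.
have := ler_wpM2l Bs0 Iz.
set I1 := Rintegral _ _ _; set I2 := Rintegral _ _ _ => HI.
have -> : (1 + c1 * I1 + c2 * I2) * B' s' = (W + 1) * B s' + c1 * B' s' * I1 + c2 * B' s' * I2.
  by rewrite /B'; ring.
move: HI; rewrite !mulrDl mulrDr mul1r (mulrC W); lra.
Qed.

End transport.

(** * Products of Jost solutions *)

Section product.
Context {R : realType}.
Local Notation mu := (@lebesgue_measure R).
Local Notation Rm := (measurableTypeR R).
Local Notation P := (`]0, +oo[%classic : set Rm).
Implicit Types (a b : R -> R) (s t x k : R).

Let mP : measurable P. Proof. exact: measurable_itvR. Qed.

Let PE x : P x = (0 < x) :> Prop.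
Proof. by rewrite /= in_itv/= andbT. Qed.

Variables q1 q2 : R -> R.
Hypothesis mq1 : measurable_fun P q1.
Hypothesis wq1 : integrableR P (weight q1).
Hypothesis mq2 : measurable_fun P q2.
Hypothesis wq2 : integrableR P (weight q2).

Definition prodre (Y1 Y2 Z1 Z2 : R -> R -> R) x k := Y1 x k * Z1 x k - Y2 x k * Z2 x k.
Definition prodim (Y1 Y2 Z1 Z2 : R -> R -> R) x k := Y1 x k * Z2 x k + Y2 x k * Z1 x k.

(** Two uses of [transport], with c = 0 for the solution of [q2] and then with c = K2 for that of
    [q1]; the triangle inequality adds K2 to K1 (1 + K2). *)
Lemma transport_product : exists2 K, 0 < K & forall Y1 Y2 Z1 Z2 a b (rho Rh : R -> R),
  jost_pair q1 Y1 Y2 -> jost_pair q2 Z1 Z2 -> integrableR P a -> integrableR P b ->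
  (forall s, 0 <= s -> 0 <= Rh s) ->
  (forall s s', 0 <= s -> s <= s' -> Rh s' <= Rh s) ->
  (forall s s', 0 <= s -> s <= s' -> integrableR `]s, s'] rho /\
     \int[mu]_(t in `]s, s']) rho t <= Rh s) ->
  (forall s, 0 <= s -> `|ftrans a b s| <= rho s) ->
  forall x, 0 < x ->
    `|\int[mu]_(k in P) (a k * prodre Y1 Y2 Z1 Z2 x k - b k * prodim Y1 Y2 Z1 Z2 x k)
      - ftrans a b (2 * x)| <= K * Rh (2 * x).
Proof.
have [K1 K10 H1] := transport mq1 wq1.
have [K2 K20 H2] := transport mq2 wq2.
have [C C0 HC] := jost_pair_bounded mq2 wq2.
exists (K2 + K1 * (1 + K2)); first by rewrite addr_gt0// mulr_gt0// addr_gt0.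
move=> Y1 Y2 Z1 Z2 a b rho Rh JY JZ ia ib R0 Rmon Rrho psiB x x0.
have psiB0 s : 0 <= s -> `|ftrans a b s| <= rho s + 0 * Rh s.
  by move=> s0; rewrite mul0r addr0; exact: psiB.
have S2 s : 0 <= s -> `|ftrans (mulre a b Z1 Z2 x) (mulim a b Z1 Z2 x) (s - x) - ftrans a b s| <= K2 * Rh s.
  move=> s0; have := H2 Z1 Z2 a b rho Rh 0 JZ ia ib (lexx 0) R0 Rmon Rrho psiB0 s x s0 x0.
  by rewrite addr0 mulr1.
have [mA mB] := measurable_mulre mq2 wq2 (integrableR_meas ia) (integrableR_meas ib) JZ.
have mAx := measurable_fun_section x0 mA; have mBx := measurable_fun_section x0 mB.
(* a' + ib' = (a + ib) f_2(x, k) e^{-ikx}. Its transform at s is the transported function of f_2,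
   and at s = 2x the second transport multiplies it by f_1 e^{ikx}, so that the phases cancel. *)
pose a' k := rotr (mulre a b Z1 Z2 x k) (mulim a b Z1 Z2 x k) (k * - x).
pose b' k := roti (mulre a b Z1 Z2 x k) (mulim a b Z1 Z2 x k) (k * - x).
have E s : ftrans a' b' s = ftrans (mulre a b Z1 Z2 x) (mulim a b Z1 Z2 x) (s - x).
  apply: Rintegral_eq => k _; rewrite /a' /b' rotr_add; congr (rotr _ _ _); ring.
have bnd k : 0 < k -> `|mulre a b Z1 Z2 x k| + `|mulim a b Z1 Z2 x k| <= 2 * C * (`|a k| + `|b k|).
  move=> k0; have [B1 B2] := mulre_bounds a b (ltW C0) (HC Z1 Z2 JZ x k x0 k0).
  apply: (le_trans (lerD B1 B2)); rewrite le_eqVlt; apply/orP; left; apply/eqP; ring.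
have iG : integrableR P (fun k => 2 * C * (`|a k| + `|b k|)).
  by apply: (integrableRZl _ mP); exact: integrableRD mP (integrableR_norm ia) (integrableR_norm ib).
have mk : measurable_fun P (fun k => k * - x).
  by apply: measurable_funM; [exact: measurable_id|exact: measurable_cst].
have ia' : integrableR P a'.
  apply: (le_integrableR mP _ _ iG); first exact: measurable_fun_rotr.
  by move=> k; rewrite PE => k0; apply: le_trans (norm_rotr_le _ _ _) (bnd k k0).
have ib' : integrableR P b'.
  apply: (le_integrableR mP _ _ iG); first exact: measurable_fun_roti.
  by move=> k; rewrite PE => k0; apply: le_trans (norm_roti_le _ _ _) (bnd k k0).
have psiB' s : 0 <= s -> `|ftrans a' b' s| <= rho s + K2 * Rh s.
  move=> s0; rewrite E -(subrK (ftrans a b s) (ftrans _ _ _)) (le_trans (ler_normD _ _))//.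
  by rewrite addrC lerD ?psiB ?S2.
have x20 : 0 <= 2 * x by rewrite mulr_ge0// ltW.
have S1 := H1 Y1 Y2 a' b' rho Rh K2 JY ia' ib' (ltW K20) R0 Rmon Rrho psiB' (2 * x) x x20 x0.
rewrite E in S1.
have -> : \int[mu]_(k in P) (a k * prodre Y1 Y2 Z1 Z2 x k - b k * prodim Y1 Y2 Z1 Z2 x k) =
    ftrans (mulre a' b' Y1 Y2 x) (mulim a' b' Y1 Y2 x) (2 * x - x).
  apply: Rintegral_eq => k _; rewrite /mulre /mulim /a' /b' /rotr /roti.
  rewrite (_ : k * (2 * x - x) = k * x); last by ring.
  rewrite mulrN cosN sinN; set A := mulre a b Z1 Z2 x k; set B := mulim a b Z1 Z2 x k.
  have := cos2Dsin2 (k * x); set c := cos (k * x); set s := sin (k * x) => cs.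
  transitivity ((c ^+ 2 + s ^+ 2) * (A * Y1 x k - B * Y2 x k)); last by ring.
  by rewrite cs /A /B /mulre /mulim /prodre /prodim; ring.
have S2x := S2 (2 * x) x20.
rewrite [leRHS]mulrDl [leRHS]addrC; apply: le_trans (lerD S1 S2x).
apply: le_trans (ler_normD _ _); rewrite le_eqVlt; apply/orP; left; apply/eqP.
by congr (`|_|); ring.
Qed.

(** * The orthogonality relations integrated over momentum *)

Section orthogonality.
Variables (Y1 Y2 Z1 Z2 : R -> R -> R) (h1 h2 : R -> R).
Hypothesis JY : jost_pair q1 Y1 Y2.
Hypothesis JZ : jost_pair q2 Z1 Z2.
Hypotheses (ih1 : integrableR P h1) (ih2 : integrableR P h2).
Hypothesis ore : forall k, 0 < k ->
  \int[mu]_(x in P) (h1 x * prodre Y1 Y2 Z1 Z2 x k - h2 x * prodim Y1 Y2 Z1 Z2 x k) = 0.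
Hypothesis oim : forall k, 0 < k ->
  \int[mu]_(x in P) (h1 x * prodim Y1 Y2 Z1 Z2 x k + h2 x * prodre Y1 Y2 Z1 Z2 x k) = 0.

Lemma jost_product_bounded : exists2 C, 0 < C & forall x k, 0 < x -> 0 < k ->
  `|prodre Y1 Y2 Z1 Z2 x k| <= C /\ `|prodim Y1 Y2 Z1 Z2 x k| <= C.
Proof.
have [C1 C10 H1] := jost_pair_bounded mq1 wq1.
have [C2 C20 H2] := jost_pair_bounded mq2 wq2.
exists (2 * (C1 * C2)); first by rewrite !mulr_gt0.
move=> x k x0 k0; have [y1 y2] := H1 _ _ JY x k x0 k0; have [z1 z2] := H2 _ _ JZ x k x0 k0.
have -> : 2 * (C1 * C2) = C1 * C2 + C1 * C2 by ring.
split.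
  by rewrite (le_trans (ler_normB _ _))// !normrM lerD// ler_pM.
by rewrite (le_trans (ler_normD _ _))// !normrM lerD// ler_pM.
Qed.

Let mre : measurable_fun (P `*` P) (fun z => prodre Y1 Y2 Z1 Z2 z.1 z.2).
Proof.
have [m1 m2] := jost_pair_measurable mq1 wq1 JY; have [n1 n2] := jost_pair_measurable mq2 wq2 JZ.
by apply: measurable_funB; exact: measurable_funM.
Qed.

Let mim : measurable_fun (P `*` P) (fun z => prodim Y1 Y2 Z1 Z2 z.1 z.2).
Proof.
have [m1 m2] := jost_pair_measurable mq1 wq1 JY; have [n1 n2] := jost_pair_measurable mq2 wq2 JZ.
by apply: measurable_funD; exact: measurable_funM.
Qed.

Let U a b x := \int[mu]_(k in P) (a k * prodre Y1 Y2 Z1 Z2 x k - b k * prodim Y1 Y2 Z1 Z2 x k).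

Let iU a b x : integrableR P a -> integrableR P b -> 0 < x ->
  integrableR P (fun k => a k * prodre Y1 Y2 Z1 Z2 x k - b k * prodim Y1 Y2 Z1 Z2 x k).
Proof.
move=> ia ib x0; have [C C0 HC] := jost_product_bounded.
apply: (integrableRB mP).
  apply: (le_integrableR mP _ _ (integrableRZl C mP (integrableR_norm ia))).
    by apply: measurable_funM; [exact: integrableR_meas ia|exact: measurable_fun_section mre].
  by move=> k; rewrite PE => k0; have [B1 B2] := HC x k x0 k0; rewrite normrM mulrC ler_wpM2r.
apply: (le_integrableR mP _ _ (integrableRZl C mP (integrableR_norm ib))).
  by apply: measurable_funM; [exact: integrableR_meas ib|exact: measurable_fun_section mim].
by move=> k; rewrite PE => k0; have [B1 B2] := HC x k x0 k0; rewrite normrM mulrC ler_wpM2r.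
Qed.

(* Multiply the orthogonality relations by a + ib and integrate over k. *)
Lemma orthogonality_integrated a b : integrableR P a -> integrableR P b ->
  [/\ integrableR P (fun x => h1 x * U a b x),
      integrableR P (fun x => h2 x * U (fun k => - b k) a x) &
      \int[mu]_(x in P) (h1 x * U a b x) +
      \int[mu]_(x in P) (h2 x * U (fun k => - b k) a x) = 0].
Proof.
move=> ia ib; have [C C0 HC] := jost_product_bounded.
have inb : integrableR P (fun k => - b k).
  by apply: (integrableR_eq mP _ (integrableRZl (-1) mP ib)) => k _; ring.
have part (h : R -> R) c d : integrableR P h -> integrableR P c -> integrableR P d ->
    [/\ integrableR P (fun x => h x * U c d x),
        integrableR P (fun k => \int[mu]_(x in P) (h x * (c k * prodre Y1 Y2 Z1 Z2 x k - d k * prodim Y1 Y2 Z1 Z2 x k))) &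
    \int[mu]_(x in P) (h x * U c d x) =
    \int[mu]_(k in P) \int[mu]_(x in P)
      (h x * (c k * prodre Y1 Y2 Z1 Z2 x k - d k * prodim Y1 Y2 Z1 Z2 x k))].
  move=> ih ic id.
  pose F x k := h x * (c k * prodre Y1 Y2 Z1 Z2 x k - d k * prodim Y1 Y2 Z1 Z2 x k).
  have mF : measurable_fun (P `*` P) (fun z => F z.1 z.2).
    apply: measurable_funM; first exact: measurable_fun_fst mP mP (integrableR_meas ih).
    apply: measurable_funB; apply: measurable_funM.
    - exact: measurable_fun_snd mP mP (integrableR_meas ic).
    - exact: mre.
    - exact: measurable_fun_snd mP mP (integrableR_meas id).
    - exact: mim.
  have iG : integrableR P (fun k => C * (`|c k| + `|d k|)).
    by apply: (integrableRZl _ mP); exact: integrableRD mP (integrableR_norm ic) (integrableR_norm id).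
  have FB x k : P x -> P k -> `|F x k| <= `|h x| * (C * (`|c k| + `|d k|)).
    rewrite !PE => x0 k0; have [B1 B2] := HC x k x0 k0.
    rewrite normrM ler_wpM2l// (le_trans (ler_normB _ _))// !normrM mulrDr.
    by rewrite lerD// mulrC ler_wpM2r.
  have [i1 i2 E] := Rfubini mP mP mF (integrableR_norm ih) iG FB.
  have UE x : P x -> \int[mu]_(k in P) F x k = h x * U c d x.
    by rewrite PE => x0; rewrite -(RintegralZl _ mP (iU ic id x0)).
  split; first by apply: (integrableR_eq mP _ i1) => x; exact: UE.
    exact: i2.
  by rewrite -E; apply: Rintegral_eq => x xP; rewrite UE.
have [i1 j1 ->] := part h1 a b ih1 ia ib.
have [i2 j2 ->] := part h2 (fun k => - b k) a ih2 inb ia.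
split => //.
rewrite -(RintegralD mP j1 j2).
(* At fixed k the two integrands add up to the real part of (a + ib) times the relation for h1 + i
   h2; the second one comes from i h2 (a + ib) = h2 (-b + ia). *)
rewrite (_ : \int[mu]_(k in P) _ = \int[mu]_(k in P) 0); last first.
  apply: Rintegral_eq => k; rewrite PE => k0.
  have ipr (h : R -> R) : integrableR P h -> integrableR P (fun x => h x * prodre Y1 Y2 Z1 Z2 x k).
    move=> ih; apply: (le_integrableR mP _ _ (integrableRZl C mP (integrableR_norm ih))).
      apply: measurable_funM; first exact: integrableR_meas ih.
      exact: (measurable_fun_section (f := fun k x => prodre Y1 Y2 Z1 Z2 x k) k0 (measurable_fun_swap mP mP mre)).
    by move=> x; rewrite PE => x0; have [B1 B2] := HC x k x0 k0; rewrite normrM mulrC ler_wpM2r.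
  have ipi (h : R -> R) : integrableR P h -> integrableR P (fun x => h x * prodim Y1 Y2 Z1 Z2 x k).
    move=> ih; apply: (le_integrableR mP _ _ (integrableRZl C mP (integrableR_norm ih))).
      apply: measurable_funM; first exact: integrableR_meas ih.
      exact: (measurable_fun_section (f := fun k x => prodim Y1 Y2 Z1 Z2 x k) k0 (measurable_fun_swap mP mP mim)).
    by move=> x; rewrite PE => x0; have [B1 B2] := HC x k x0 k0; rewrite normrM mulrC ler_wpM2r.
  have k1 := ore k0; have k2 := oim k0.
  have p1 := ipr _ ih1; have p2 := ipr _ ih2; have r1 := ipi _ ih1; have r2 := ipi _ ih2.
  rewrite (RintegralB mP p1 r2) in k1.
  rewrite (RintegralD mP r1 p2) in k2.
  have -> : \int[mu]_(x in P) (h1 x * (a k * prodre Y1 Y2 Z1 Z2 x k - b k * prodim Y1 Y2 Z1 Z2 x k)) =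
     a k * \int[mu]_(x in P) (h1 x * prodre Y1 Y2 Z1 Z2 x k) -
     b k * \int[mu]_(x in P) (h1 x * prodim Y1 Y2 Z1 Z2 x k).
    rewrite -(RintegralZl _ mP p1) -(RintegralZl _ mP r1) -(RintegralB mP (integrableRZl _ mP p1) (integrableRZl _ mP r1)).
    by apply: Rintegral_eq => x _; ring.
  have -> : \int[mu]_(x in P) (h2 x * (- b k * prodre Y1 Y2 Z1 Z2 x k - a k * prodim Y1 Y2 Z1 Z2 x k)) =
     - b k * \int[mu]_(x in P) (h2 x * prodre Y1 Y2 Z1 Z2 x k) -
     a k * \int[mu]_(x in P) (h2 x * prodim Y1 Y2 Z1 Z2 x k).
    rewrite -(RintegralZl _ mP p2) -(RintegralZl _ mP r2) -(RintegralB mP (integrableRZl _ mP p2) (integrableRZl _ mP r2)).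
    by apply: Rintegral_eq => x _; ring.
  move: k1 k2; set I1 := Rintegral _ _ _; set I2 := Rintegral _ _ _; set I3 := Rintegral _ _ _; set I4 := Rintegral _ _ _.
  move=> k1 k2; transitivity (a k * (I1 - I2) - b k * (I3 + I4)); first by ring.
  by rewrite k1 k2; ring.
by rewrite /Rintegral integral0.
Qed.

End orthogonality.

End product.

(** * Approximation by Fourier transforms on the half-line *)

Section approximation.
Context {R : realType}.
Local Notation mu := (@lebesgue_measure R).
Local Notation Rm := (measurableTypeR R).
Local Notation P := (`]0, +oo[%classic : set Rm).
Implicit Types (a b : R -> R) (s t x k : R).

Let mP : measurable P. Proof. exact: measurable_itvR. Qed.

Let PE x : P x = (0 < x) :> Prop.
Proof. by rewrite /= in_itv/= andbT. Qed.

Lemma FTC_oc (F f : R -> R) (x y : R) : x <= y ->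
  (forall t, x <= t <= y -> is_derive t 1 F (f t)) ->
  (forall t, x <= t <= y -> {for t, continuous f}) ->
  integrableR `[x, y] f /\ \int[mu]_(t in `]x, y]) f t = F y - F x.
Proof.
move=> xy dF cf.
have cwf : {within `[x, y], continuous f}.
  by apply: continuous_in_subspaceT => t /set_mem/=; rewrite in_itv/=; exact: cf.
have If : integrableR `[x, y] f.
  by apply: continuous_compact_integrable => //; exact: segment_compact.
split => //; move: xy dF cf cwf If; rewrite le_eqVlt => /predU1P[->|xy] dF cf cwf If.
  by rewrite set_itvoc0// Rintegral_set0 subrr.
rewrite Rintegral_itv_obnd_cbnd; last first.
  by apply: integrableR_itvS If; rewrite subitvE; apply/andP; split; rewrite bnd_simp.
rewrite /Rintegral (@continuous_FTC2 R f F x y xy)//.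
- split => [t||].
  + by rewrite in_itv/= => /andP[xt ty]; have [|//] := dF t; rewrite !ltW.
  + apply/cvg_at_right_filter/(is_derive_continuous (dF _ _)); by rewrite lexx ltW.
  + apply/cvg_at_left_filter/(is_derive_continuous (dF _ _)); by rewrite lexx ltW.
- move=> t; rewrite in_itv/= => /andP[xt ty]; rewrite derive1E.
  by have [|_ ->//] := dF t; rewrite !ltW.
Qed.

Lemma integrableR_expR (d : R) : 0 < d -> integrableR P (fun k => expR (- d * k)).
Proof.
move=> d0; have := integrable_exponential_pdf d0.
move=> /(integrableRS measurableT mP (@subsetT _ _)) ipdf.
apply: (integrableR_eq mP _ (integrableRZl d^-1 mP ipdf)) => k; rewrite PE => k0.
rewrite /exponential_pdf patchE mem_set; last by rewrite /= in_itv/= andbT ltW.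
by rewrite mulrA mulVf ?mul1r// gt_eqF.
Qed.

Lemma FTC_pinfty (F f : R -> R) (d M : R) : 0 < d ->
  (forall t, is_derive t 1 F (f t)) -> continuous f -> integrableR P f ->
  (forall t, 0 <= t -> `|F t| <= M * expR (- d * t)) ->
  \int[mu]_(t in P) f t = - F 0.
Proof.
move=> d0 dF cf If FM.
have M0 : 0 <= M.
  have := FM 0 (lexx 0); rewrite mulr0 expR0 mulr1; exact: le_trans.
have cv := Rintegral_pinfty_cvg If.
have E : (fun n : nat => \int[mu]_(t in `]0, 0 + n%:R]) f t) = (fun n => F n%:R - F 0).
  apply/funext => n; rewrite add0r.
  by have [|_ ->] := @FTC_oc F f 0 n%:R (ler0n _ _) (fun t _ => dF t) => // t _; exact: cf.
rewrite E in cv.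
have cv0 : F n%:R @[n --> \oo] --> (0 : R).
  apply/cvgrPdist_lt => e e0; near=> n; rewrite sub0r normrN.
  rewrite (le_lt_trans (FM n%:R (ler0n _ _)))//.
  have n0 : 0 < n%:R :> R by rewrite ltr0n; near: n; exact: nbhs_infty_gt.
  rewrite mulNr expRN ltr_pdivrMr ?expR_gt0//.
  have H : 1 + d * n%:R <= expR (d * n%:R) by exact: expR_ge1Dx.
  apply: (@lt_le_trans _ _ (e * (1 + d * n%:R))); last by rewrite ler_pM2l.
  rewrite mulrDr mulr1 mulrA.
  have : M / (e * d) < n%:R by near: n; exact: nbhs_infty_gtr.
  rewrite ltr_pdivrMr ?mulr_gt0// mulrC => Mn.
  by rewrite (lt_trans Mn)// ltrDr.
have cv1 : F n%:R - F 0 @[n --> \oo] --> 0 - F 0 by apply: cvgB => //; exact: cvg_cst.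
rewrite sub0r in cv1.
exact: (cvg_unique _ cv cv1).
Unshelve. all: by end_near. Qed.

(* Real and imaginary parts of (-i beta)^(j+1) k^j / j! e^(-eps k) e^(i sigma k). *)
Fixpoint gam (beta eps sigma : R) (j : nat) (k : R) : R * R :=
  if j is j'.+1 then
    (beta * k / j%:R * (gam beta eps sigma j' k).2,
     - (beta * k / j%:R * (gam beta eps sigma j' k).1))
  else (beta * expR (- eps * k) * sin (sigma * k),
        - (beta * expR (- eps * k) * cos (sigma * k))).

(* Real and imaginary parts of (-i beta / (eps - i sigma))^m. *)
Fixpoint vpow (beta eps sigma : R) (m : nat) : R * R :=
  if m is m'.+1 then
    let: (x, y) := vpow beta eps sigma m' in
    let: D := sigma ^+ 2 + eps ^+ 2 in
    let: (x1, y1) := (beta * sigma / D, - (beta * eps / D)) in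
    (x * x1 - y * y1, x * y1 + y * x1)
  else (1, 0).

(** * Explicit transforms of polynomials times exponentials *)

Section moments.
Variables beta eps : R.
Hypothesis beta0 : 0 < beta.
Hypothesis eps0 : 0 < eps.

Let A sigma j k := (gam beta eps sigma j k).1.
Let B sigma j k := (gam beta eps sigma j k).2.
Let Ap sigma j k := if j is j'.+1 then A sigma j' k else 0.
Let Bp sigma j k := if j is j'.+1 then B sigma j' k else 0.

(** In complex form, with gamma_j = A + iB and gamma_(-1) = 0, this is gamma_j' = - i beta
    gamma_(j-1) + (i sigma - eps) gamma_j. *)
Lemma gam_derive sigma j k :
  is_derive k 1 (A sigma j) (beta * Bp sigma j k - eps * A sigma j k - sigma * B sigma j k) /\
  is_derive k 1 (B sigma j) (- (beta * Ap sigma j k) - eps * B sigma j k + sigma * A sigma j k).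
Proof.
elim: j k => [|j ih] k.
  rewrite /A /B /=; split; apply: is_derive_eq; rewrite /GRing.scale/=; ring.
have [dA dB] := ih k.
have jn0 : j.+1%:R != 0 :> R by rewrite pnatr_eq0.
have EA : A sigma j.+1 = fun k => beta * k / j.+1%:R * B sigma j k by [].
have EB : B sigma j.+1 = fun k => - (beta * k / j.+1%:R * A sigma j k) by [].
have rel : beta * k * Ap sigma j k = - (j%:R * B sigma j k) /\
           beta * k * Bp sigma j k = j%:R * A sigma j k.
  case: j {ih dA dB EA EB} jn0 => [|j] _; first by rewrite !mulr0 !mul0r oppr0.
  have jn0 : j.+1%:R != 0 :> R by rewrite pnatr_eq0.
  by rewrite /Ap /Bp /A /B/=; split; field.
have [rA rB] := rel.
rewrite /Ap /Bp -/(Ap sigma j k) -/(Bp sigma j k) EA EB.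
split; apply: is_derive_eq; rewrite /GRing.scale/=.
- transitivity (beta / j.+1%:R * B sigma j k +
    (- (beta / j.+1%:R * (beta * k * Ap sigma j k)) +
     beta * k / j.+1%:R * (- (eps * B sigma j k) + sigma * A sigma j k))); first by field.
  rewrite rA -natr1; field.
  by rewrite natr1.
- transitivity (- (beta / j.+1%:R * A sigma j k) -
    (beta / j.+1%:R * (beta * k * Bp sigma j k) +
     beta * k / j.+1%:R * (- (eps * A sigma j k) - sigma * B sigma j k))); first by field.
  rewrite rB -natr1; field.
  by rewrite natr1.
Qed.

(** Each factor k costs a part of the exponential rate, by k e^{-(d' - d)k} <= 1/(d' - d). The
    induction therefore runs over all rates below [eps], with [d'] halfway between [d] and [eps]. *)
Lemma gam_bound sigma j (d : R) : 0 < d -> d < eps ->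
  exists2 M, 0 <= M & forall k, 0 <= k ->
    `|A sigma j k| <= M * expR (- d * k) /\ `|B sigma j k| <= M * expR (- d * k).
Proof.
elim: j d => [|j ih] d d0 de.
  exists beta; first exact: ltW.
  move=> k k0; rewrite /A /B/= normrN !normrM (gtr0_norm beta0) (gtr0_norm (expR_gt0 _)).
  have E : expR (- eps * k) <= expR (- d * k) by rewrite ler_expR ler_wpM2r// lerN2 ltW.
  have bE : beta * expR (- eps * k) <= beta * expR (- d * k) by rewrite ler_pM2l.
  split; apply: le_trans bE; rewrite ler_piMr ?mulr_ge0 ?expR_ge0 ?(ltW beta0)//.
    exact: norm_sin_le1.
  exact: norm_cos_le1.
pose d' := (d + eps) / 2.
have dd' : d < d' by rewrite /d'; lra.
have d'e : d' < eps by rewrite /d'; lra.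
have [M M0 HM] := ih d' (lt_trans d0 dd') d'e.
exists (beta * M / (d' - d)).
  by rewrite divr_ge0 ?mulr_ge0 ?(ltW beta0)// subr_ge0 ltW.
move=> k k0; have [BA BB] := HM k k0.
have kE : k * expR (- d' * k) <= (d' - d)^-1 * expR (- d * k).
  have -> : - d * k = (d' - d) * k + (- d' * k) by ring.
  rewrite expRD mulrA ler_wpM2r ?expR_ge0// ler_pdivlMl ?subr_gt0//.
  by apply: le_trans (expR_ge1Dx _); rewrite lerDr.
have j1 : (j.+1%:R : R)^-1 <= 1 by rewrite invf_le1// ler1n.
have step X : `|X| <= M * expR (- d' * k) -> `|beta * k / j.+1%:R * X| <= beta * M / (d' - d) * expR (- d * k).
  move=> HX; rewrite !normrM (gtr0_norm beta0) (ger0_norm k0) [`|_^-1|]ger0_norm//.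
  apply: (@le_trans _ _ (beta * k * (M * expR (- d' * k)))).
    by rewrite ler_pM ?mulr_ge0 ?(ltW beta0)// ler_piMr// mulr_ge0// ltW.
  have -> : beta * k * (M * expR (- d' * k)) = beta * M * (k * expR (- d' * k)) by ring.
  by rewrite -[leRHS]mulrA ler_wpM2l// mulr_ge0// ltW.
by split; rewrite /A /B/= ?normrN; apply: step.
Qed.

Let cA sigma j : continuous (A sigma j).
Proof. by move=> k; have [dA _] := gam_derive sigma j k; exact: is_derive_continuous dA. Qed.

Let cB sigma j : continuous (B sigma j).
Proof. by move=> k; have [_ dB] := gam_derive sigma j k; exact: is_derive_continuous dB. Qed.

Lemma gam_integrable sigma j : integrableR P (A sigma j) /\ integrableR P (B sigma j).
Proof.
have d0 : 0 < eps / 2 by rewrite divr_gt0.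
have de : eps / 2 < eps by lra.
have [M M0 HM] := gam_bound sigma j d0 de.
have iM := integrableRZl M mP (integrableR_expR d0).
split; apply: (le_integrableR mP _ _ iM).
- by apply: measurable_funTS; exact: continuous_measurable_fun.
- by move=> k; rewrite PE => /ltW /HM[].
- by apply: measurable_funTS; exact: continuous_measurable_fun.
- by move=> k; rewrite PE => /ltW /HM[].
Qed.

(** Integrating the differential relation over the half-line gives (eps - i sigma) I_j = - i beta
    I_(j-1) for j > 0, since gamma_j then vanishes at 0, and (eps - i sigma) I_0 = gamma_0(0) = - i
    beta. *)
Lemma gam_integral sigma j : 0 < sigma ->
  \int[mu]_(k in P) A sigma j k = (vpow beta eps sigma j.+1).1 /\
  \int[mu]_(k in P) B sigma j k = (vpow beta eps sigma j.+1).2.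
Proof.
move=> sigma0.
have D0 : sigma ^+ 2 + eps ^+ 2 != 0 by rewrite gt_eqF// addr_gt0// exprn_gt0.
have d0 : 0 < eps / 2 by rewrite divr_gt0.
have de : eps / 2 < eps by lra.
have ibp j' : beta * \int[mu]_(k in P) Bp sigma j' k - eps * \int[mu]_(k in P) A sigma j' k -
     sigma * \int[mu]_(k in P) B sigma j' k = - A sigma j' 0 /\
   - (beta * \int[mu]_(k in P) Ap sigma j' k) - eps * \int[mu]_(k in P) B sigma j' k +
     sigma * \int[mu]_(k in P) A sigma j' k = - B sigma j' 0.
  have [M M0 HM] := gam_bound sigma j' d0 de.
  have [iA iB] := gam_integrable sigma j'.
  have i0 : integrableR P (fun=> 0).
    by apply: (integrableR_eq mP _ (integrableRZl 0 mP iA)) => k _; rewrite mul0r.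
  have iAp : integrableR P (Ap sigma j').
    by case: j' {M M0 HM iA iB} => [|j'] //; have [] := gam_integrable sigma j'.
  have iBp : integrableR P (Bp sigma j').
    by case: j' {M M0 HM iA iB iAp} => [|j'] //; have [] := gam_integrable sigma j'.
  have cAp : continuous (Ap sigma j').
    by case: j' {M M0 HM iA iB iAp iBp} => [|j'] //=; [exact: cst_continuous|exact: cA].
  have cBp : continuous (Bp sigma j').
    by case: j' {M M0 HM iA iB iAp iBp cAp} => [|j'] //=; [exact: cst_continuous|exact: cB].
  have z1 := integrableRZl beta mP iBp; have z2 := integrableRZl eps mP iA.
  have z3 := integrableRZl sigma mP iB; have z4 := integrableRZl (- beta) mP iAp.
  have z5 := integrableRZl eps mP iB; have z6 := integrableRZl sigma mP iA.
  split.
  - have <- := @FTC_pinfty _ _ (eps / 2) M d0 (fun k => (gam_derive sigma j' k).1) _ _ _.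
    + rewrite -(RintegralZl _ mP iBp) -(RintegralZl _ mP iA) -(RintegralZl _ mP iB).
      by rewrite -(RintegralB mP z1 z2) -(RintegralB mP (integrableRB mP z1 z2) z3).
    + move=> k; apply: cvgB; first apply: cvgB.
      * by apply: cvgM; [exact: cvg_cst|exact: cBp].
      * by apply: cvgM; [exact: cvg_cst|exact: cA].
      * by apply: cvgM; [exact: cvg_cst|exact: cB].
    + exact: integrableRB mP (integrableRB mP z1 z2) z3.
    + by move=> t /HM[].
  - have <- := @FTC_pinfty _ _ (eps / 2) M d0 (fun k => (gam_derive sigma j' k).2) _ _ _.
    + rewrite -mulNr -(RintegralZl _ mP iAp) -(RintegralZl _ mP iA) -(RintegralZl _ mP iB).
      rewrite -(RintegralB mP z4 z5) -(RintegralD mP (integrableRB mP z4 z5) z6).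
      by apply: Rintegral_eq => k _; rewrite mulNr.
    + move=> k; apply: cvgD; first apply: cvgB.
      * by apply: cvgN; apply: cvgM; [exact: cvg_cst|exact: cAp].
      * by apply: cvgM; [exact: cvg_cst|exact: cB].
      * by apply: cvgM; [exact: cvg_cst|exact: cA].
    + apply: (integrableR_eq mP _ (integrableRD mP (integrableRB mP z4 z5) z6)) => k _.
      by rewrite mulNr.
    + by move=> t /HM[].
(* Division by i sigma - eps in real coordinates. *)
have solve (u v p q : R) : - (eps * u) - sigma * v = p -> - (eps * v) + sigma * u = q ->
    u = (- eps * p + sigma * q) / (sigma ^+ 2 + eps ^+ 2) /\
    v = (- sigma * p - eps * q) / (sigma ^+ 2 + eps ^+ 2).
  by move=> <- <-; split; field.
elim: j => [|j [ihA ihB]].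
  have [E1 E2] := ibp 0%N.
  move: E1 E2; rewrite /Ap /Bp/=.
  have -> : \int[mu]_(k in P) (0 : R) = 0 by rewrite /Rintegral integral0.
  rewrite mulr0 !oppr0 !add0r.
  have -> : A sigma 0 0 = 0 by rewrite /A/= !mulr0 sin0 mulr0.
  have -> : B sigma 0 0 = - beta by rewrite /B/= !mulr0 expR0 cos0 !mulr1.
  rewrite oppr0 opprK => E1 E2.
  have [-> ->] := solve _ _ _ _ E1 E2.
  by rewrite /=; split; field.
have [E1 E2] := ibp j.+1.
have A00 : A sigma j.+1 0 = 0 by rewrite /A/= mulr0 !mul0r.
have B00 : B sigma j.+1 0 = 0 by rewrite /B/= mulr0 !mul0r oppr0.
rewrite A00 B00 oppr0 /Ap /Bp ihA ihB in E1 E2.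
move: E1 E2; set u := (\int[mu]_(k in P) A sigma j.+1 k); set v := (\int[mu]_(k in P) B sigma j.+1 k) => E1 E2.
have E1' : - (eps * u) - sigma * v = - (beta * (vpow beta eps sigma j.+1).2) by lra.
have E2' : - (eps * v) + sigma * u = beta * (vpow beta eps sigma j.+1).1 by lra.
have [-> ->] := solve _ _ _ _ E1' E2'.
move: E1 E2 {E1' E2'} => _ _; rewrite [vpow _ _ _ j.+2]/=.
rewrite -/(vpow beta eps sigma j.+1).
case: (vpow beta eps sigma j.+1) => X Y /=.
by split; field.
Qed.

(** A phase e^{iks} shifts sigma from beta to s + beta, so the transform at s is the corresponding
    power in closed form. *)
Lemma gam_rot s j k :
  rotr (A beta j k) (B beta j k) (k * s) = A (s + beta) j k /\
  roti (A beta j k) (B beta j k) (k * s) = B (s + beta) j k.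
Proof.
elim: j => [|j [ihA ihB]].
  rewrite /A /B/= /rotr /roti; have -> : (s + beta) * k = beta * k + k * s by ring.
  by rewrite sinD cosD; split; ring.
rewrite /A /B/= -/(A (s + beta) j k) -/(B (s + beta) j k) -ihA -ihB /rotr /roti.
by split; rewrite /A /B; ring.
Qed.

End moments.

(** An integrable size for errors: their tail integrals, which enter the transport estimate, stay
    bounded. *)
Definition decay s := ((1 + s) ^+ 2)^-1.

Lemma decay_ge0 s : 0 <= decay s.
Proof. by rewrite invr_ge0 sqr_ge0. Qed.

(** The limit of - i beta/(eps - i(s + beta)) as eps tends to 0. It is real, so the imaginary part
    of the transform disappears in the limit. *)
Definition vlim (beta s : R) := beta / (s + beta).

Lemma vlim_itv beta s : 0 < beta -> 0 <= s -> 0 < vlim beta s <= 1.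
Proof.
move=> b0 s0; have sb : 0 < s + beta by rewrite ltr_wpDl.
by rewrite /vlim divr_gt0//= ler_pdivrMr// mul1r lerDr.
Qed.

Lemma vlim_decay beta s : 0 < beta -> 0 <= s -> vlim beta s ^+ 2 <= (beta + 1) ^+ 2 * decay s.
Proof.
move=> b0 s0; have sb : 0 < s + beta by rewrite ltr_wpDl.
have s1 : 0 < 1 + s by rewrite ltr_pwDl.
rewrite /decay -exprVn -exprMn; have /andP[v0 _] := vlim_itv b0 s0.
rewrite lerXn2r ?nnegrE ?(ltW v0) ?divr_ge0 ?addr_ge0 ?(ltW b0)//.
rewrite /vlim ler_pdivlMr// mulrAC ler_pdivrMr//.
by have := mulr_ge0 (ltW b0) (ltW b0); nra.
Qed.

(** Let sigma = s + beta and D = sigma^2 + eps^2. The real part of one factor misses its limit by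
    beta eps^2/(sigma D) and the imaginary part has modulus beta eps/D. Both are at most beta
    eps/sigma^2, as eps sigma <= D and sigma^2 <= D. The parts of a factor and the powers of the
    limit have modulus at most 1, so the errors of a product just add up. *)
Lemma vpow_vlim beta m : 0 < beta -> exists2 C, 0 <= C & forall eps s, 0 < eps -> 0 <= s ->
  `|(vpow beta eps (s + beta) m.+1).1 - vlim beta s ^+ m.+1| <= C * eps * decay s /\
  `|(vpow beta eps (s + beta) m.+1).2| <= C * eps * decay s.
Proof.
move=> b0.
pose C1 := (beta + 1) ^+ 2 / beta.
have C10 : 0 <= C1 by rewrite divr_ge0 ?sqr_ge0// ltW.
have base eps s : 0 < eps -> 0 <= s -> let sg := s + beta in let D := sg ^+ 2 + eps ^+ 2 in
    [/\ `|beta * sg / D - vlim beta s| <= C1 * eps * decay s,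
        `|- (beta * eps / D)| <= C1 * eps * decay s,
        `|beta * sg / D| <= 1 & `|- (beta * eps / D)| <= 1].
  move=> e0 s0 sg D; have sg0 : 0 < sg by rewrite ltr_wpDl.
  have D0 : 0 < D by rewrite addr_gt0// exprn_gt0.
  have bD : beta <= sg by rewrite lerDr.
  have key : eps * vlim beta s ^+ 2 / beta <= C1 * eps * decay s.
    rewrite /C1 (_ : _ * eps * decay s = eps * ((beta + 1) ^+ 2 * decay s) / beta); last by ring.
    by rewrite ler_pM2r ?invr_gt0// ler_pM2l// vlim_decay.
  have vE : eps * vlim beta s ^+ 2 / beta = beta * eps / sg ^+ 2.
    by rewrite /vlim -/sg; field; rewrite !gt_eqF.
  have yB : `|- (beta * eps / D)| <= beta * eps / sg ^+ 2.
    rewrite normrN ger0_norm ?divr_ge0 ?mulr_ge0 ?(ltW b0) ?(ltW e0) ?(ltW D0)//.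
    by rewrite ler_pM2l ?mulr_gt0// lef_pV2 ?posrE ?exprn_gt0// lerDl sqr_ge0.
  split.
  - have -> : beta * sg / D - vlim beta s = - (beta * eps ^+ 2 / (sg * D)).
      by rewrite /vlim -/sg /D; field; rewrite !gt_eqF.
    apply: le_trans key; rewrite vE normrN ger0_norm; last first.
      by apply: divr_ge0; apply: mulr_ge0; rewrite ?sqr_ge0 ?(ltW b0) ?(ltW sg0) ?(ltW D0).
    rewrite ler_pdivrMr ?mulr_gt0// mulrAC ler_pdivlMr ?exprn_gt0//.
    have -> : beta * eps ^+ 2 * sg ^+ 2 = (beta * eps * sg) * (eps * sg) by ring.
    have -> : beta * eps * (sg * D) = (beta * eps * sg) * D by ring.
    rewrite ler_pM2l ?mulr_gt0// /D.
    have := sqr_ge0 (eps - sg); rewrite sqrrB => H.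
    have := mulr_gt0 e0 sg0; move: H; rewrite mulr2n; lra.
  - by apply: le_trans key; rewrite vE.
  - rewrite ger0_norm ?divr_ge0 ?mulr_ge0 ?(ltW b0) ?(ltW sg0) ?(ltW D0)//.
    rewrite ler_pdivrMr// mul1r /D; have := sqr_ge0 eps.
    by have := ler_wpM2r (ltW sg0) bD; rewrite -expr2; lra.
  - rewrite normrN ger0_norm ?divr_ge0 ?mulr_ge0 ?(ltW b0) ?(ltW e0) ?(ltW D0)//.
    rewrite ler_pdivrMr// mul1r /D.
    have := sqr_ge0 (eps - sg); rewrite sqrrB mulr2n => H.
    have := ler_wpM2r (ltW e0) bD; have := mulr_gt0 e0 sg0; move: H; rewrite (mulrC sg eps); lra.
elim: m => [|m [C C0 IH]].
  exists C1 => // eps s e0 s0; have [B1 B2 _ _] := base eps s e0 s0.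
  by rewrite /= !mul1r !mul0r subr0 addr0 expr1.
exists (2 * C + C1); first by rewrite addr_ge0// mulr_ge0.
move=> eps s e0 s0; have [B1 B2 X1 Y1] := base eps s e0 s0.
have [I1 I2] := IH eps s e0 s0.
move: I1 I2; rewrite [vpow _ _ _ m.+2]/= -/(vpow beta eps (s + beta) m.+1).
case: (vpow beta eps (s + beta) m.+1) => X Y.
move: B1 B2 X1 Y1.
set x1 := beta * (s + beta) / _; set y1 := - (beta * eps / _).
move=> /= B1 B2 X1 Y1 I1 I2.
have /andP[v0 v1] := vlim_itv b0 s0; set v := vlim beta s in B1 I1 v0 v1 *.
have vm : `|v ^+ m.+1| <= 1 by rewrite ger0_norm ?exprn_ge0 ?(ltW v0)// exprn_ile1// ltW.
have mul1 (p r : R) : `|r| <= 1 -> `|p * r| <= `|p| by move=> r1; rewrite normrM ler_piMr.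
have -> : (2 * C + C1) * eps * decay s = C * eps * decay s + (C1 * eps * decay s + C * eps * decay s) by ring.
split.
  have -> : X * x1 - Y * y1 - v ^+ m.+2 =
      (X - v ^+ m.+1) * x1 + ((x1 - v) * v ^+ m.+1 - Y * y1) by rewrite [v ^+ m.+2]exprSr; ring.
  rewrite (le_trans (ler_normD _ _))// lerD ?(le_trans (mul1 _ _ X1))//.
  rewrite (le_trans (ler_normB _ _))// lerD ?(le_trans (mul1 _ _ _))//.
have -> : X * y1 + Y * x1 = (X - v ^+ m.+1) * y1 + (y1 * v ^+ m.+1 + Y * x1) by ring.
rewrite (le_trans (ler_normD _ _))// lerD ?(le_trans (mul1 _ _ Y1))//.
apply: (le_trans (ler_normD _ _)); apply: lerD.
  exact: le_trans (mul1 _ _ vm) B2.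
exact: le_trans (mul1 _ _ X1) I2.
Qed.

(** The last estimate, on the conjugate transform, is what will suppress the contribution of the
    other part of h. Both errors are relative to [decay], so that their tail integrals are of order
    eps as well. *)
Definition approximable (psi : R -> R) := exists2 C, 0 <= C & forall eps, 0 < eps ->
  exists a b, [/\ integrableR P a, integrableR P b,
    forall s, 0 <= s -> `|ftrans a b s - psi s| <= C * eps * decay s &
    forall s, 0 <= s -> `|ftrans (fun k => - b k) a s| <= C * eps * decay s].

Lemma approximable_vlim beta m : 0 < beta -> approximable (fun s => vlim beta s ^+ m.+1).
Proof.
move=> b0; have [C C0 HC] := vpow_vlim m b0; exists C => // eps e0.
pose A k := (gam beta eps beta m k).1; pose B k := (gam beta eps beta m k).2.
have [iA iB] := gam_integrable b0 e0 beta m.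
exists A, B; split => // s s0; have sb : 0 < s + beta by rewrite ltr_wpDl.
  have [I1 _] := gam_integral b0 e0 m sb.
  have -> : ftrans A B s = (vpow beta eps (s + beta) m.+1).1.
    by rewrite -I1; apply: Rintegral_eq => k _; have [] := gam_rot beta eps s m k.
  by have [] := HC eps s e0 s0.
have [_ I2] := gam_integral b0 e0 m sb.
have [_ iB'] := gam_integrable b0 e0 (s + beta) m.
have -> : ftrans (fun k => - B k) A s = - (vpow beta eps (s + beta) m.+1).2.
  rewrite -I2 -mulN1r -(RintegralZl _ mP iB'); apply: Rintegral_eq => k _.
  have [_ <-] := gam_rot beta eps s m k.
  by rewrite /rotr /roti /A /B; ring.
by rewrite normrN; have [] := HC eps s e0 s0.
Qed.

Let irotr a b s : integrableR P a -> integrableR P b -> integrableR P (fun k => rotr (a k) (b k) (k * s)).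
Proof.
move=> ia ib.
apply: (le_integrableR mP _ _ (integrableRD mP (integrableR_norm ia) (integrableR_norm ib))).
  apply: measurable_fun_rotr; [exact: integrableR_meas ia|exact: integrableR_meas ib|].
  by apply: measurable_funM; [exact: measurable_id|exact: measurable_cst].
by move=> k _; exact: norm_rotr_le.
Qed.

Lemma approximable_lin psi phi (c d : R) : approximable psi -> approximable phi ->
  approximable (fun s => c * psi s + d * phi s).
Proof.
move=> [C C0 HC] [D D0 HD]; exists (`|c| * C + `|d| * D); first by rewrite addr_ge0// mulr_ge0.
move=> eps e0; have [a [b [ia ib h1 h2]]] := HC eps e0; have [a' [b' [ia' ib' h1' h2']]] := HD eps e0.
have lin (u v u' v' : R -> R) s : integrableR P u -> integrableR P v -> integrableR P u' -> integrableR P v' ->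
   ftrans (fun k => c * u k + d * u' k) (fun k => c * v k + d * v' k) s =
   c * ftrans u v s + d * ftrans u' v' s.
  move=> iu iv iu' iv'.
  rewrite /ftrans -(RintegralZl _ mP (irotr s iu iv)) -(RintegralZl _ mP (irotr s iu' iv')).
  rewrite -(RintegralD mP (integrableRZl _ mP (irotr s iu iv)) (integrableRZl _ mP (irotr s iu' iv'))).
  by apply: Rintegral_eq => k _; rewrite /rotr; ring.
have iN (u : R -> R) : integrableR P u -> integrableR P (fun k => - u k).
  by move=> iu; apply: (integrableR_eq mP _ (integrableRZl (-1) mP iu)) => k _; ring.
exists (fun k => c * a k + d * a' k), (fun k => c * b k + d * b' k); split.
- exact: integrableRD mP (integrableRZl _ mP ia) (integrableRZl _ mP ia').
- exact: integrableRD mP (integrableRZl _ mP ib) (integrableRZl _ mP ib').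
- move=> s s0; rewrite lin//.
  have -> : c * ftrans a b s + d * ftrans a' b' s - (c * psi s + d * phi s) =
    c * (ftrans a b s - psi s) + d * (ftrans a' b' s - phi s) by ring.
  rewrite (le_trans (ler_normD _ _))// !normrM !mulrDl -!mulrA lerD// ler_wpM2l// mulrA; [exact: h1|exact: h1'].
- move=> s s0.
  have -> : ftrans (fun k => - (c * b k + d * b' k)) (fun k => c * a k + d * a' k) s =
      ftrans (fun k => c * - b k + d * - b' k) (fun k => c * a k + d * a' k) s.
    by apply: Rintegral_eq => k _; rewrite /rotr; ring.
  rewrite lin//; [|exact: iN|exact: iN].
  rewrite (le_trans (ler_normD _ _))// !normrM !mulrDl -!mulrA lerD// ler_wpM2l// mulrA; [exact: h2|exact: h2'].
Qed.

Lemma approximable_sum (I : Type) (r : seq I) (F : I -> R -> R) :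
  (forall i, approximable (F i)) -> approximable (fun s => \sum_(i <- r) F i s).
Proof.
move=> HF; elim: r => [|i r ih].
  have := approximable_lin 0 0 (approximable_vlim 0 ltr01) (approximable_vlim 0 ltr01).
  congr approximable; apply/funext => s; rewrite big_nil; ring.
have := approximable_lin 1 1 (HF i) ih.
congr approximable; apply/funext => s; rewrite big_cons; ring.
Qed.

(* Tends to the indicator function of the half-line v > 1/2, that is s < beta,
   and vanishes at v = 0. *)
Definition step_poly n (v : R) := 1 - (1 - v ^+ n) ^+ (2 ^ n).

Lemma approximable_step beta n : 0 < beta -> (0 < n)%N ->
  approximable (fun s => step_poly n (vlim beta s)).
Proof.
move=> b0 n0.
(* The zero summand only gives the monomial the shape of a combination of two approximable
   functions. *)
pose F (i : 'I_(2 ^ n)) s := - ((-1) ^+ i.+1 *+ 'C(2 ^ n, i.+1)) * vlim beta s ^+ (n * i.+1) + 0 * vlim 1 s ^+ 1.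
have aF i : approximable (F i).
  rewrite /F; have -> : (n * i.+1 = (n * i.+1).-1.+1)%N by rewrite prednK// muln_gt0 n0.
  by apply: approximable_lin; exact: approximable_vlim.
have := approximable_sum (index_enum 'I_(2 ^ n)) aF.
(* The term of index 0 in the binomial expansion cancels the leading 1, so only positive powers
   remain. *)
congr approximable; apply/funext => s; rewrite /step_poly exprBn big_ord_recl/=.
rewrite !expr0 expr1n bin0 !mulr1 mulr1n opprD addrA subrr add0r -sumrN.
apply: eq_bigr => i _; rewrite /bump leq0n add1n expr1n mulr1 -exprM /F mul0r addr0 mulNr.
by rewrite mulrnAl.
Qed.

End approximation.

(** * Approximate indicator functions *)

Section density.
Context {R : realType}.
Local Notation mu := (@lebesgue_measure R).
Local Notation Rm := (measurableTypeR R).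
Local Notation P := (`]0, +oo[%classic : set Rm).
Implicit Types (a b : R -> R) (s t x k : R).

Let mP : measurable P. Proof. exact: measurable_itvR. Qed.

Let PE x : P x = (0 < x) :> Prop.
Proof. by rewrite /= in_itv/= andbT. Qed.

Lemma is_derive_decay t : 0 <= t -> is_derive t 1 (fun y => - (1 + y)^-1) (decay t).
Proof.
move=> t0; have t1 : 1 + t != 0 by rewrite gt_eqF// ltr_pwDl.
have d1 : is_derive t 1 (fun y : R => 1 + y) 1 
  by have := is_deriveD (is_derive_cst (1 : R) t 1) (is_derive_id t (1 : R)); rewrite add0r.
have dV := is_deriveV t1 d1.
apply: is_derive_eq; rewrite /decay /GRing.scale/=.
by rewrite mulr1 opprK.
Qed.

Lemma continuous_decay t : 0 <= t -> {for t, continuous decay}.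
Proof.
move=> t0; have t1 : 1 + t != 0 by rewrite gt_eqF// ltr_pwDl.
apply: cvgV; first by rewrite expf_neq0.
apply: (@continuous_comp _ _ _ (fun y : R => 1 + y) (fun y => y ^+ 2)); last exact: exprn_continuous.
by apply: cvgD; [exact: cvg_cst|exact: cvg_id].
Qed.

Lemma decay_integral s s' : 0 <= s -> s <= s' ->
  integrableR `]s, s'] decay /\ \int[mu]_(t in `]s, s']) decay t <= 1.
Proof.
move=> s0 ss'.
have [|t /andP[st _]|I ->] := @FTC_oc R (fun y => - (1 + y)^-1) decay s s' ss'.
- by move=> t /andP[st _]; apply: is_derive_decay; exact: le_trans st.
- by apply: continuous_decay; exact: le_trans st.
split; first by apply: integrableR_itvS I; rewrite subitvE; apply/andP; split; rewrite bnd_simp.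
have : 0 <= (1 + s')^-1 by rewrite invr_ge0 addr_ge0// (le_trans s0).
have : (1 + s)^-1 <= 1 by rewrite invf_le1 ?lerDl// ltr_pwDl.
lra.
Qed.

Lemma measurable_decay : measurable_fun P decay.
Proof.
apply: open_continuous_measurable_fun; first exact: rray_open.
by move=> t; rewrite inE/= in_itv/= andbT => t0; apply: continuous_decay; exact: ltW.
Qed.

Lemma decay_le1 s : 0 <= s -> decay s <= 1.
Proof.
by move=> s0; rewrite /decay invf_le1 ?exprn_gt0 ?ltr_pwDl// exprn_ege1// lerDl.
Qed.

Lemma integrable_decay : integrableR P decay.
Proof.
apply/integrableP; split; first by apply/measurable_EFinP; exact: measurable_decay.
have -> : (\int[mu]_(x in P) `|(EFin \o decay) x| = \int[mu]_(x in P) (decay x)%:E)%E.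
  by apply: eq_integral => x _; rewrite /= ger0_norm// decay_ge0.
rewrite integral_itv_obnd_cbnd; last by apply/measurable_EFinP; exact: measurable_decay.
rewrite (@ge0_continuous_FTC2y R decay (fun y => - (1 + y)^-1) 0 0).
- by rewrite -EFinB ltry.
- by move=> x _; exact: decay_ge0.
- apply: continuous_in_subspaceT => t /set_mem/=; rewrite in_itv/= andbT; exact: continuous_decay.
- rewrite -oppr0; apply: cvgN; apply/gtr0_cvgV0.
    by near=> y; rewrite addr_gt0//; near: y; exact: nbhs_pinfty_gt.
  exact: cvg_addrl.
- by move=> x x0; have [] := is_derive_decay (ltW x0).
- apply/cvg_at_right_filter; exact: is_derive_continuous (is_derive_decay (lexx 0)).
- by move=> x; rewrite in_itv/= andbT => x0; rewrite derive1E; have [_ ->] := is_derive_decay (ltW x0).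
Unshelve. all: by end_near. Qed.

Lemma step_poly_itv n (v : R) : 0 <= v <= 1 -> 0 <= step_poly n v <= 1.
Proof.
move=> /andP[v0 v1]; rewrite /step_poly.
have /andP[w0 w1] : 0 <= v ^+ n <= 1 by rewrite exprn_ge0//= exprn_ile1.
rewrite subr_ge0 gerBl exprn_ge0 ?subr_ge0// andbT exprn_ile1 ?subr_ge0//.
by rewrite gerBl.
Qed.

Lemma bernoulli n (x : R) : -1 <= x -> 1 + n%:R * x <= (1 + x) ^+ n.
Proof.
move=> x1; elim: n => [|n ih]; first by rewrite mul0r addr0 expr0.
have x10 : 0 <= 1 + x by lra.
rewrite exprS; apply: le_trans (ler_wpM2l x10 ih).
have := mulr_ge0 (ler0n R n) (sqr_ge0 x); rewrite -natr1; nra.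
Qed.

(** Bernoulli's inequality with N = 2^n and w = v^n: 1 - (1 - w)^N <= N w, and N w = (2v)^n. This is
    where the threshold v = 1/2 comes from. *)
Lemma step_poly_le n (v : R) : 0 <= v <= 1 -> step_poly n v <= (2 * v) ^+ n.
Proof.
move=> /andP[v0 v1]; have /andP[w0 w1] : 0 <= v ^+ n <= 1 by rewrite exprn_ge0//= exprn_ile1.
have w2 : -1 <= - v ^+ n by rewrite lerN2.
have := bernoulli (2 ^ n) w2; rewrite mulrN natrX -exprMn /step_poly.
lra.
Qed.

(** With N = 2^n and w = v^n, (1 - w)^N (1 + w)^N <= 1, while (1 + w)^N >= N w = (2v)^n by
    Bernoulli's inequality. *)
Lemma step_poly_ge n (v : R) : 0 < v <= 1 -> 1 - ((2 * v) ^+ n)^-1 <= step_poly n v.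
Proof.
move=> /andP[v0 v1]; have /andP[w0 w1] : 0 < v ^+ n <= 1 by rewrite exprn_gt0//= exprn_ile1// ltW.
have w2 : -1 <= v ^+ n by apply: le_trans (ltW w0).
have B := bernoulli (2 ^ n) w2; rewrite natrX -exprMn in B.
rewrite /step_poly lerD2l lerN2.
have v20 : 0 < (2 * v) ^+ n by rewrite exprn_gt0// mulr_gt0.
rewrite -[leRHS]mul1r ler_pdivlMr//.
apply: (@le_trans _ _ ((1 - v ^+ n) ^+ (2 ^ n) * (1 + v ^+ n) ^+ (2 ^ n))).
  by rewrite ler_wpM2l ?exprn_ge0 ?subr_ge0//; lra.
rewrite -exprMn exprn_ile1//.
  by rewrite mulr_ge0 ?subr_ge0// addr_ge0// ltW.
have -> : (1 - v ^+ n) * (1 + v ^+ n) = 1 - (v ^+ n) ^+ 2 by ring.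
by rewrite gerBl sqr_ge0.
Qed.

(** For 2v <= 1 higher powers are smaller, and for 2v > 1 the bound exceeds 1. Being quadratic in v
    and uniform in n, it yields an integrable majorant in s. *)
Lemma step_poly_le_sqr n (v : R) : 0 <= v <= 1 -> step_poly n.+2 v <= (2 * v) ^+ 2.
Proof.
move=> v01; have /andP[v0 v1] := v01; have v20 : 0 <= 2 * v by rewrite mulr_ge0.
have [v2|v2] := leP (2 * v) 1.
  by apply: le_trans (step_poly_le _ v01) _; rewrite ler_wiXn2l.
have /andP[_ s1] := step_poly_itv n.+2 v01.
by apply: (le_trans s1); rewrite exprn_ege1// ltW.
Qed.

Lemma step_poly_cvg0 (v : R) : 0 <= v -> 2 * v < 1 -> step_poly n.+2 v @[n --> \oo] --> (0 : R).
Proof.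
move=> v0 v2; have v01 : 0 <= v <= 1 by rewrite v0; lra.
have c : (2 * v) ^+ n.+2 @[n --> \oo] --> (0 : R).
  rewrite (_ : (fun n : nat => _) = (fun n => (2 * v) ^+ (n + 2))); last by apply/funext => n; rewrite addn2.
  rewrite (cvg_shiftn 2 (fun n => (2 * v) ^+ n)).
  by apply: cvg_expr; rewrite ger0_norm// mulr_ge0.
apply: (squeeze_cvgr _ (cvg_cst 0) c); apply: nearW => n.
by rewrite step_poly_le// andbT; have /andP[] := step_poly_itv n.+2 v01.
Qed.

Lemma step_poly_cvg1 (v : R) : v <= 1 -> 1 < 2 * v -> step_poly n.+2 v @[n --> \oo] --> (1 : R).
Proof.
move=> v1 v2; have v0 : 0 < v by lra.
have v01 : 0 <= v <= 1 by rewrite (ltW v0).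
have c : 1 - ((2 * v) ^+ n.+2)^-1 @[n --> \oo] --> (1 : R).
  rewrite -[X in _ --> X]subr0; apply: cvgB; first exact: cvg_cst.
  rewrite (_ : (fun n : nat => _) = (fun n => ((2 * v)^-1) ^+ (n + 2))); last by apply/funext => n; rewrite addn2 exprVn.
  rewrite (cvg_shiftn 2 (fun n => (2 * v)^-1 ^+ n)).
  by apply: cvg_expr; rewrite ger0_norm ?invr_ge0 ?invf_lt1 //; lra.
apply: (@squeeze_cvgr _ _ _ _ (fun n => 1 - ((2 * v) ^+ n.+2)^-1) (cst 1) _ _ 1 c (cvg_cst _)); apply: nearW => n.
have v01' : 0 < v <= 1 by rewrite v0.
by rewrite step_poly_ge//=; have /andP[] := step_poly_itv n.+2 v01.
Qed.

Lemma measurable_vlim beta (D : set Rm) : measurable D -> D `<=` P -> 0 < beta -> measurable_fun D (vlim beta).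
Proof.
move=> mD DP b0; apply: (measurable_funS mP DP).
apply: open_continuous_measurable_fun; first exact: rray_open.
move=> t; rewrite inE/= in_itv/= andbT => t0.
apply: cvgM; first exact: cvg_cst.
apply: cvgV; first by rewrite gt_eqF// addr_gt0.
by apply: cvgD; [exact: cvg_id|exact: cvg_cst].
Qed.

Lemma measurable_step beta n (D : set Rm) : measurable D -> D `<=` P -> 0 < beta ->
  measurable_fun D (fun s => step_poly n (vlim beta s)).
Proof.
move=> mD DP b0; have mv := measurable_vlim mD DP b0.
apply: measurable_funB; first exact: measurable_cst.
apply: measurable_funX; apply: measurable_funB; first exact: measurable_cst.
exact: measurable_funX.
Qed.

Lemma vlim_half beta s : 0 < beta -> 0 <= s ->
  (s < beta -> 1 < 2 * vlim beta s) /\ (beta < s -> 2 * vlim beta s < 1).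
Proof.
move=> b0 s0; have sb : 0 < s + beta by rewrite ltr_wpDl.
rewrite /vlim mulrA; split => H; first by rewrite ltr_pdivlMr//; lra.
by rewrite ltr_pdivrMr//; lra.
Qed.

Lemma vlim_scale beta s : 0 < beta -> 0 <= s -> vlim beta (2 * s) = vlim (beta / 2) s.
Proof.
move=> b0 s0; rewrite /vlim; field.
by rewrite gt_eqF//; lra.
Qed.

(** Tends to the indicator function of ]al, be[ off the two endpoints. The shift to [n.+2] provides
    the quadratic bound, hence domination by a multiple of [decay]. *)
Definition bump_poly (al be : R) n s := step_poly n.+2 (vlim be s) - step_poly n.+2 (vlim al s).

Section bump.
Variables al be : R.
Hypotheses (al0 : 0 < al) (albe : al < be).

Let be0 : 0 < be. Proof. exact: lt_trans albe. Qed.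

Lemma bump_poly_le1 n s : 0 <= s -> `|bump_poly al be n s| <= 1.
Proof.
move=> s0; have /andP[b1 b2] := vlim_itv be0 s0; have /andP[a1 a2] := vlim_itv al0 s0.
have /andP[B0 B1] : 0 <= step_poly n.+2 (vlim be s) <= 1 by apply: step_poly_itv; rewrite (ltW b1).
have /andP[A0 A1] : 0 <= step_poly n.+2 (vlim al s) <= 1 by apply: step_poly_itv; rewrite (ltW a1).
by rewrite /bump_poly ler_norml; apply/andP; split; lra.
Qed.

Lemma bump_poly_decay : exists2 C, 0 <= C & forall n s, 0 <= s -> `|bump_poly al be n s| <= C * decay s.
Proof.
exists (4 * (be + 1) ^+ 2 + 4 * (al + 1) ^+ 2).
  by rewrite addr_ge0// mulr_ge0// sqr_ge0.
have key g n s : 0 < g -> 0 <= s -> `|step_poly n.+2 (vlim g s)| <= 4 * (g + 1) ^+ 2 * decay s.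
  move=> g0 s0; have /andP[b1 b2] := vlim_itv g0 s0.
  have v01 : 0 <= vlim g s <= 1 by rewrite (ltW b1).
  have /andP[B0 B1] := step_poly_itv n.+2 v01.
  rewrite ger0_norm// (le_trans (step_poly_le_sqr _ v01))//.
  rewrite exprMn (_ : 2 ^+ 2 = 4); last by ring.
  by rewrite -mulrA ler_pM2l// vlim_decay.
by move=> n s s0; rewrite (le_trans (ler_normB _ _))// mulrDl lerD// key.
Qed.

Lemma bump_poly_cvg0l s : 0 < s -> s < al -> bump_poly al be n s @[n --> \oo] --> (0 : R).
Proof.
move=> s0 sal; have s0' := ltW s0.
have /andP[_ b2] := vlim_itv be0 s0'; have /andP[_ a2] := vlim_itv al0 s0'.
rewrite -(subrr (1 : R)); apply: cvgB; apply: step_poly_cvg1 => //.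
  by apply: (vlim_half be0 s0').1; exact: lt_trans albe.
exact: (vlim_half al0 s0').1.
Qed.

Lemma bump_poly_cvg0r s : be < s -> bump_poly al be n s @[n --> \oo] --> (0 : R).
Proof.
move=> bes; have s0 : 0 <= s by apply: ltW; exact: lt_trans bes.
have /andP[b1 _] := vlim_itv be0 s0; have /andP[a1 _] := vlim_itv al0 s0.
rewrite -(subrr (0 : R)); apply: cvgB; apply: step_poly_cvg0; rewrite ?(ltW b1) ?(ltW a1)//.
  exact: (vlim_half be0 s0).2.
by apply: (vlim_half al0 s0).2; exact: lt_trans bes.
Qed.

Lemma bump_poly_cvg1 s : al < s -> s < be -> bump_poly al be n s @[n --> \oo] --> (1 : R).
Proof.
move=> als sbe; have s0 : 0 <= s by apply: ltW; exact: lt_trans als.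
have /andP[_ b2] := vlim_itv be0 s0; have /andP[a1 _] := vlim_itv al0 s0.
rewrite -[X in _ --> X](subr0 (1 : R)); apply: cvgB.
  by apply: step_poly_cvg1 => //; exact: (vlim_half be0 s0).1.
by apply: step_poly_cvg0; rewrite ?(ltW a1)//; exact: (vlim_half al0 s0).2.
Qed.

Lemma measurable_bump n (D : set Rm) : measurable D -> D `<=` P -> measurable_fun D (bump_poly al be n).
Proof. by move=> mD DP; apply: measurable_funB; exact: measurable_step. Qed.

Lemma approximable_bump n : approximable (bump_poly al be n).
Proof.
have := approximable_lin 1 (-1) (approximable_step be0 (ltn0Sn n.+1)) (approximable_step al0 (ltn0Sn n.+1)).
by congr approximable; apply/funext => s; rewrite /bump_poly; ring.
Qed.

Lemma bump_poly_scale n s : 0 <= s -> bump_poly al be n (2 * s) = bump_poly (al / 2) (be / 2) n s.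
Proof. by move=> s0; rewrite /bump_poly !vlim_scale. Qed.

End bump.

(** * The orthogonality relations tested against approximable functions *)

Section main_estimate.
Variables q1 q2 : R -> R.
Hypothesis mq1 : measurable_fun P q1.
Hypothesis wq1 : integrableR P (weight q1).
Hypothesis mq2 : measurable_fun P q2.
Hypothesis wq2 : integrableR P (weight q2).
Variables (Y1 Y2 Z1 Z2 : R -> R -> R) (h1 h2 : R -> R).
Hypothesis JY : jost_pair q1 Y1 Y2.
Hypothesis JZ : jost_pair q2 Z1 Z2.
Hypotheses (ih1 : integrableR P h1) (ih2 : integrableR P h2).
Hypothesis ore : forall k, 0 < k ->
  \int[mu]_(x in P) (h1 x * prodre Y1 Y2 Z1 Z2 x k - h2 x * prodim Y1 Y2 Z1 Z2 x k) = 0.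
Hypothesis oim : forall k, 0 < k ->
  \int[mu]_(x in P) (h1 x * prodim Y1 Y2 Z1 Z2 x k + h2 x * prodre Y1 Y2 Z1 Z2 x k) = 0.

(** A pair (a, b) approximating [psi] is put into the integrated relation. Up to multiples of eps,
    [U1 x] is psi(2x) with an error [K * Rh (2 * x)] and [U2 x] is 0, so the term with [h2]
    disappears as eps tends to 0. *)
Lemma orthogonality_estimate : exists2 K, 0 < K & forall (psi Rh : R -> R) (B : R),
  approximable psi ->
  measurable_fun P (fun x => psi (2 * x)) -> (forall s, 0 <= s -> `|psi s| <= B) ->
  measurable_fun P (fun x => Rh (2 * x)) ->
  (forall s, 0 <= s -> 0 <= Rh s) ->
  (forall s s', 0 <= s -> s <= s' -> Rh s' <= Rh s) ->
  (forall s s', 0 <= s -> s <= s' -> integrableR `]s, s'] (fun t => `|psi t|) /\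
     \int[mu]_(t in `]s, s']) `|psi t| <= Rh s) ->
  `|\int[mu]_(x in P) (h1 x * psi (2 * x))| <= K * \int[mu]_(x in P) (`|h1 x| * Rh (2 * x)).
Proof.
have [K K0 HK] := transport_product mq1 wq1 mq2 wq2.
exists K => // psi Rh B [C C0 HC] mpsi psiB mRh R0 Rmon Rpsi.
have x20 x : 0 < x -> 0 <= 2 * x by move=> x0; rewrite mulr_ge0// ltW.
pose N1 := \int[mu]_(x in P) `|h1 x|; pose N2 := \int[mu]_(x in P) `|h2 x|.
have N10 : 0 <= N1 by exact: Rintegral_ge0.
have N20 : 0 <= N2 by exact: Rintegral_ge0.
have mh1 := integrableR_meas ih1; have mh2 := integrableR_meas ih2.
have nh1 := integrableR_norm ih1; have nh2 := integrableR_norm ih2.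
have iR : integrableR P (fun x => `|h1 x| * Rh (2 * x)).
  apply: (le_integrableR mP _ _ (integrableRZl (Rh 0) mP nh1)).
    apply: measurable_funM => //; exact: measurableT_comp.
  move=> x; rewrite PE => x0; rewrite normrM normr_id mulrC ler_wpM2r// ger0_norm ?R0 ?x20//.
  by apply: Rmon => //; exact: x20.
have ipsi : integrableR P (fun x => h1 x * psi (2 * x)).
  apply: (le_integrableR mP _ _ (integrableRZl B mP nh1)); first exact: measurable_funM.
  by move=> x; rewrite PE => x0; rewrite normrM mulrC ler_wpM2r// psiB// x20.
suff H eps : 0 < eps -> `|\int[mu]_(x in P) (h1 x * psi (2 * x))| <=
    K * \int[mu]_(x in P) (`|h1 x| * Rh (2 * x)) + (K + 1) * C * eps * (N1 + N2).
  apply/ler_addgt0Pr => e e0.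
  have D0 : 0 < (K + 1) * C * (N1 + N2) + 1.
    by rewrite ltr_wpDl// mulr_ge0 ?addr_ge0// mulr_ge0// addr_ge0// ltW.
  apply: (le_trans (H (e / ((K + 1) * C * (N1 + N2) + 1)) (divr_gt0 e0 D0))).
  rewrite lerD2l (_ : _ * _ * _ * _ = e * (((K + 1) * C * (N1 + N2)) / ((K + 1) * C * (N1 + N2) + 1))); last by ring.
  by rewrite ler_piMr ?(ltW e0)// ler_pdivrMr// mul1r lerDl.
move=> e0; have [a [b [ia ib A1 A2]]] := HC eps e0.
have inb : integrableR P (fun k => - b k).
  by apply: (integrableR_eq mP _ (integrableRZl (-1) mP ib)) => k _; ring.
have Ce0 : 0 <= C * eps by rewrite mulr_ge0// ltW.
have dec s : 0 <= s -> C * eps * decay s <= C * eps by move=> s0; rewrite ler_piMr// decay_le1.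
pose U1 x := \int[mu]_(k in P) (a k * prodre Y1 Y2 Z1 Z2 x k - b k * prodim Y1 Y2 Z1 Z2 x k).
pose U2 x := \int[mu]_(k in P) (- b k * prodre Y1 Y2 Z1 Z2 x k - a k * prodim Y1 Y2 Z1 Z2 x k).
have decI s s' : 0 <= s -> s <= s' -> integrableR `]s, s'] (fun t => C * eps * decay t) /\
    \int[mu]_(t in `]s, s']) (C * eps * decay t) <= C * eps.
  move=> s0 ss'; have [i I] := decay_integral s0 ss'; split; first exact: integrableRZl.
  by rewrite RintegralZl// ler_piMr.
have B1 x : 0 < x -> `|U1 x - psi (2 * x)| <= K * Rh (2 * x) + (K + 1) * C * eps.
  move=> x0.
  (* The approximation error is added to the majorants; its integral over any interval is at most C
     eps, because that of [decay] is at most 1. *)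
  have := HK Y1 Y2 Z1 Z2 a b (fun s => `|psi s| + C * eps * decay s) (fun s => Rh s + C * eps) JY JZ ia ib.
  move=> /(_ _ _ _ _ x x0) T.
  have {}T : `|U1 x - ftrans a b (2 * x)| <= K * (Rh (2 * x) + C * eps).
    apply: T.
    - by move=> s s0; rewrite addr_ge0// R0.
    - by move=> s s' s0 ss'; rewrite lerD2r Rmon.
    - move=> s s' s0 ss'; have [i1 I1] := Rpsi s s' s0 ss'; have [i2 I2] := decI s s' s0 ss'.
      by split; [exact: integrableRD|rewrite RintegralD// lerD].
    - move=> s s0; rewrite -(subrK (psi s) (ftrans a b s)) addrC (le_trans (ler_normD _ _))//.
      by rewrite lerD2l A1.
  have A := le_trans (A1 (2 * x) (x20 _ x0)) (dec _ (x20 _ x0)).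
  rewrite (_ : _ - _ = (U1 x - ftrans a b (2 * x)) + (ftrans a b (2 * x) - psi (2 * x))); last by ring.
  rewrite (le_trans (ler_normD _ _))//.
  move: T A; rewrite mulrDr => T A; have := lerD T A; rewrite !mulrDl mul1r -!mulrA; lra.
have B2 x : 0 < x -> `|U2 x| <= (K + 1) * C * eps.
  move=> x0.
  (* The transform of (-b, a) is an error term altogether, so both majorants are of order eps. *)
  have := HK Y1 Y2 Z1 Z2 (fun k => - b k) a (fun s => C * eps * decay s) (fun s => C * eps) JY JZ inb ia.
  move=> /(_ _ _ _ _ x x0) T.
  have {}T : `|U2 x - ftrans (fun k => - b k) a (2 * x)| <= K * (C * eps) by exact: T.
  have A := le_trans (A2 (2 * x) (x20 _ x0)) (dec _ (x20 _ x0)).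
  rewrite -(subrK (ftrans (fun k => - b k) a (2 * x)) (U2 x)) (le_trans (ler_normD _ _))//.
  have := lerD T A; rewrite !mulrDl mul1r -!mulrA; lra.
have [i1 i2 E] := orthogonality_integrated mq1 wq1 mq2 wq2 JY JZ ih1 ih2 ore oim ia ib.
have {}E : \int[mu]_(x in P) (h1 x * U1 x) + \int[mu]_(x in P) (h2 x * U2 x) = 0 by exact: E.
have {}i1 : integrableR P (fun x => h1 x * U1 x) by exact: i1.
have {}i2 : integrableR P (fun x => h2 x * U2 x) by exact: i2.
have -> : \int[mu]_(x in P) (h1 x * psi (2 * x)) =
    - (\int[mu]_(x in P) (h1 x * U1 x - h1 x * psi (2 * x)) + \int[mu]_(x in P) (h2 x * U2 x)).
  rewrite (RintegralB mP i1 ipsi); move: E; set I1 := Rintegral _ _ _; set I2 := Rintegral _ _ _.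
  by move=> E; rewrite addrAC E; ring.
rewrite normrN (le_trans (ler_normD _ _))//.
have F1 : `|\int[mu]_(x in P) (h1 x * U1 x - h1 x * psi (2 * x))| <=
    K * \int[mu]_(x in P) (`|h1 x| * Rh (2 * x)) + (K + 1) * C * eps * N1.
  rewrite /N1 -(RintegralZl _ mP iR) -(RintegralZl _ mP nh1).
  rewrite -(RintegralD mP (integrableRZl _ mP iR) (integrableRZl _ mP nh1)).
  apply: (le_norm_Rintegral mP).
  - exact: integrableR_meas (integrableRB mP i1 ipsi).
  - move=> x; rewrite PE => x0; rewrite -mulrBr normrM.
    have -> : K * (`|h1 x| * Rh (2 * x)) + (K + 1) * C * eps * `|h1 x| =
      `|h1 x| * (K * Rh (2 * x) + (K + 1) * C * eps) by ring.
    by rewrite ler_wpM2l// B1.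
  - exact: integrableRD mP (integrableRZl _ mP iR) (integrableRZl _ mP nh1).
have F2 : `|\int[mu]_(x in P) (h2 x * U2 x)| <= (K + 1) * C * eps * N2.
  rewrite /N2 -(RintegralZl _ mP nh2); apply: (le_norm_Rintegral mP).
  - exact: integrableR_meas i2.
  - by move=> x; rewrite PE => x0; rewrite normrM mulrC ler_wpM2r// B2.
  - exact: integrableRZl _ mP nh2.
by rewrite [X in _ <= _ + X]mulrDr addrA lerD.
Qed.

End main_estimate.

End density.

(** * Vanishing of h *)

Section localization.
Context {R : realType}.
Local Notation mu := (@lebesgue_measure R).
Local Notation Rm := (measurableTypeR R).
Local Notation P := (`]0, +oo[%classic : set Rm).
Implicit Types (a b : R -> R) (s t x k : R).

Let mP : measurable P. Proof. exact: measurable_itvR. Qed.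

Let PE x : P x = (0 < x) :> Prop.
Proof. by rewrite /= in_itv/= andbT. Qed.

Lemma Rintegral_split3 (x y : R) (f : R -> R) : 0 < x -> x < y -> integrableR P f ->
  \int[mu]_(t in P) f t = \int[mu]_(t in `]0, x[) f t + \int[mu]_(t in `]x, y[) f t +
    \int[mu]_(t in `]y, +oo[) f t.
Proof.
move=> x0 xy fi.
have fx : integrableR `]x, +oo[ f by apply: integrableR_itvS fi; rewrite subitvE/= bnd_simp ltW.
rewrite (Rintegral_split (ltW x0) fi) (Rintegral_split (ltW xy) fx) addrA.
rewrite -(@Rintegral_itv_bndo_bndc _ (BRight 0) x); last first.
  by apply: integrableR_itvS fi; rewrite subitvE; apply/andP; split; rewrite ?bnd_simp ?lexx ?ltW.
rewrite -(@Rintegral_itv_bndo_bndc _ (BRight x) y)//.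
by apply: integrableR_itvS fx; rewrite subitvE; apply/andP; split; rewrite ?bnd_simp ?lexx ?ltW.
Qed.

(** * From test functions to intervals *)

Section localize.
Variables (K : R) (h1 : R -> R).
Hypotheses (K0 : 0 < K) (ih1 : integrableR P h1).
Hypothesis est : forall (psi Rh : R -> R) (B : R),
  approximable psi ->
  measurable_fun P (fun x => psi (2 * x)) -> (forall s, 0 <= s -> `|psi s| <= B) ->
  measurable_fun P (fun x => Rh (2 * x)) ->
  (forall s, 0 <= s -> 0 <= Rh s) ->
  (forall s s', 0 <= s -> s <= s' -> Rh s' <= Rh s) ->
  (forall s s', 0 <= s -> s <= s' -> integrableR `]s, s'] (fun t => `|psi t|) /\
     \int[mu]_(t in `]s, s']) `|psi t| <= Rh s) ->
  `|\int[mu]_(x in P) (h1 x * psi (2 * x))| <= K * \int[mu]_(x in P) (`|h1 x| * Rh (2 * x)).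

(** The bump functions are inserted in [est] and n tends to infinity. On the left they are bounded
    by 1, so |h1| dominates; the masses outside ]al, be[ tend to 0 by domination with [decay]. *)
Lemma interval_estimate_oo (al be : R) : 0 < al -> al < be ->
  `|\int[mu]_(x in `]al / 2, be / 2[) h1 x| <=
    K * ((be - al) * \int[mu]_(x in `]0, be / 2]) `|h1 x|).
Proof.
move=> al0 albe; have be0 := lt_trans al0 albe.
have nh1 := integrableR_norm ih1; have mh1 := integrableR_meas ih1.
pose psi n := bump_poly al be n.
have mpsi n D : measurable D -> D `<=` P -> measurable_fun D (psi n) by exact: measurable_bump.
have [C C0 HC] := bump_poly_decay al0 albe.
have ig : integrableR P (fun s => C * decay s) := integrableRZl C mP integrable_decay.
have ipsi n : integrableR P (fun s => `|psi n s|).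
  apply: integrableR_norm; apply: (le_integrableR mP (mpsi n P mP (@subset_refl _ _)) _ ig).
  by move=> s; rewrite PE => /ltW; exact: HC.
pose p n := \int[mu]_(s in `]0, al[) `|psi n s|.
pose r n := \int[mu]_(s in `]be, +oo[) `|psi n s|.
have p0 n : 0 <= p n by exact: Rintegral_ge0.
have r0 n : 0 <= r n by exact: Rintegral_ge0.
have sub1 : (`]0%R, al[ <= `]0%R, +oo[)%O by rewrite subitvE; apply/andP; split; rewrite ?bnd_simp ?lexx ?ltW.
have sub2 : (`]be, +oo[ <= `]0%R, +oo[)%O by rewrite subitvE/= bnd_simp ltW.
have sub3 : (`]al, be[ <= `]0%R, +oo[)%O by rewrite subitvE/= bnd_simp ltW.
have cvg_int0 (i : interval R) : (i <= `]0%R, +oo[)%O ->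
    (forall s, s \in i -> psi n s @[n --> \oo] --> (0 : R)) ->
    \int[mu]_(s in [set` i]) `|psi n s| @[n --> \oo] --> (0 : R).
  move=> iP H.
  have iS : [set` i] `<=` P by move=> t; exact: (subitvP iP).
  have [||||_] := @Rdominated_convergence R [set` i] (fun n s => `|psi n s|) (fun=> 0) (fun s => C * decay s) (measurable_itvR i).
  - move=> n; apply: measurableT_comp => //; exact: mpsi.
  - move=> s /H /cvg_norm; by rewrite normr0.
  - exact: integrableR_itvS ig.
  - by move=> n s /iS; rewrite PE normr_id => /ltW; exact: HC.
  by rewrite Rintegral_cst// mul0r.
have cp : p n @[n --> \oo] --> (0 : R).
  by apply: cvg_int0 => // s; rewrite in_itv/= => /andP[s0 sal]; exact: bump_poly_cvg0l.
have cr : r n @[n --> \oo] --> (0 : R).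
  by apply: cvg_int0 => // s; rewrite in_itv/= andbT => sbe; exact: bump_poly_cvg0r.
pose T n := p n + (be - al) + r n.
have T0 n : r n <= T n by rewrite /T lerDr addr_ge0// subr_ge0 ltW.
have HT n : \int[mu]_(s in P) `|psi n s| <= T n.
  rewrite (Rintegral_split3 al0 albe (ipsi n)) lerD2r lerD2l.
  have -> : be - al = \int[mu]_(s in `]al, be[) 1.
    by rewrite -[LHS]/(fine (be - al)%:E) -(lebesgue_measure_oo (ltW albe)) Rintegral_cst// mul1r.
  apply: le_Rintegral => //; first exact: integrableR_itvS (ipsi n).
    by apply: integrableR_itvS (@integrableR_cst R al be 1 (ltW albe)); rewrite subitvE; apply/andP; split; rewrite ?bnd_simp.
  move=> s; rewrite /= in_itv/= => /andP[als _]; apply: bump_poly_le1 => //.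
  by apply: ltW; exact: lt_trans als.
(* A majorant of the tail with two values: the bound on the total mass before [be], and the mass
   beyond [be] from there on. They tend to be - al and 0, so that only [h1] on ]0, be/2] remains on
   the right. *)
pose Rh n s := if s < be then T n else r n.
have bound n : `|\int[mu]_(x in P) (h1 x * psi n (2 * x))| <= K * \int[mu]_(x in P) (`|h1 x| * Rh n (2 * x)).
  apply: (@est _ _ 1).
  - exact: approximable_bump.
  - rewrite (_ : (fun x => _) = (psi n) \o (fun x => 2 * x))//.
    apply: (measurable_comp mP _ (mpsi n P mP (@subset_refl _ _))).
      by move=> _ [x x0 <-]; move: x0; rewrite !PE => x0; rewrite mulr_gt0.
    exact: measurable_funM.
  - by move=> s s0; exact: bump_poly_le1.
  - apply: measurable_funTS; apply: measurable_fun_ifT => //.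
    by apply: measurable_fun_ltr => //; exact: measurable_funM.
  - by move=> s s0; rewrite /Rh; case: ifP => // _; exact: le_trans (T0 n).
  - move=> s s' s0 ss'; rewrite /Rh; case: (ltP s' be) => s'be; first by rewrite (le_lt_trans ss').
    by case: ifP.
  - move=> s s' s0 ss'; rewrite /Rh; split.
      by apply: integrableR_itvS (ipsi n); rewrite subitvE/= bnd_simp s0.
    case: ltP => sbe.
      apply: le_trans (HT n); apply: Rintegral_itv_le => //.
      by rewrite subitvE/= bnd_simp s0.
    apply: Rintegral_itv_le => //; first by rewrite subitvE/= bnd_simp sbe.
    exact: integrableR_itvS (ipsi n).
pose N1 := \int[mu]_(x in P) `|h1 x|; pose H := \int[mu]_(x in `]0, be / 2]) `|h1 x|.
have b20 : 0 < be / 2 by rewrite divr_gt0.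
have a20 : 0 < al / 2 by rewrite divr_gt0.
have ab2 : al / 2 < be / 2 by rewrite ltr_pM2r.
have i0 : integrableR `]0, be / 2] (fun x => `|h1 x|) by apply: integrableR_itvS nh1; rewrite subitvE/= bnd_simp.
have i1 : integrableR `]be / 2, +oo[ (fun x => `|h1 x|).
  by apply: integrableR_itvS nh1; rewrite subitvE/= bnd_simp ltW.
have RHS n : \int[mu]_(x in P) (`|h1 x| * Rh n (2 * x)) <= T n * H + r n * N1.
  have iR : integrableR P (fun x => `|h1 x| * Rh n (2 * x)).
    apply: (le_integrableR mP _ _ (integrableRZl (T n) mP nh1)).
      apply: measurable_funM; first exact: measurableT_comp.
      apply: measurable_funTS; apply: measurable_fun_ifT => //.
      by apply: measurable_fun_ltr => //; exact: measurable_funM.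
    move=> x _; rewrite normrM normr_id mulrC ler_wpM2r// /Rh.
    by case: ifP => _; rewrite ger0_norm// (le_trans (r0 n)).
  rewrite (Rintegral_split (ltW b20) iR) lerD//.
    rewrite -(RintegralZl _ _ i0)//; apply: le_Rintegral => //.
    - by apply: integrableR_itvS iR; rewrite subitvE/= bnd_simp.
    - exact: integrableRZl.
    - by move=> x _; rewrite mulrC ler_wpM2r// /Rh; case: ifP.
  apply: (@le_trans _ _ (r n * \int[mu]_(x in `]be / 2, +oo[) `|h1 x|)); last first.
    rewrite ler_wpM2l//; apply: Rintegral_itv_le => //.
    by rewrite subitvE/= bnd_simp ltW.
  rewrite -(RintegralZl _ _ i1)//; apply: le_Rintegral => //.
  - by apply: integrableR_itvS iR; rewrite subitvE/= bnd_simp ltW.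
  - exact: integrableRZl.
  - move=> x; rewrite /= in_itv/= andbT => bx; rewrite mulrC ler_wpM2r// /Rh ifF//.
    by apply/negbTE; rewrite -leNgt; lra.
have cL : \int[mu]_(x in P) (h1 x * psi n (2 * x)) @[n --> \oo] --> \int[mu]_(x in `]al / 2, be / 2[) h1 x.
  have scale n x : 0 < x -> psi n (2 * x) = bump_poly (al / 2) (be / 2) n x.
    by move=> /ltW x0; rewrite /psi bump_poly_scale.
  have mpn n (i : interval R) : (i <= `]0%R, +oo[)%O -> measurable_fun [set` i] (fun x => h1 x * psi n (2 * x)).
    move=> iP; have iS : [set` i] `<=` P by move=> t; exact: (subitvP iP).
    apply: measurable_funM; first exact: measurable_funS mh1.
    rewrite (_ : (fun x => _) = (psi n) \o (fun x => 2 * x))//.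
    apply: (measurable_comp mP _ (mpsi n P mP (@subset_refl _ _))).
      by move=> _ [x /iS x0 <-]; move: x0; rewrite !PE => x0; rewrite mulr_gt0.
    exact: measurable_funM.
  have dom n x : 0 < x -> `|h1 x * psi n (2 * x)| <= `|h1 x|.
    by move=> x0; rewrite normrM ler_piMr// bump_poly_le1// mulr_ge0// ltW.
  have piece (i : interval R) (c : R) : (i <= `]0%R, +oo[)%O ->
      (forall x, x \in i -> bump_poly (al / 2) (be / 2) n x @[n --> \oo] --> c) ->
      \int[mu]_(x in [set` i]) (h1 x * psi n (2 * x)) @[n --> \oo] --> \int[mu]_(x in [set` i]) (h1 x * c).
    move=> iP Hc; have iS : [set` i] `<=` P by move=> t; exact: (subitvP iP).
    have [||||_ //] := @Rdominated_convergence R [set` i] (fun n x => h1 x * psi n (2 * x)) (fun x => h1 x * c)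
      (fun x => `|h1 x|) (measurable_itvR i).
    - by move=> n; exact: mpn.
    - move=> x ix; have x0 : 0 < x by have := iS _ ix; rewrite PE.
      apply: cvgM; first exact: cvg_cst.
      rewrite (_ : (fun n => _) = (fun n => bump_poly (al / 2) (be / 2) n x)); first exact: Hc.
      by apply/funext => n; exact: scale.
    - exact: integrableR_itvS nh1.
    - by move=> n x /iS; rewrite PE; exact: dom.
  have iall n : integrableR P (fun x => h1 x * psi n (2 * x)).
    by apply: (le_integrableR mP _ _ nh1); [exact: mpn|move=> x; rewrite PE; exact: dom].
  rewrite (_ : (fun n => _) = (fun n => \int[mu]_(x in `]0%R, al / 2[) (h1 x * psi n (2 * x)) +
     \int[mu]_(x in `]al / 2, be / 2[) (h1 x * psi n (2 * x)) +
     \int[mu]_(x in `]be / 2, +oo[) (h1 x * psi n (2 * x)))); last first.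
    by apply/funext => n; exact: Rintegral_split3.
  have -> : \int[mu]_(x in `]al / 2, be / 2[) h1 x = \int[mu]_(x in `]0%R, al / 2[) (h1 x * 0) +
     \int[mu]_(x in `]al / 2, be / 2[) (h1 x * 1) + \int[mu]_(x in `]be / 2, +oo[) (h1 x * 0).
    have E0 (D : set Rm) : measurable D -> \int[mu]_(x in D) (h1 x * 0) = 0.
      by move=> mD; rewrite (Rintegral_eq (g := fun=> 0)) => [|x _]; rewrite ?mulr0// Rintegral_cst// mul0r.
    rewrite !E0// add0r addr0; apply: Rintegral_eq => x _; by rewrite mulr1.
  apply: cvgD; first apply: cvgD; apply: piece.
  - by rewrite subitvE/= bnd_simp.
  - by move=> x; rewrite in_itv/= => /andP[? ?]; exact: bump_poly_cvg0l.
  - by rewrite subitvE/= bnd_simp ltW.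
  - by move=> x; rewrite in_itv/= => /andP[? ?]; exact: bump_poly_cvg1.
  - by rewrite subitvE/= bnd_simp ltW.
  - by move=> x; rewrite in_itv/= andbT => ?; exact: bump_poly_cvg0r.
have cR : K * (T n * H + r n * N1) @[n --> \oo] --> K * ((be - al) * H).
  have -> : K * ((be - al) * H) = K * ((0 + (be - al) + 0) * H + 0 * N1) by ring.
  apply: cvgM; first exact: cvg_cst.
  apply: cvgD; apply: cvgM; [|exact: cvg_cst|exact: cr|exact: cvg_cst].
  by apply: cvgD => //; apply: cvgD => //; exact: cvg_cst.
apply: (ler_cvg_to (cvg_norm cL) cR); apply: nearW => n.
by apply: (le_trans (bound n)); rewrite ler_pM2l// RHS.
Qed.

(** al = 2x and be = 2y undo the dilation in psi(2x), whence the factor 2. *)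
Lemma interval_estimate (x y : R) : 0 < x -> x <= y ->
  `|\int[mu]_(t in `]x, y]) h1 t| <= 2 * K * (y - x) * \int[mu]_(t in `]0, y]) `|h1 t|.
Proof.
move=> x0; rewrite le_eqVlt => /predU1P[->|xy].
  by rewrite set_itvoc0// Rintegral_set0 normr0 subrr mulr0 mul0r.
have := @interval_estimate_oo (2 * x) (2 * y); rewrite mulr_gt0// ltr_pM2l// => /(_ isT xy).
rewrite ![2 * _ / 2]mulrC !mulKf ?pnatr_eq0//.
rewrite (@Rintegral_itv_bndo_bndc _ (BRight x) y); last first.
  by apply: integrableR_itvS ih1; rewrite subitvE/= bnd_simp ltW.
by move=> E; apply: (le_trans E); rewrite -mulrBr; lra.
Qed.

End localize.

(* |h| <= M H a.e. with H' = |h|; a continuation argument on steps of length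
   less than 1/M gives H = 0. *)
Lemma ae0_of_interval_estimate (M : R) (h : R -> R) : 0 < M -> integrableR P h ->
  (forall x y : R, 0 < x -> x <= y ->
    `|\int[mu]_(t in `]x, y]) h t| <= M * (y - x) * \int[mu]_(t in `]0, y]) `|h t|) ->
  {ae mu, forall x, 0 < x -> h x = 0}.
Proof.
move=> M0 ih est.
have nh := integrableR_norm ih; have mh := integrableR_meas ih.
pose H x := \int[mu]_(t in `]0, x]) `|h t|.
have H0 x : 0 <= H x by exact: Rintegral_ge0.
have Hmon x y : x <= y -> H x <= H y.
  move=> xy; apply: Rintegral_itv_le => //; first by rewrite subitvE; apply/andP; split; rewrite ?bnd_simp ?lexx ?xy.
  by apply: integrableR_itvS nh; rewrite subitvE; apply/andP; split; rewrite ?bnd_simp ?lexx ?ltW.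
have aeF := ae_filter_ringOfSetsType mu.
have ae1 : {ae mu, forall x, 0 < x -> `|h x| <= M * H x}.
  pose g := h \_ P.
  have ig : mu.-integrable setT (EFin \o g) by exact: integrableR_patch.
  pose F x := \int[mu]_(t in `]-oo, x]) g t.
  have FE x y : 0 < x -> x <= y -> F y - F x = \int[mu]_(t in `]x, y]) h t.
    move=> x0 xy; rewrite /F (@Rintegral_itvB _ g -oo%O (BRight y) x)//; last exact: integrableS ig.
    apply: Rintegral_eq => t; rewrite /= in_itv/= => /andP[xt _].
    by rewrite /g patchE mem_set//= in_itv/= andbT (lt_trans x0).
  have dF : {ae mu, forall x, derivable F x 1 /\ derive1 F x = g x}.
    apply: FTC1Ny; first by move=> y; exact: integrableS ig.
    exact: integrable_locally.
  apply: filterS dF => x [dFx vFx] x0.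
  have d1 : is_derive x 1 F (h x).
    by apply: DeriveDef => //; rewrite -derive1E vFx /g patchE mem_set//= in_itv/= andbT.
  have d2 : is_derive x 1 (fun y => F y - h x * y) 0.
    have := is_deriveB d1 (is_deriveZ (h x) (is_derive_id x (1 : R))).
    by rewrite /GRing.scale/= mulr1 subrr.
  apply/ler_addgt0Pr => e e0.
  have [d d0 Hd] := is_derive0_small d2 e0.
  (* A point to the left of [x] is used, so that the hypothesis on ]y, x] involves [H x] itself. It
     is kept positive and within distance [d]. *)
  pose y := x - Num.min (d / 2) (x / 2).
  have m0 : 0 < Num.min (d / 2) (x / 2) by rewrite lt_min !divr_gt0.
  have m1 : Num.min (d / 2) (x / 2) <= d / 2 by rewrite ge_min lexx.
  have m2 : Num.min (d / 2) (x / 2) <= x / 2 by rewrite ge_min lexx orbT.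
  have y0 : 0 < y by rewrite /y; lra.
  have yx : y < x by rewrite /y; lra.
  have yxd : `|y - x| = x - y by rewrite distrC ger0_norm// subr_ge0 ltW.
  have := Hd y; rewrite yxd => /(_ _)/wrap[]; first by rewrite /y; lra.
  move=> E; have E2 := est y x y0 (ltW yx); rewrite -(FE y x y0 (ltW yx)) in E2.
  rewrite -(ler_pM2r (x := x - y)) ?subr_gt0//.
  rewrite -[x in _ * x]gtr0_norm ?subr_gt0// -normrM.
  have -> : h x * (x - y) = (F y - h x * y - (F x - h x * x)) + (F x - F y) by ring.
  apply: (le_trans (ler_normD _ _)); rewrite [_ + e]addrC mulrDl.
  by apply: lerD => //; apply: (le_trans E2); rewrite -/(H x) mulrAC.
have step u v : 0 <= u -> u <= v -> \int[mu]_(t in `]u, v]) `|h t| <= M * H v * (v - u).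
  move=> u0 uv.
  have iuv : integrableR `]u, v] (fun t => `|h t|).
    by apply: integrableR_itvS nh; rewrite subitvE/= bnd_simp u0.
  have E1 : (\int[mu]_(t in `]u, v]) `|h t|)%:E = (\int[mu]_(t in `]u, v]) `|h t|%:E)%E.
    by rewrite /Rintegral fineK//; exact: integrable_fin_num iuv.
  have E2 : (M * H v * (v - u))%:E = (\int[mu]_(t in `]u, v]) (M * H v)%:E)%E.
    by rewrite integral_cst// EFinM; congr (_ * _)%E; exact/esym/lebesgue_measure_oc.
  rewrite -lee_fin E1 E2.
  apply: ae_ge0_le_integral => //.
  - by have /integrableP[] := iuv.
  - by move=> x _; rewrite lee_fin mulr_ge0// ltW.
  apply: filterS ae1 => x Hx; rewrite /= in_itv/= => /andP[ux xv].
  have x0 := le_lt_trans u0 ux.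
  by rewrite lee_fin (le_trans (Hx x0))// ler_pM2l// Hmon.
pose d := (M + 1)^-1.
have d0 : 0 < d by rewrite invr_gt0 addr_gt0.
have Md : M * d < 1 by rewrite ltr_pdivrMr ?addr_gt0// mul1r ltrDl.
have Hz n : H (n%:R * d) = 0.
  elim: n => [|n ihn]; first by rewrite mul0r /H set_itvoc0// Rintegral_set0.
  have nd0 : 0 <= n%:R * d by rewrite mulr_ge0// ltW.
  have nd1 : n%:R * d <= n.+1%:R * d by rewrite ler_pM2r// ler_nat.
  have := step _ _ nd0 nd1.
  have : H (n.+1%:R * d) = H (n%:R * d) + \int[mu]_(t in `](n%:R * d), (n.+1%:R * d)]) `|h t|.
    have A0 := Rintegral_split (le_trans nd0 nd1) nh.
    have A1 := Rintegral_split nd0 nh.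
    have A2 := @Rintegral_split R (n%:R * d) (n.+1%:R * d) (fun t => `|h t|) nd1.
    rewrite A1 A2 in A0; first by rewrite /H; lra.
    by apply: integrableR_itvS nh; rewrite subitvE; apply/andP; split; rewrite ?bnd_simp ?lexx ?nd0.
  rewrite ihn add0r => <-.
  have -> : n.+1%:R * d - n%:R * d = d by rewrite -natr1; ring.
  move=> A; apply/eqP; rewrite eq_le H0 andbT leNgt; apply/negP => Hp.
  move: A; rewrite mulrAC -[leLHS]mul1r ler_pM2r// leNgt Md//.
have Hn n : H n%:R = 0.
  apply/eqP; rewrite eq_le H0 andbT -(Hz (Num.bound (n%:R * (M + 1)))); apply: Hmon.
  rewrite ler_pdivlMr ?addr_gt0//; apply: ltW; apply: archi_boundP.
  by rewrite mulr_ge0// addr_ge0// ltW.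
have I0 : \int[mu]_(t in P) `|h t| = 0.
  have cv := Rintegral_pinfty_cvg nh.
  rewrite (_ : (fun n : nat => _) = (fun=> 0)) in cv; last by apply/funext => n; rewrite add0r; exact: Hn.
  exact: (cvg_unique _ cv (cvg_cst 0)).
have I1 : (\int[mu]_(t in P) `|(h t)%:E| = 0)%E.
  have E : (\int[mu]_(t in P) `|h t|)%:E = (\int[mu]_(t in P) `|h t|%:E)%E.
    by rewrite /Rintegral fineK//; exact: integrable_fin_num nh.
  by rewrite I0 in E; exact: esym E.
have mhE : measurable_fun P (EFin \o h) by apply/measurable_EFinP.
have A := (ae_eq_integral_abs mu mP mhE).1 I1.
by apply: filterS A => x Hx x0; have [] : (h x)%:E = 0%:E by apply: Hx; rewrite PE.
Qed.

End localization.

(** * Property C *)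

Section property_C.
Context {R : realType}.
Local Notation mu := (@lebesgue_measure R).
Local Notation Rm := (measurableTypeR R).
Local Notation P := (`]0, +oo[%classic : set Rm).
Local Notation Re := (@complex.Re R).
Local Notation Im := (@complex.Im R).
Local Open Scope complex_scope.

Let mP : measurable P. Proof. exact: measurable_itvR. Qed.

Let PE (x : R) : P x = (0 < x) :> Prop.
Proof. by rewrite /= in_itv/= andbT. Qed.

Lemma pinfty_nbhs_gt (A : set R) : (\forall x \near +oo, A x) -> exists B : R, forall x, B < x -> A x.
Proof. by move=> [B [_ HB]]; exists B. Qed.

Lemma cexp_ix (k x : R) : cexp ((0 +i* 1) * k%:C * x%:C) = cos (k * x) +i* sin (k * x).
Proof.
rewrite /cexp /=; rewrite !(mul0r, mulr0, mul1r, subr0, add0r, addr0, oppr0).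
by rewrite expR0 !mul1r.
Qed.

(** f/e^{ikx} - 1 is multiplied back by e^{ikx}, of modulus 1 for real k; each part of the product
    is a sum of two terms smaller than e/2. *)
Lemma jost_asymptotics (k : R) (f : R -> R[i]) (e : R) : 0 < e ->
  ccvg_pinfty (fun x => f x / cexp ((0 +i* 1) * k%:C * x%:C)) 1 ->
  exists A : R, forall x, A < x -> `|Re (f x) - cos (k * x)| < e /\ `|Im (f x) - sin (k * x)| < e.
Proof.
move=> e0 [/cvgrPdist_lt cu /cvgrPdist_lt cv].
have e2 : 0 < e / 2 by rewrite divr_gt0.
have [A HA] := pinfty_nbhs_gt (cu _ e2); have [B HB] := pinfty_nbhs_gt (cv _ e2).
exists (Num.max A B) => x; rewrite gt_max => /andP[/HA Hu /HB Hv].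
move: Hu Hv; rewrite cexp_ix; set E := _ +i* _ => Hu Hv.
have E0 : E != 0.
  apply/eqP => E0; have := cos2Dsin2 (k * x).
  have [-> ->] : cos (k * x) = 0 /\ sin (k * x) = 0 by case: E0.
  by rewrite expr0n/= addr0 => /eqP; rewrite eq_sym oner_eq0.
have := divfK E0 (f x); case: (f x / E) Hu Hv => u v /= Hu Hv <-.
rewrite /E/=.
have c1 := norm_cos_le1 (k * x); have s1 := norm_sin_le1 (k * x).
have key (p q c s : R) : `|p| < e / 2 -> `|q| < e / 2 -> `|c| <= 1 -> `|s| <= 1 -> `|p * c + q * s| < e.
  move=> Hp Hq Hc Hs; apply: (le_lt_trans (ler_normD _ _)); rewrite !normrM (splitr e).
  by apply: ltrD; [apply: le_lt_trans Hp|apply: le_lt_trans Hq]; rewrite ler_piMr.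
split.
- have -> : u * cos (k * x) - v * sin (k * x) - cos (k * x) = - ((1 - u) * cos (k * x) + (v - 0) * sin (k * x)) by ring.
  by rewrite normrN; apply: key => //; rewrite distrC.
- have -> : u * sin (k * x) + v * cos (k * x) - sin (k * x) = (v - 0) * cos (k * x) + (u - 1) * sin (k * x) by ring.
  by apply: key => //; rewrite distrC.
Qed.

Lemma L11_weight (q : R -> R) : L11 q -> measurable_fun P q /\ integrableR P (weight q).
Proof.
move=> [mq iq _]; have sub : P `<=` (Rplus : set Rm).
  by move=> x; rewrite PE /Rplus/= in_itv/= andbT => /ltW.
by split; [exact: measurable_funS mq|exact: integrableS iq].
Qed.

(** For real k both [q] and k^2 are real, so the differential equation splits into the same equation
    for the real and for the imaginary part, with asymptotics cos(kx) and sin(kx). *)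
Lemma jost_family_pair (q : R -> R) (f : R -> R[i] -> R[i]) : L11 q -> jost_family q f ->
  jost_pair q (fun x k => Re (f x k%:C)) (fun x k => Im (f x k%:C)).
Proof.
move=> /L11_weight[mq wq] Jf.
have qi := potential_integrable mq wq.
have aeF := ae_filter_ringOfSetsType mu.
have H k : 0 < k -> jost_component q k 1 0 (fun x => Re (f x k%:C)) /\
    jost_component q k 0 1 (fun x => Im (f x k%:C)).
  move=> k0; have [[g [dg acg aeg]] asy] := Jf k%:C (lexx 0).
  split.
  - apply: (@jost_component_ode _ q _ (fun x => Re (g x))) => //.
    + by move=> x x0; have [] := dg x x0.
    + by move=> u v u0 uv; have [] := acg u v u0 uv.
    + apply: filterS aeg => x Hx x0; have [g' [dg' _] E] := Hx x0.
      rewrite (_ : _ * _ = Re g')//; move/eqP: E; rewrite eq_complex expr2.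
      by case: (f x k%:C) => fr fi; case: g' {dg'} => gr gi /= /andP[/eqP E _]; lra.
    + move=> e e0; have [A HA] := jost_asymptotics e0 asy; exists A => x /HA[].
      by rewrite mul1r mul0r addr0.
  - apply: (@jost_component_ode _ q _ (fun x => Im (g x))) => //.
    + by move=> x x0; have [] := dg x x0.
    + by move=> u v u0 uv; have [] := acg u v u0 uv.
    + apply: filterS aeg => x Hx x0; have [g' [_ dg'] E] := Hx x0.
      rewrite (_ : _ * _ = Im g')//; move/eqP: E; rewrite eq_complex expr2.
      by case: (f x k%:C) => fr fi; case: g' {dg'} => gr gi /= /andP[_ /eqP E]; lra.
    + move=> e e0; have [A HA] := jost_asymptotics e0 asy; exists A => x /HA[_].
      by rewrite mul1r mul0r add0r.
by split => k k0; have [] := H k k0.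
Qed.

Lemma Rintegral_Rplus (F : R -> R) : measurable_fun P F ->
  \int[mu]_(x in Rplus) F x = \int[mu]_(x in P) F x.
Proof.
by move=> mF; rewrite /Rintegral integral_itv_obnd_cbnd//; apply/measurable_EFinP.
Qed.

Lemma orthogonal_ae0 (q1 q2 : R -> R) (Y1 Y2 Z1 Z2 : R -> R -> R) (h1 h2 : R -> R) :
  L11 q1 -> L11 q2 -> jost_pair q1 Y1 Y2 -> jost_pair q2 Z1 Z2 ->
  integrableR P h1 -> integrableR P h2 ->
  (forall k, 0 < k ->
    \int[mu]_(x in P) (h1 x * prodre Y1 Y2 Z1 Z2 x k - h2 x * prodim Y1 Y2 Z1 Z2 x k) = 0) ->
  (forall k, 0 < k ->
    \int[mu]_(x in P) (h1 x * prodim Y1 Y2 Z1 Z2 x k + h2 x * prodre Y1 Y2 Z1 Z2 x k) = 0) ->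
  {ae mu, forall x, 0 < x -> h1 x = 0}.
Proof.
move=> /L11_weight[mq1 wq1] /L11_weight[mq2 wq2] JY JZ ih1 ih2 ore oim.
have [K K0 est] := orthogonality_estimate mq1 wq1 mq2 wq2 JY JZ ih1 ih2 ore oim.
have K20 : 0 < 2 * K by rewrite mulr_gt0.
by apply: (ae0_of_interval_estimate K20 ih1) => x y; exact: interval_estimate.
Qed.

End property_C.

Theorem theorem2p1p1 (R : realType) (q1 q2 : R -> R)
  (hq1 : L11 q1) (hq2 : L11 q2) : property_Cplus q1 q2.
Proof.
move=> f1 f2 J1 J2 h [ihr ihi] orth.
pose mu := @lebesgue_measure R.
pose P : set (measurableTypeR R) := `]0, +oo[%classic.
have mP : measurable P by exact: measurable_itvR.
have PE (x : R) : P x = (0 < x) :> Prop by rewrite /P/= in_itv/= andbT.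
pose Y1 x k := complex.Re (f1 x (real_complex R k)); pose Y2 x k := complex.Im (f1 x (real_complex R k)).
pose Z1 x k := complex.Re (f2 x (real_complex R k)); pose Z2 x k := complex.Im (f2 x (real_complex R k)).
pose h1 x := complex.Re (h x); pose h2 x := complex.Im (h x).
have JY : jost_pair q1 Y1 Y2 := jost_family_pair hq1 J1.
have JZ : jost_pair q2 Z1 Z2 := jost_family_pair hq2 J2.
have sub : P `<=` (Rplus : set (measurableTypeR R)).
  by move=> x; rewrite PE /Rplus/= in_itv/= andbT => /ltW.
have [mq1 wq1] := L11_weight hq1; have [mq2 wq2] := L11_weight hq2.
have ih1 : integrableR P h1 by exact: integrableS ihr.
have ih2 : integrableR P h2 by exact: integrableS ihi.
have mJ (y : R -> R) : (forall x, 0 < x -> {for x, continuous y}) -> measurable_fun P y.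
  move=> cy; apply: open_continuous_measurable_fun; first exact: rray_open.
  by move=> x; rewrite inE PE; exact: cy.
have mprod k : 0 < k -> measurable_fun P (fun x => prodre Y1 Y2 Z1 Z2 x k) /\
    measurable_fun P (fun x => prodim Y1 Y2 Z1 Z2 x k).
  move=> k0; have [y1 _ _] := JY.1 k k0; have [y2 _ _] := JY.2 k k0.
  have [z1 _ _] := JZ.1 k k0; have [z2 _ _] := JZ.2 k k0.
  by split; [apply: measurable_funB|apply: measurable_funD]; apply: measurable_funM; exact: mJ.
have mh1 := integrableR_meas ih1; have mh2 := integrableR_meas ih2.
have O k : 0 < k ->
    \int[mu]_(x in P) (h1 x * prodre Y1 Y2 Z1 Z2 x k - h2 x * prodim Y1 Y2 Z1 Z2 x k) = 0 /\
    \int[mu]_(x in P) (h1 x * prodim Y1 Y2 Z1 Z2 x k + h2 x * prodre Y1 Y2 Z1 Z2 x k) = 0.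
  move=> k0; have [mre mim] := mprod k k0; have [Er Ei] := orth k k0.
  split.
  - rewrite -[RHS]Er -Rintegral_Rplus; last by apply: measurable_funB; exact: measurable_funM.
    apply: eq_Rintegral => x _; rewrite /prodre /prodim /Y1 /Y2 /Z1 /Z2 /h1 /h2.
    by case: (h x) (f1 x _) (f2 x _) => [a b] [c d] [u v] /=; ring.
  - rewrite -[RHS]Ei -Rintegral_Rplus; last by apply: measurable_funD; exact: measurable_funM.
    apply: eq_Rintegral => x _; rewrite /prodre /prodim /Y1 /Y2 /Z1 /Z2 /h1 /h2.
    by case: (h x) (f1 x _) (f2 x _) => [a b] [c d] [u v] /=; ring.
have A1 : {ae mu, forall x, 0 < x -> h1 x = 0}.
  by apply: (orthogonal_ae0 hq1 hq2 JY JZ ih1 ih2) => k k0; have [] := O k k0.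
have ihN : integrableR P (fun x => - h1 x).
  by apply: (integrableR_eq mP _ (integrableRZl (-1) mP ih1)) => x _; rewrite mulN1r.
(* The orthogonality relations are complex linear: apply them to -i h. *)
have A2 : {ae mu, forall x, 0 < x -> h2 x = 0}.
  apply: (orthogonal_ae0 hq1 hq2 JY JZ ih2 ihN) => k k0; have [I1 I2] := O k k0.
    by rewrite -[RHS]I2; apply: Rintegral_eq => x _; ring.
  pose F x := h1 x * prodre Y1 Y2 Z1 Z2 x k - h2 x * prodim Y1 Y2 Z1 Z2 x k.
  have iF : integrableR P F.
    have [mre mim] := mprod k k0; have [C C0 HC] := jost_product_bounded mq1 wq1 mq2 wq2 JY JZ.
    apply: (le_integrableR mP _ _ (integrableRD mP (integrableRZl C mP (integrableR_norm ih1))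
      (integrableRZl C mP (integrableR_norm ih2)))).
      by apply: measurable_funB; exact: measurable_funM.
    move=> x; rewrite PE => x0; have [B1 B2] := HC x k x0 k0.
    by rewrite (le_trans (ler_normB _ _))// !normrM ![C * _]mulrC lerD// ler_wpM2l.
  rewrite (Rintegral_eq (g := fun x => (-1) * F x)) => [|x _]; last by rewrite /F; ring.
  by rewrite (RintegralZl _ mP iF) [X in _ * X]I1 mulr0.
have aeF := ae_filter_ringOfSetsType mu.
(* The estimates concern the open half-line, whereas [Rplus] contains 0; this point is discarded as
   a null set. *)
have A3 : {ae mu, forall x : R, x != 0}.
  exists [set 0]; split => //; first exact: lebesgue_measure_set1.
  by move=> x /= /negP; rewrite negbK => /eqP.
apply: filterS3 A1 A2 A3 => x Hr Hi x0 Rx.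
have xp : 0 < x by rewrite lt_neqAle eq_sym x0; move: Rx; rewrite /Rplus/= in_itv/= andbT.
by move: (Hr xp) (Hi xp); rewrite /h1 /h2; case: (h x) => a b /= -> ->.
Qed.
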